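(* Let $\tau>0$, let $\mathbf{k}\in\mathbb{Z}^3$ with $k=|\mathbf{k}|$ satisfying $0<k<k_{\rm crit,min}=\sqrt{\pi/2}\,/\tau$, and let $\mathcal{L}_{\mathbf{k}}$, the hydrodynamic eigenfunctions, the hydrodynamic manifold $\mathcal{M}_{{\rm hydro},\mathbf{k}}$, the function $\theta$ and the matrix $\mathbf{H}$ be as in the context. Then $\mathbf{H}$ is invertible, and for every solution $t\mapsto\hat f(t)\in\mathcal{M}_{{\rm hydro},\mathbf{k}}$ of $\partial_t\hat f=\mathcal{L}_{\mathbf{k}}\hat f$, the vector of macroscopic moments $\hat{\mathbf{h}}=(\langle\hat f,e_0\rangle_{\mathbf{v}},\dots,\langle\hat f,e_4\rangle_{\mathbf{v}})^T$ satisfies $$\frac{d\hat{\mathbf{h}}}{dt}=\mathbf{H}\boldsymbol{\Lambda}\mathbf{H}^{-1}\hat{\mathbf{h}},\qquad \boldsymbol{\Lambda}=\mathrm{diag}(\lambda_{\rm diff},\lambda_{\rm ac},\lambda_{\rm ac}^*,\lambda_{\rm shear},\lambda_{\rm shear}),$$ and $$\mathbf{H}\boldsymbol{\Lambda}\mathbf{H}^{-1}=\tilde{\mathbf{Q}}_{\mathbf{k}}\begin{pmatrix}0&-\mathrm{i}k&0&0&0\\ C_1&C_2&0&0&C_3\\0&0&\lambda_{\rm shear}&0&0\\0&0&0&\lambda_{\rm shear}&0\\ C_4&C_5&0&0&C_6\end{pmatrix}\tilde{\mathbf{Q}}_{\mathbf{k}}^T,$$ where, with all sums and products running over the three cyclic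 permutations $(\lambda_1,\lambda_2,\lambda_3)$ of $(\lambda_{\rm diff},\lambda_{\rm ac},\lambda_{\rm ac}^* )$, $$C_1=\frac{1}{k^2\det\mathbf{H}}\sum\lambda_1\lambda_3(\lambda_1-\lambda_3)\theta(\lambda_2),\qquad C_2=\frac{\mathrm{i}}{k\det\mathbf{H}}\sum(\lambda_1^2-\lambda_3^2)\theta(\lambda_2),$$ $$C_3=-\frac{1}{k^2\det\mathbf{H}}\prod(\lambda_1-\lambda_2),\qquad C_4=\frac{\mathrm{i}}{k\det\mathbf{H}}\sum\lambda_2(\lambda_1-\lambda_3)\theta(\lambda_1)\theta(\lambda_3),$$ $$C_5=\frac{1}{\det\mathbf{H}}\sum(\lambda_3-\lambda_1)\theta(\lambda_1)\theta(\lambda_3),\qquad C_6=-\frac{\mathrm{i}}{k\det\mathbf{H}}\sum\lambda_1\theta(\lambda_1)(\lambda_2-\lambda_3).$$ Moreover $C_1,C_3,C_5$ are purely imaginary and $C_2,C_4,C_6$ are real.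
   Context: Let $\mathcal{H}_{\mathbf{v}}=L^2(\mathbb{R}^3,(2\pi)^{-3/2}e^{-|\mathbf{v}|^2/2}d\mathbf{v})$ (complex-valued functions), with inner product $\langle f,g\rangle_{\mathbf{v}}=(2\pi)^{-3/2}\int_{\mathbb{R}^3}f(\mathbf{v})g^*(\mathbf{v})e^{-|\mathbf{v}|^2/2}\,d\mathbf{v}$, where $*$ denotes complex conjugation. The functions $e_0=1$, $e_j=v_j$ ($j=1,2,3$), $e_4=(|\mathbf{v}|^2-3)/\sqrt6$ are orthonormal, and $\mathbb{P}_5f=\sum_{j=0}^4\langle f,e_j\rangle_{\mathbf{v}}e_j$. For $\mathbf{k}=(k_1,k_2,k_3)$, $k=|\mathbf{k}|$, and relaxation time $\tau>0$, the operator is $$\mathcal{L}_{\mathbf{k}}=-\mathrm{i}\,\mathbf{v}\cdot\mathbf{k}-\tfrac1\tau(1-\mathbb{P}_5)$$ on $\mathcal{H}_{\mathbf{v}}$ with its natural (maximal) domain. Known spectral facts (prior work, taken as given): for $0<k<k_{\rm crit,min}=\sqrt{\pi/2}/\tau$, the essential spectrum of $\mathcal{L}_{\mathbf{k}}$ is the line $\Re\lambda=-1/\tau$, and the eigenvalues off this line all lie in $-1/\tau<\Re\lambda<0$ and are exactly: a real eigenvalue $\lambda_{\rm diff}$ and a non-real conjugate pair $\lambda_{\rm ac},\lambda_{\rm ac}^*$ ($\Im\lambda_{\rm ac}>0$), all of algebraic multiplicity one, and a real eigenvalue $\lambda_{\rm shear}$ of algebraic and geometric multiplicity two. The hydrodynamic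 manifold $\mathcal{M}_{{\rm hydro},\mathbf{k}}$ is the five-dimensional linear span of all eigenfunctions of $\mathcal{L}_{\mathbf{k}}$ for these eigenvalues. $\mathbf{Q}_{\mathbf{k}}$ is a $3\times3$ rotation matrix with $\mathbf{Q}_{\mathbf{k}}(k,0,0)^T=\mathbf{k}$, and $\tilde{\mathbf{Q}}_{\mathbf{k}}=\mathrm{diag}(1,\mathbf{Q}_{\mathbf{k}},1)$ ($5\times5$ block-diagonal). The plasma dispersion function is $Z(\zeta)=\frac1{\sqrt{2\pi}}\int_{\mathbb{R}}\frac{e^{-v^2/2}}{v-\zeta}\,dv$, $\zeta\in\mathbb{C}\setminus\mathbb{R}$, and the spectral temperature is $$\theta(\lambda)=\frac{\sqrt{6}\left(\big(k^2\tau^2-\tau\lambda(\tau\lambda+1)\big)\,Z\!\left(\frac{\mathrm{i}(\tau\lambda+1)}{k\tau}\right)-\mathrm{i}k\tau\,(k^2\tau^2-\tau\lambda)\right)}{\big(k^2\tau^2+(\tau\lambda+1)^2\big)\,Z\!\left(\frac{\mathrm{i}(\tau\lambda+1)}{k\tau}\right)-\mathrm{i}k\tau(\tau\lambda+1)} .$$ The matrix of spectral basis vectors is $$\mathbf{H}=\tilde{\mathbf{Q}}_{\mathbf{k}}\begin{pmatrix}1&1&1&0&0\\ \frac{\mathrm{i}}{k}\lambda_{\rm diff}&\frac{\mathrm{i}}{k}\lambda_{\rm ac}&\frac{\mathrm{i}}{k}\lambda_{\rm ac}^*&0&0\\0&0&0&1&0\\0&0&0&0&1\\ \theta(\lambda_{\rm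 diff})&\theta(\lambda_{\rm ac})&\theta(\lambda_{\rm ac}^* )&0&0\end{pmatrix}.$$ Its columns are the vectors $(\langle f,e_0\rangle_{\mathbf{v}},\dots,\langle f,e_4\rangle_{\mathbf{v}})^T$ of moments of suitably normalized eigenfunctions $f$ of $\mathcal{L}_{\mathbf{k}}$ for $\lambda_{\rm diff},\lambda_{\rm ac},\lambda_{\rm ac}^*$ (normalized by $\langle f,1\rangle_{\mathbf{v}}=1$) and of a suitable basis of the eigenspace of $\lambda_{\rm shear}$. *)

(* Defs.v *)
From HB Require Import structures.
From mathcomp Require Import all_boot all_order all_algebra.
From mathcomp Require Import all_classical all_reals all_analysis.
From mathcomp Require Import complex.

Set Implicit Arguments.
Unset Strict Implicit.
Unset Printing Implicit Defensive.

Import Order.TTheory GRing.Theory Num.Theory.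
Import numFieldNormedType.Exports.

Local Open Scope classical_set_scope.
Local Open Scope ring_scope.
Local Open Scope complex_scope.

Local Notation Re := complex.Re.
Local Notation Im := complex.Im.

(* The elements of the Hilbert space H_v are represented by functions
   satisfying [inL2]; equality in H_v is almost-everywhere equality [aeq].
   The Gaussian weight is positive, so Lebesgue null sets are the right ones. *)
Notation R3 R :=
  (measurableTypeR R * measurableTypeR R * measurableTypeR R)%type.

Definition leb3 (R : realType) : {measure set (R3 R) -> \bar R} :=
  ((@lebesgue_measure R \x @lebesgue_measure R) \x @lebesgue_measure R)%E.

Definition sqnorm3 (R : realType) (v : R3 R) : R :=
  v.1.1 ^+ 2 + v.1.2 ^+ 2 + v.2 ^+ 2.

Definition maxwellian (R : realType) (v : R3 R) : R :=
  (Num.sqrt (2 * pi) ^+ 3)^-1 * expR (- (sqnorm3 v / 2)).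

Definition cintegral (d : measure_display) (T : measurableType d)
    (R : realType) (mu : {measure set T -> \bar R}) (f : T -> R[i]) : R[i] :=
  (\int[mu]_x Re (f x)) +i* (\int[mu]_x Im (f x)).

Definition inL2 (R : realType) (f : R3 R -> R[i]) : Prop :=
  [/\ measurable_fun [set: R3 R] (fun v => Re (f v)),
      measurable_fun [set: R3 R] (fun v => Im (f v)) &
      (leb3 R).-integrable [set: R3 R]
        (fun v => ((Re (f v) ^+ 2 + Im (f v) ^+ 2) * maxwellian v)%:E)].

Definition aeq (R : realType) (f g : R3 R -> R[i]) : Prop :=
  {ae leb3 R, forall v, f v = g v}.

Definition inner (R : realType) (f g : R3 R -> R[i]) : R[i] :=
  cintegral (leb3 R) (fun v => f v * conjc (g v) * (maxwellian v)%:C).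

Definition normv (R : realType) (f : R3 R -> R[i]) : R :=
  Num.sqrt (Re (inner f f)).

Definition ebasis (R : realType) (j : 'I_5) (v : R3 R) : R[i] :=
  (nth 0 [:: 1; v.1.1; v.1.2; v.2; (sqnorm3 v - 3) / Num.sqrt 6] j)%:C.

Definition P5 (R : realType) (f : R3 R -> R[i]) : R3 R -> R[i] :=
  fun v => \sum_(j < 5) inner f (ebasis j) * ebasis j v.

Definition dot3 (R : realType) (v : R3 R) (k : 'cV[R]_3) : R :=
  v.1.1 * k 0 0 + v.1.2 * k 1 0 + v.2 * k 2 0.

Definition Lop (R : realType) (tau : R) (k : 'cV[R]_3)
    (f : R3 R -> R[i]) : R3 R -> R[i] :=
  fun v => - 'i%C * (dot3 v k)%:C * f v - (tau^-1)%:C * (f v - P5 f v).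

(* The maximal domain: as L_k differs from multiplication by -i v.k by a
   bounded operator, this is the set of f in H_v with (v.k) f in H_v. *)
Definition in_dom (R : realType) (tau : R) (k : 'cV[R]_3)
    (f : R3 R -> R[i]) : Prop :=
  inL2 f /\ inL2 (Lop tau k f).

Definition Lsub (R : realType) (tau : R) (k : 'cV[R]_3) (lam : R[i])
    (f : R3 R -> R[i]) : R3 R -> R[i] :=
  fun v => Lop tau k f v - lam * f v.

Definition eigenspace_of (R : realType) (tau : R) (k : 'cV[R]_3) (lam : R[i])
    (f : R3 R -> R[i]) : Prop :=
  in_dom tau k f /\ aeq (Lop tau k f) (fun v => lam * f v).

Definition eigenfunction (R : realType) (tau : R) (k : 'cV[R]_3) (lam : R[i])
    (f : R3 R -> R[i]) : Prop :=
  eigenspace_of tau k lam f /\ ~ aeq f (fun=> 0).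

Definition is_eigenvalue (R : realType) (tau : R) (k : 'cV[R]_3)
    (lam : R[i]) : Prop :=
  exists f, eigenfunction tau k lam f.

Fixpoint ker_pow (R : realType) (tau : R) (k : 'cV[R]_3) (lam : R[i])
    (n : nat) (f : R3 R -> R[i]) : Prop :=
  if n is m.+1 then in_dom tau k f /\ ker_pow tau k lam m (Lsub tau k lam f)
  else inL2 f /\ aeq f (fun=> 0).

Definition gen_eigenspace (R : realType) (tau : R) (k : 'cV[R]_3) (lam : R[i])
    (f : R3 R -> R[i]) : Prop :=
  exists n, ker_pow tau k lam n f.

Definition lincomb (R : realType) (n : nat) (c : 'I_n -> R[i])
    (b : 'I_n -> R3 R -> R[i]) : R3 R -> R[i] :=
  fun v => \sum_(i < n) c i * b i v.

(* Linear independence and spanning are those of H_v, that is, up to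
   almost-everywhere equality. *)
Definition has_dim (R : realType) (V : (R3 R -> R[i]) -> Prop) (d : nat) :
    Prop :=
  exists b : 'I_d -> R3 R -> R[i],
    [/\ forall i, V (b i),
        forall c, aeq (lincomb c b) (fun=> 0) -> forall i, c i = 0 &
        forall f, V f -> exists c, aeq f (lincomb c b)].

Definition geo_mult (R : realType) (tau : R) (k : 'cV[R]_3) (lam : R[i])
    (d : nat) : Prop :=
  has_dim (eigenspace_of tau k lam) d.

Definition alg_mult (R : realType) (tau : R) (k : 'cV[R]_3) (lam : R[i])
    (d : nat) : Prop :=
  has_dim (gen_eigenspace tau k lam) d.

(* L_k - lam maps its domain onto H_v; the lower bound gives injectivity and
   boundedness of the inverse. *)
Definition in_resolvent (R : realType) (tau : R) (k : 'cV[R]_3)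
    (lam : R[i]) : Prop :=
  (forall g, inL2 g ->
     exists2 f, in_dom tau k f & aeq (Lsub tau k lam f) g) /\
  (exists2 c : R, 0 < c &
     forall f, in_dom tau k f -> c * normv f <= normv (Lsub tau k lam f)).

Definition spectrum (R : realType) (tau : R) (k : 'cV[R]_3)
    (lam : R[i]) : Prop :=
  ~ in_resolvent tau k lam.

Definition discrete_spectrum (R : realType) (tau : R) (k : 'cV[R]_3)
    (lam : R[i]) : Prop :=
  [/\ is_eigenvalue tau k lam,
      exists d, alg_mult tau k lam d &
      exists2 e : R, 0 < e &
        forall mu, spectrum tau k mu -> mu != lam -> e%:C <= `|mu - lam|].

Definition essential_spectrum (R : realType) (tau : R) (k : 'cV[R]_3)
    (lam : R[i]) : Prop :=
  spectrum tau k lam /\ ~ discrete_spectrum tau k lam.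

Definition hydro_eigenvalues (R : realType) (ldiff : R) (lac : R[i])
    (lshear : R) : seq R[i] :=
  [:: ldiff%:C; lac; lac^*%C; lshear%:C].

(* The spectral picture below the critical wave number. Together these
   fields determine ldiff, lac and lshear uniquely. *)
Record spectral_facts (R : realType) (tau : R) (k : 'cV[R]_3)
    (ldiff : R) (lac : R[i]) (lshear : R) : Prop := SpectralFacts {
  sf_essential : forall lam,
    essential_spectrum tau k lam <-> Re lam = - tau^-1;
  sf_eigenvalues : forall lam,
    (is_eigenvalue tau k lam /\ Re lam <> - tau^-1) <->
    lam \in hydro_eigenvalues ldiff lac lshear;
  sf_strip : forall lam, lam \in hydro_eigenvalues ldiff lac lshear ->
    - tau^-1 < Re lam < 0;
  sf_ac : 0 < Im lac;
  sf_diff_mult : alg_mult tau k ldiff%:C 1;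
  sf_ac_mult : alg_mult tau k lac 1;
  sf_acc_mult : alg_mult tau k lac^* 1;
  sf_shear_alg : alg_mult tau k lshear%:C 2;
  sf_shear_geo : geo_mult tau k lshear%:C 2 }.

Definition hydro_manifold (R : realType) (tau : R) (k : 'cV[R]_3)
    (ldiff : R) (lac : R[i]) (lshear : R) (f : R3 R -> R[i]) : Prop :=
  inL2 f /\
  exists (n : nat) (c : 'I_n -> R[i]) (g : 'I_n -> R3 R -> R[i]),
    (forall i, exists2 lam, lam \in hydro_eigenvalues ldiff lac lshear &
       eigenfunction tau k lam (g i)) /\
    aeq f (lincomb c g).

(* Derivatives of curves defined on an interval I, one-sided at the
   endpoints of I, in the norm of H_v and componentwise in C^n. *)
Definition is_deriv_Hv (R : realType) (I : interval R)
    (f : R -> R3 R -> R[i]) (t : R) (g : R3 R -> R[i]) : Prop :=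
  normv (fun v => ((s - t)^-1)%:C * (f s v - f t v) - g v)
    @[s --> within [set` I] t^'] --> (0 : R).

Definition is_deriv_C (R : realType) (n : nat) (I : interval R)
    (h : R -> 'cV[R[i]]_n) (t : R) (g : 'cV[R[i]]_n) : Prop :=
  forall j, ComplexField.Normc.normc
      (((s - t)^-1)%:C * (h s j 0 - h t j 0) - g j 0)
    @[s --> within [set` I] t^'] --> (0 : R).

Definition hydro_solution (R : realType) (tau : R) (k : 'cV[R]_3)
    (ldiff : R) (lac : R[i]) (lshear : R) (I : interval R)
    (f : R -> R3 R -> R[i]) : Prop :=
  forall t, t \in I ->
    hydro_manifold tau k ldiff lac lshear (f t) /\
    is_deriv_Hv I f t (Lop tau k (f t)).

Definition moments (R : realType) (f : R3 R -> R[i]) : 'cV[R[i]]_5 :=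
  \col_j inner f (ebasis j).

Definition wavevec (R : realType) (kk : 'cV[int]_3) : 'cV[R]_3 :=
  \col_j (kk j 0)%:~R.

Definition enorm (R : realType) (n : nat) (k : 'cV[R]_n) : R :=
  Num.sqrt (\sum_(j < n) k j 0 ^+ 2).

Definition kcrit_min (R : realType) (tau : R) : R := Num.sqrt (pi / 2) / tau.

Definition mx_of_rows (T : nzRingType) (m n : nat) (rows : seq (seq T)) :
    'M[T]_(m, n) :=
  \matrix_(i < m, j < n) nth 0 (nth [::] rows i) j.

Definition aligns (R : realType) (Q : 'M[R]_3) (k : 'cV[R]_3) : Prop :=
  [/\ Q^T *m Q = 1%:M, \det Q = 1 &
      Q *m mx_of_rows 3 1 [:: [:: enorm k]; [:: 0]; [:: 0]] = k].

Definition Qtilde (R : realType) (Q : 'M[R]_3) : 'M[R[i]]_5 :=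
  (block_mx 1%:M 0 0 (block_mx (map_mx (real_complex R) Q) 0 0 1%:M)
    : 'M[R[i]]_(1 + (3 + 1))).

(* Only meaningful for non-real z; for eigenvalues with tau * Re lam > -1 the
   argument used in [theta] lies in the upper half-plane. *)
Definition plasmaZ (R : realType) (z : R[i]) : R[i] :=
  ((Num.sqrt (2 * pi))^-1)%:C *
  cintegral (@lebesgue_measure R)
    (fun v => (expR (- (v ^+ 2 / 2)))%:C / (v%:C - z)).

Definition theta (R : realType) (tau k : R) (lam : R[i]) : R[i] :=
  let T := tau%:C in
  let K := k%:C in
  let Z := plasmaZ ('i%C * (T * lam + 1) / (K * T)) in
  (Num.sqrt 6)%:C *
    ((K ^+ 2 * T ^+ 2 - T * lam * (T * lam + 1)) * Z
      - 'i%C * K * T * (K ^+ 2 * T ^+ 2 - T * lam))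
  / ((K ^+ 2 * T ^+ 2 + (T * lam + 1) ^+ 2) * Z
      - 'i%C * K * T * (T * lam + 1)).

Definition Hmx (R : realType) (tau k : R) (Q : 'M[R]_3)
    (ldiff : R) (lac : R[i]) : 'M[R[i]]_5 :=
  let l := ldiff%:C in
  let ik := 'i%C / k%:C in
  let lacc := lac^* in
  let th := theta tau k in
  Qtilde Q *m mx_of_rows 5 5
    [:: [:: 1;      1;        1;         0; 0];
        [:: ik * l; ik * lac; ik * lacc; 0; 0];
        [:: 0;      0;        0;         1; 0];
        [:: 0;      0;        0;         0; 1];
        [:: th l;   th lac;   th lacc;   0; 0]].

Definition Lambda_mx (R : realType) (ldiff : R) (lac : R[i]) (lshear : R) :
    'M[R[i]]_5 :=
  let lacc := lac^* in
  diag_mx (mx_of_rows 1 5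
    [:: [:: ldiff%:C; lac; lacc; lshear%:C; lshear%:C]]).

Definition cyc_sum (T : nzRingType) (F : T -> T -> T -> T) (a b c : T) : T :=
  F a b c + F b c a + F c a b.

Definition cyc_prod (T : nzRingType) (F : T -> T -> T -> T) (a b c : T) : T :=
  F a b c * F b c a * F c a b.

(* In C1 .. C6, D is det H, th is theta and (a, b, c) is
   (ldiff, lac, lac^* ). *)
Section Coefficients.
Variables (R : realType) (k : R) (D : R[i]) (th : R[i] -> R[i]) (a b c : R[i]).
Let K := k%:C.

Definition C1 : R[i] :=
  1 / (K ^+ 2 * D) *
  cyc_sum (fun l1 l2 l3 => l1 * l3 * (l1 - l3) * th l2) a b c.
Definition C2 : R[i] :=
  'i%C / (K * D) *
  cyc_sum (fun l1 l2 l3 => (l1 ^+ 2 - l3 ^+ 2) * th l2) a b c.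
Definition C3 : R[i] :=
  - (1 / (K ^+ 2 * D)) *
  cyc_prod (fun l1 l2 l3 => l1 - l2) a b c.
Definition C4 : R[i] :=
  'i%C / (K * D) *
  cyc_sum (fun l1 l2 l3 => l2 * (l1 - l3) * th l1 * th l3) a b c.
Definition C5 : R[i] :=
  1 / D *
  cyc_sum (fun l1 l2 l3 => (l3 - l1) * th l1 * th l3) a b c.
Definition C6 : R[i] :=
  - ('i%C / (K * D)) *
  cyc_sum (fun l1 l2 l3 => l1 * th l1 * (l2 - l3)) a b c.

End Coefficients.

Definition purely_imaginary (R : realType) (z : R[i]) : Prop := Re z = 0.
Definition is_real (R : realType) (z : R[i]) : Prop := Im z = 0.

(* Main.v *)
Require Import Defs.
From HB Require Import structures.
From mathcomp Require Import all_boot all_order all_algebra.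
From mathcomp Require Import all_classical all_reals all_analysis.
From mathcomp Require Import complex.
From mathcomp Require Import measurable_realfun ring lra.

Set Implicit Arguments.
Unset Strict Implicit.
Unset Printing Implicit Defensive.

Import Order.TTheory GRing.Theory Num.Theory.
Import numFieldNormedType.Exports.

Local Open Scope classical_set_scope.
Local Open Scope ring_scope.
Local Open Scope complex_scope.

Local Notation Re := complex.Re.
Local Notation Im := complex.Im.

(** In units where the velocity is Gaussian, an eigenfunction for an eigenvalue
[lam] to the right of the essential spectrum is
[f = kap (P5 f) / (z + i w)], where [w] is the velocity along the wave vector,
[kap = 1 / (k tau)] and [z = kap (tau lam + 1)]. It is thus determined by its
moments [h], and taking moments again gives a linear system for [h] in terms of
[m = E (1 / (z + i w))], [I1 = 1 - z m], [J2 = m - z I1] and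
[eta = lam / k = z - kap]. The system splits. The transverse part is
[kap m h_j = h_j]; since one density-carrying direction cannot fill a space of
dimension two, [kap m = 1] holds at the shear eigenvalue, and as [m] is strictly
monotone on the real axis and non-real off it, [kap m <> 1] at the three other
eigenvalues. There the longitudinal part gives [h_1 = i eta h_0] and
[h_4 = theta h_0], where
[2 theta (3 - 2 kap m) = - sqrt 6 (1 + eta ^ 2)].

Up to a nonzero factor, [det H] is the imaginary part of
[(eta_ac - eta_diff) conj (theta_ac - theta_diff)]. Its positivity follows from
bounds on [m] and on [Im (I1 conj J2)], which come from integrating, from
[+oo], the differential equations in [Re z] satisfied by these functions; the
remaining inequality is semialgebraic. The matrix identity is then Cramer's
rule, and the evolution equation follows from the continuity of the moments. *)

(** Invertibility of [H] is not formal: the eigenvalues are known only as roots of a transcendental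
    equation, so det H has no closed form to inspect. The way out is that the longitudinal system
    determines theta twice, through J2 by the density moment and through E = 3 - 2 kap m by the
    energy moment. Equating the two gives (1 + eta^2) (2 I1 / J2 - kap / E) = - 2 eta, so at an
    eigenvalue a bound on Im (I1 / J2) becomes a bound on 1 / E, while theta is a multiple of (1 +
    eta^2) / E. Only inequalities valid in the whole half-plane Re z > 0 are then needed. The
    functions m, I1, J2 are the integrals over t > 0 of 1, t, t^2 against exp (- z t - t^2 / 2).
    Hence the closed system m' = - I1, I1' = - J2, J2' = z J2 - 2 I1. Quadratic expressions in them,
    multiplied by exp (- u^2 / 2) with u = Re z, can be balanced so that their derivative in u has a
    sign; as they vanish at infinity, so do they. *)

Section Gaussian.
Variable R : realType.
Implicit Types (f g : R -> R) (w x y : R).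
Local Notation mu := (@lebesgue_measure R).

(** * Integration against the standard Gaussian density on the line *)

Definition phi w : R := (Num.sqrt (2 * pi))^-1 * expR (- (w ^+ 2 / 2)).

Lemma phi_gt0 w : 0 < phi w.
Proof.
by rewrite mulr_gt0 ?expR_gt0// invr_gt0 sqrtr_gt0 mulr_gt0// pi_gt0.
Qed.

Lemma phiE w : phi w = normal_pdf 0 1 w.
Proof.
rewrite normal_pdfE ?oner_eq0// /normal_peak /normal_fun /phi.
by rewrite expr1n mul1r subr0 -(mulr_natl pi) mulNr.
Qed.

Lemma continuous_phi : continuous phi.
Proof.
have -> : phi = normal_pdf 0 1 by apply/funext => w; rewrite phiE.
by apply: continuous_normal_pdf; rewrite oner_eq0.
Qed.

Lemma measurable_phi : measurable_fun setT phi.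
Proof. exact: continuous_measurable_fun continuous_phi. Qed.

Lemma is_derive_phi w : is_derive w 1 phi (- w * phi w).
Proof.
rewrite /phi; set c := (Num.sqrt _)^-1; apply: is_derive_eq.
rewrite /GRing.scale/=.
by field.
Qed.

Definition gint f := mu.-integrable setT (fun w => (f w * phi w)%:E).
Definition E1 f : R := \int[mu]_w (f w * phi w).

(** Degree four is what products of two of the functions [ebasis] require; a bounded resolvent
    factor does not raise it. *)
Definition quartic_growth f := measurable_fun setT f /\
  exists C, forall w, `|f w| <= C * (1 + w ^+ 4).

(** The bound exp x >= 1 + x^2 / 2 at x = w^2 / 4, where the quadratic term is w^4 / 32. *)
Lemma quartic_expR w : 1 + w ^+ 4 <= 32 * expR (w ^+ 2 / 4).
Proof.
have h := @expR_ge1Dxn R (w ^+ 2 / 4) 1 (divr_ge0 (sqr_ge0 w) (ler0n _ 4)).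
have -> : w ^+ 4 = (w ^+ 2) ^+ 2 by rewrite -exprM.
have := sqr_ge0 (w ^+ 2).
move: h; rewrite /= (_ : 2`! = 2)%N // => h h2; lra.
Qed.

(** Half of the Gaussian exponent absorbs the polynomial by [quartic_expR]; the other half, exp (-
    w^2 / 4), is up to a constant the normal density of variance two, an integrable majorant. *)
Lemma quartic_phi : exists2 K : R, 0 <= K &
  forall w, (1 + w ^+ 4) * phi w <= K * normal_pdf 0 (Num.sqrt 2) w.
Proof.
pose c := normal_peak (Num.sqrt 2 : R).
have c0 : 0 < c by apply: normal_peak_gt0; rewrite gt_eqF// sqrtr_gt0.
exists (32 * (Num.sqrt (2 * pi))^-1 / c).
  by rewrite !mulr_ge0// ?invr_ge0 ?sqrtr_ge0// ltW.
move=> w; rewrite normal_pdfE ?gt_eqF ?sqrtr_gt0//.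
have -> : 32 * (Num.sqrt (2 * pi))^-1 / c * (c * normal_fun 0 (Num.sqrt 2) w)
  = (Num.sqrt (2 * pi))^-1 * (32 * normal_fun 0 (Num.sqrt 2) w) :> R.
  by set d := (Num.sqrt _)^-1; field; rewrite gt_eqF.
rewrite /phi mulrCA ler_wpM2l ?invr_ge0 ?sqrtr_ge0// /normal_fun subr0.
have -> : - w ^+ 2 / (Num.sqrt 2 ^+ 2 *+ 2) = w ^+ 2 / 4 + - (w ^+ 2 / 2) :> R.
  by rewrite sqr_sqrtr// -mulr_natl; field.
rewrite expRD mulrA ler_wpM2r ?expR_ge0//; exact: quartic_expR.
Qed.

Lemma quartic_phi_bound : exists K : R, forall w, (1 + w ^+ 4) * phi w <= K.
Proof.
have [K K0 hK] := quartic_phi.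
exists (K * normal_peak (Num.sqrt 2)) => w; apply: (le_trans (hK w)).
apply: ler_wpM2l => //; apply: normal_pdf_ub.
by rewrite gt_eqF ?sqrtr_gt0.
Qed.

Lemma one_quartic_gt0 w : 0 < 1 + w ^+ 4.
Proof. by rewrite (exprM w 2 2); have := sqr_ge0 (w ^+ 2); lra. Qed.

Lemma tame_gint f : quartic_growth f -> gint f.
Proof.
move=> [mf [C hC]]; have [K K0 hK] := quartic_phi.
apply: (@le_integrable _ _ _ mu setT measurableT _
    (fun w => (C * K * normal_pdf 0 (Num.sqrt 2) w)%:E)).
- apply/measurable_EFinP; apply: measurable_funM => //; exact: measurable_phi.
- move=> w _ /=; rewrite lee_fin normrM (gtr0_norm (phi_gt0 w)).
  apply: (le_trans _ (ler_norm _)).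
  have C0 : 0 <= C.
    have := le_trans (normr_ge0 _) (hC w); rewrite pmulr_lge0//.
    exact: one_quartic_gt0.
  apply: (le_trans (ler_wpM2r (ltW (phi_gt0 w)) (hC w))).
  by rewrite -!mulrA ler_wpM2l.
- under eq_fun do rewrite EFinM.
  apply: integrableZl => //.
  exact: integrable_normal_pdf.
Qed.

Lemma tame_cst (c : R) : quartic_growth (fun=> c).
Proof.
split=> //; exists `|c| => w; rewrite ler_peMr// lerDl.
by rewrite (exprM w 2 2) sqr_ge0.
Qed.

Lemma tameMl (b : R) f g : measurable_fun setT g -> (forall w, `|g w| <= b) ->
  quartic_growth f -> quartic_growth (fun w => g w * f w).
Proof.
move=> mg gb [mf [C hC]]; split; first exact: measurable_funM.
exists (b * C) => w; rewrite normrM -mulrA; exact: ler_pM.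
Qed.

Lemma tame_exp n : (n <= 4)%N -> quartic_growth (fun w => w ^+ n).
Proof.
move=> n4; split; first by apply: continuous_measurable_fun; exact: exprn_continuous.
exists 1 => w; rewrite mul1r normrX.
have -> : w ^+ 4 = `|w| ^+ 4 by rewrite -normrX ger0_norm// (exprM w 2 2) sqr_ge0.
have [w1|w1] := leP `|w| 1.
  by apply: (@le_trans _ _ 1); [rewrite exprn_ile1 | rewrite lerDl exprn_ge0].
apply: (@le_trans _ _ (`|w| ^+ 4)); last by rewrite lerDr.
by apply: ler_weXn2l => //; exact: ltW.
Qed.

Lemma E1_ext f g : f =1 g -> E1 f = E1 g.
Proof. by move=> h; congr Rintegral; apply/funext => w; rewrite h. Qed.

Lemma E1D f g : gint f -> gint g -> E1 (fun w => f w + g w) = E1 f + E1 g.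
Proof.
move=> hf hg; rewrite /E1 -RintegralD//.
by congr Rintegral; apply/funext => w; rewrite mulrDl.
Qed.

Lemma E1Z (c : R) f : gint f -> E1 (fun w => c * f w) = c * E1 f.
Proof.
move=> hf; rewrite /E1 -RintegralZl//.
by congr Rintegral; apply/funext => w; rewrite mulrA.
Qed.

Lemma gintD f g : gint f -> gint g -> gint (fun w => f w + g w).
Proof.
move=> hf hg; rewrite /gint.
by under eq_fun do rewrite mulrDl EFinD; exact: integrableD.
Qed.

Lemma gintZ (c : R) f : gint f -> gint (fun w => c * f w).
Proof.
move=> hf; rewrite /gint.
by under eq_fun do rewrite -mulrA EFinM; exact: integrableZl.
Qed.

Lemma E1_le f g : gint f -> gint g -> (forall w, f w <= g w) -> E1 f <= E1 g.
Proof.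
move=> hf hg h; apply: le_Rintegral => // w _.
by rewrite ler_wpM2r// ltW// phi_gt0.
Qed.

Lemma E1_1 : E1 (fun=> 1) = 1.
Proof.
rewrite /E1 /Rintegral.
under eq_integral do rewrite mul1r phiE.
by rewrite integral_normal_pdf.
Qed.

Lemma E1_cst (c : R) : E1 (fun=> c) = c.
Proof.
by have := E1Z c (tame_gint (tame_cst 1)); rewrite E1_1 mulr1.
Qed.

(** The fundamental theorem of calculus on [-n, n], followed by dominated convergence. The last
    hypothesis makes both boundary values O(1 / n). *)
Lemma integral_derive (F f : R -> R) :
  (forall w, is_derive w 1 F (f w)) -> continuous f ->
  mu.-integrable setT (EFin \o f) ->
  (exists K, forall w, `|F w| * `|w| <= K) -> \int[mu]_w f w = 0.
Proof.
move=> dF cf intf [K hK].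
pose f_ (n : nat) (w : R) := (f \_ `[- n%:R, n%:R]) w.
have mf : measurable_fun setT f by exact: continuous_measurable_fun.
have [] := @dominated_convergence _ _ R mu setT measurableT
  (fun n => EFin \o f_ n) (EFin \o f) (fun w => `|f w|%:E).
- move=> n; apply/measurable_EFinP; rewrite /f_.
  apply/(measurable_restrictT _ _).1 => //; exact: measurable_funS mf.
- exact/measurable_EFinP.
- apply: aeW => w _; apply: cvg_near_cst.
  near=> n; rewrite /f_ /= patchE mem_set//= in_itv/=.
  rewrite -ler_norml; near: n; exact: nbhs_infty_ger.
- exact: (integrable_norm intf).
- apply: aeW => w n _ /=; rewrite lee_fin /f_ patchE; case: ifPn => // _.
  by rewrite normr0.
move=> _ _ h.
suff h0 : ([sequence \int[mu]_(x in setT) (EFin \o f_ n) x]_n @ \oo --> 0)%E.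
  by rewrite /Rintegral -(cvg_unique _ h0 h).
have key n : (0 < n)%N ->
    (\int[mu]_(x in setT) (EFin \o f_ n) x = (F n%:R - F (- n%:R))%:E)%E.
  move=> n0.
  transitivity (\int[mu]_(x in `[(- n%:R)%R, n%:R%R]) (f x)%:E)%E.
    rewrite [RHS]integral_mkcond; apply: eq_integral => x _.
    by rewrite /f_ /= !patchE; case: ifP.
  rewrite (@continuous_FTC2 _ f F)//.
  - by rewrite -subr_gt0 opprK addr_gt0// ltr0n.
  - exact: continuous_subspaceT.
  - have dF' w : derivable F w 1 by have := dF w => -[].
    split => [w _||]; first exact: dF'.
      by apply: cvg_at_right_filter; apply: differentiable_continuous; apply/derivable1_diffP.
    by apply: cvg_at_left_filter; apply: differentiable_continuous; apply/derivable1_diffP.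
  - by move=> w _; rewrite derive1E; have := dF w => -[].
have Fb w : w != 0 -> `|F w| <= K / `|w|.
  by move=> w0; rewrite ler_pdivlMr ?normr_gt0.
apply: (@cvg_trans _ ((fun n : nat => (F n%:R - F (- n%:R))%:E) @ \oo)).
  apply: near_eq_cvg; near=> n; rewrite /= key//; near: n; exact: nbhs_infty_gt.
apply/fine_cvgP; split; first by near=> n.
apply/cvgr0Pnorm_le => e e0; near=> n.
have n0 : (0 : R) < n%:R by rewrite ltr0n; near: n; exact: nbhs_infty_gt.
have nK : 2 * K / e <= n%:R by near: n; exact: nbhs_infty_ger.
have h1 : `|F n%:R| <= K / n%:R.
  by have := Fb n%:R (lt0r_neq0 n0); rewrite (gtr0_norm n0).
have h2 : `|F (- n%:R)| <= K / n%:R.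
  by have := Fb (- n%:R); rewrite oppr_eq0 normrN (gtr0_norm n0); apply; exact: lt0r_neq0.
apply: (le_trans (ler_normB _ _)); apply: (le_trans (lerD h1 h2)).
rewrite -mulrDl ler_pdivrMr//; move: nK; rewrite ler_pdivrMr// => nK; lra.
Unshelve. all: by end_near. Qed.

(** Gaussian integration by parts: phi' = - w phi, so G phi has derivative (g - w G) phi and
    [integral_derive] applies. The quartic bound on w G controls the boundary values through
    [quartic_phi_bound]. *)
Lemma E1_stein (G g : R -> R) :
  (forall w, is_derive w 1 G (g w)) -> continuous g ->
  gint g -> gint (fun w => w * G w) ->
  (exists C, forall w, `|G w * w| <= C * (1 + w ^+ 4)) ->
  E1 (fun w => w * G w) = E1 g.
Proof.
move=> dG cg ig iG [C hC]; have [K hK] := quartic_phi_bound.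
have cG : continuous G.
  move=> w; apply: differentiable_continuous; apply/derivable1_diffP.
  by have := dG w => -[].
have ih : gint (fun w => g w + (-1) * (w * G w)) by apply: gintD => //; exact: gintZ.
have C0 : 0 <= C.
  by have := le_trans (normr_ge0 _) (hC 0); rewrite expr0n addr0 mulr1.
have h : \int[mu]_w ((g w + (-1) * (w * G w)) * phi w) = 0.
  apply: (@integral_derive (fun w => G w * phi w)) => //.
  - move=> w; have dp := is_derive_phi w; have dGw := dG w.
    by apply: is_derive_eq; rewrite /GRing.scale/=; ring.
  - move=> w; apply: cvgM; last exact: continuous_phi.
    apply: cvgD; first exact: cg.
    by apply: cvgM; [exact: cvg_cst | apply: cvgM; [exact: cvg_id | exact: cG]].
  - exists (C * K) => w.
    rewrite normrM (gtr0_norm (phi_gt0 w)) mulrAC -normrM.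
    apply: (le_trans (ler_wpM2r (ltW (phi_gt0 w)) (hC w))).
    by rewrite -mulrA ler_wpM2l.
have {h} : E1 (fun w => g w + (-1) * (w * G w)) = 0 by exact: h.
rewrite (E1D ig (gintZ (-1) iG)) (E1Z (-1) iG) => /eqP.
by rewrite mulN1r subr_eq0 => /eqP.
Qed.

Lemma gint_exp n : (n <= 4)%N -> gint (fun w => w ^+ n).
Proof. by move=> n4; apply: tame_gint; exact: tame_exp. Qed.

Lemma E1_exp_rec n : (n.+1 <= 3)%N ->
  E1 (fun w => w ^+ n.+2) = n.+1%:R * E1 (fun w => w ^+ n).
Proof.
move=> n3; have n4 : (n <= 4)%N by rewrite (leq_trans (leqnSn n))// (leq_trans n3).
rewrite -E1Z; last exact: gint_exp.
have -> : E1 (fun w => w ^+ n.+2) = E1 (fun w => w * w ^+ n.+1).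
  by apply: E1_ext => w; rewrite exprS.
apply: E1_stein.
- move=> w.
  have -> : (fun w : R => w ^+ n.+1) = (id : R -> R) ^+ n.+1.
    by apply/funext => x; rewrite fctE.
  by apply: is_derive_eq; rewrite /GRing.scale/= mulr1.
- by move=> w; apply: cvgM; [exact: cvg_cst | exact: exprn_continuous].
- by apply: gintZ; exact: gint_exp.
- by under eq_fun do rewrite -exprS; apply: gint_exp.
- have [_ [C hC]] := @tame_exp n.+2 n3.
  by exists C => w; rewrite -exprSr.
Qed.

Lemma E1_exp1 : E1 (fun w => w ^+ 1) = 0.
Proof.
have -> : E1 (fun w => w ^+ 1) = E1 (fun w => w * (fun=> 1) w).
  by apply: E1_ext => w; rewrite mulr1 expr1.
rewrite (@E1_stein (fun=> 1) (fun=> 0)).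
- exact: E1_cst.
- by move=> w; exact: cvg_cst.
- exact: tame_gint (tame_cst _).
- have -> : (fun w : R => w * 1) = (fun w => w ^+ 1).
    by apply/funext => w; rewrite mulr1 expr1.
  exact: gint_exp.
- have [_ [C hC]] := @tame_exp 1 isT.
  by exists C => w; rewrite mul1r -[w in `|w|]expr1.
Qed.

Lemma E1_exp2 : E1 (fun w => w ^+ 2) = 1.
Proof. by rewrite E1_exp_rec// mul1r; exact: E1_1. Qed.

Lemma E1_exp3 : E1 (fun w => w ^+ 3) = 0.
Proof. by rewrite E1_exp_rec// E1_exp1 mulr0. Qed.

Lemma E1_exp4 : E1 (fun w => w ^+ 4) = 3.
Proof. by rewrite E1_exp_rec// E1_exp2 mulr1. Qed.

End Gaussian.

(** * The resolvent 1 / (z + i w) and its derivatives *)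

Section Resolvent.
Variable R : realType.
Implicit Types (u s w x y : R).
Local Notation mu := (@lebesgue_measure R).

(* For [z = u + i s], [ga + i gb = 1 / (z + i w)] and [mr + i mi] is its
   Gaussian mean [m], that is [- i Z(i z)]. *)
Definition ga u s w : R := u / (u ^+ 2 + (s + w) ^+ 2).
Definition gb u s w : R := - (s + w) / (u ^+ 2 + (s + w) ^+ 2).
Definition mr u s : R := E1 (ga u s).
Definition mi u s : R := E1 (gb u s).

Lemma den_gt0 u s w : 0 < u -> 0 < u ^+ 2 + (s + w) ^+ 2.
Proof. by move=> u0; have := exprn_gt0 2 u0; have := sqr_ge0 (s + w); lra. Qed.

Lemma gab_re u s w : 0 < u -> u * ga u s w - (s + w) * gb u s w = 1.
Proof. by move=> /(den_gt0 s w) d; rewrite /ga /gb; field; rewrite gt_eqF. Qed.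

Lemma gab_im u s w : u * gb u s w + (s + w) * ga u s w = 0.
Proof. by rewrite /ga /gb; ring. Qed.

Lemma ga_gt0 u s w : 0 < u -> 0 < ga u s w.
Proof. by move=> u0; rewrite divr_gt0// den_gt0. Qed.

Lemma ga_bound u s w : 0 < u -> `|ga u s w| <= u^-1.
Proof.
move=> u0; rewrite (gtr0_norm (ga_gt0 s w u0)) /ga ler_pdivrMr ?den_gt0//.
rewrite -(ler_pM2l u0) mulrA divff ?gt_eqF// mul1r -expr2 lerDl.
exact: sqr_ge0.
Qed.

Lemma gb_bound u s w : 0 < u -> `|gb u s w| <= u^-1.
Proof.
move=> u0; have d := den_gt0 s w u0.
rewrite /gb normrM normrN normfV (gtr0_norm d) ler_pdivrMr//.
rewrite -(ler_pM2l u0) mulrA divff ?gt_eqF// mul1r.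
have := sqr_ge0 (`|s + w| - u); rewrite -(real_normK (num_real (s + w))).
have := mulr_ge0 (normr_ge0 (s + w)) (ltW u0); lra.
Qed.

(** The derivative of [ga] in [u]. Since 1 / (z + i w) is holomorphic in u + i (s + w), the
    derivatives in [w] of [ga] and [gb] are - gb' and ga'; Stein's identity thereby turns
    derivatives of m in [u] into first moments. *)
Definition ga' u s w : R := ((s + w) ^+ 2 - u ^+ 2) / (u ^+ 2 + (s + w) ^+ 2) ^+ 2.
Definition gb' u s w : R := 2 * u * (s + w) / (u ^+ 2 + (s + w) ^+ 2) ^+ 2.

Lemma is_derive_ga_u u s w : 0 < u -> is_derive u 1 (fun u => ga u s w) (ga' u s w).
Proof.
move=> u0; have d := lt0r_neq0 (den_gt0 s w u0).
have dV : is_derive u 1 (fun u => (u ^+ 2 + (s + w) ^+ 2)^-1)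
    (- (u ^+ 2 + (s + w) ^+ 2) ^- 2 *: (2 * u)).
  apply: is_deriveV => //.
  by apply: is_derive_eq; rewrite /GRing.scale/=; ring.
rewrite /ga; apply: is_derive_eq.
by rewrite /GRing.scale/= /ga'; field; rewrite d.
Qed.

Lemma is_derive_gb_u u s w : 0 < u -> is_derive u 1 (fun u => gb u s w) (gb' u s w).
Proof.
move=> u0; have d := lt0r_neq0 (den_gt0 s w u0).
have dV : is_derive u 1 (fun u => (u ^+ 2 + (s + w) ^+ 2)^-1)
    (- (u ^+ 2 + (s + w) ^+ 2) ^- 2 *: (2 * u)).
  apply: is_deriveV => //.
  by apply: is_derive_eq; rewrite /GRing.scale/=; ring.
rewrite /gb; apply: is_derive_eq.
by rewrite /GRing.scale/= /gb'; field; rewrite d.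
Qed.

Lemma is_derive_ga_w u s w : 0 < u -> is_derive w 1 (ga u s) (- gb' u s w).
Proof.
move=> u0; have d := lt0r_neq0 (den_gt0 s w u0).
have dV : is_derive w 1 (fun w => (u ^+ 2 + (s + w) ^+ 2)^-1)
    (- (u ^+ 2 + (s + w) ^+ 2) ^- 2 *: (2 * (s + w))).
  apply: is_deriveV => //.
  by apply: is_derive_eq; rewrite /GRing.scale/=; ring.
rewrite /ga; apply: is_derive_eq.
by rewrite /GRing.scale/= /gb'; field; rewrite d.
Qed.

Lemma is_derive_gb_w u s w : 0 < u -> is_derive w 1 (gb u s) (ga' u s w).
Proof.
move=> u0; have d := lt0r_neq0 (den_gt0 s w u0).
have dV : is_derive w 1 (fun w => (u ^+ 2 + (s + w) ^+ 2)^-1)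
    (- (u ^+ 2 + (s + w) ^+ 2) ^- 2 *: (2 * (s + w))).
  apply: is_deriveV => //.
  by apply: is_derive_eq; rewrite /GRing.scale/=; ring.
rewrite /gb; apply: is_derive_eq.
by rewrite /GRing.scale/= /ga'; field; rewrite d.
Qed.

Lemma continuous_ga u s : 0 < u -> continuous (ga u s).
Proof.
move=> u0 w; apply: differentiable_continuous; apply/derivable1_diffP.
by have := is_derive_ga_w s w u0 => -[].
Qed.

Lemma continuous_gb u s : 0 < u -> continuous (gb u s).
Proof.
move=> u0 w; apply: differentiable_continuous; apply/derivable1_diffP.
by have := is_derive_gb_w s w u0 => -[].
Qed.

Lemma ga'_E u s w : 0 < u -> ga' u s w = gb u s w ^+ 2 - ga u s w ^+ 2.
Proof.
by move=> /(den_gt0 s w) d; rewrite /ga /gb /ga'; field; rewrite gt_eqF.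
Qed.

Lemma gb'_E u s w : 0 < u -> gb' u s w = - (2 * ga u s w * gb u s w).
Proof.
by move=> /(den_gt0 s w) d; rewrite /ga /gb /gb'; field; rewrite gt_eqF.
Qed.

Lemma sumsq_gab u s w : 0 < u -> ga u s w ^+ 2 + gb u s w ^+ 2 <= u ^- 2.
Proof.
move=> u0; have d := den_gt0 s w u0.
have -> : ga u s w ^+ 2 + gb u s w ^+ 2 = (u ^+ 2 + (s + w) ^+ 2)^-1.
  by rewrite /ga /gb; field; rewrite gt_eqF.
by rewrite lef_pV2 ?posrE ?exprn_gt0// lerDl sqr_ge0.
Qed.

Lemma ga'_bound u s w : 0 < u -> `|ga' u s w| <= u ^- 2.
Proof.
move=> u0; rewrite ga'_E// ler_norml; have := sumsq_gab s w u0.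
have := sqr_ge0 (ga u s w); have := sqr_ge0 (gb u s w) => ? ? ?.
by apply/andP; split; lra.
Qed.

Lemma gb'_bound u s w : 0 < u -> `|gb' u s w| <= u ^- 2.
Proof.
move=> u0; rewrite gb'_E// ler_norml; have := sumsq_gab s w u0.
have := sqr_ge0 (ga u s w + gb u s w); have := sqr_ge0 (ga u s w - gb u s w) => ? ? ?.
by apply/andP; split; lra.
Qed.

Lemma continuous_ga' u s : 0 < u -> continuous (ga' u s).
Proof.
move=> u0; have -> : ga' u s = (fun w => gb u s w * gb u s w - ga u s w * ga u s w).
  by apply/funext => w; rewrite ga'_E.
move=> w; have ca := @continuous_ga u s u0 w; have cb := @continuous_gb u s u0 w.
exact: (cvgB (cvgM cb cb) (cvgM ca ca)).
Qed.

Lemma continuous_gb' u s : 0 < u -> continuous (gb' u s).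
Proof.
move=> u0; have -> : gb' u s = (fun w => - (2 * ga u s w * gb u s w)).
  by apply/funext => w; rewrite gb'_E.
move=> w; apply: cvgN; apply: cvgM; last exact: continuous_gb.
by apply: cvgM; [exact: cvg_cst | exact: continuous_ga].
Qed.

Lemma tame_bounded (f : R -> R) (C : R) : continuous f -> (forall w, `|f w| <= C) -> quartic_growth f.
Proof.
move=> cf fC; split; first exact: continuous_measurable_fun.
exists C => w; apply: (le_trans (fC w)); rewrite ler_peMr//.
  exact: le_trans (normr_ge0 _) (fC 0).
by rewrite lerDl (exprM w 2 2) sqr_ge0.
Qed.

Lemma tame_ga u s : 0 < u -> quartic_growth (ga u s).
Proof. by move=> u0; apply: tame_bounded (fun w => ga_bound s w u0); exact: continuous_ga. Qed.

Lemma tame_gb u s : 0 < u -> quartic_growth (gb u s).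
Proof. by move=> u0; apply: tame_bounded (fun w => gb_bound s w u0); exact: continuous_gb. Qed.

Lemma tame_exp_ga u s n : 0 < u -> (n <= 4)%N -> quartic_growth (fun w => w ^+ n * ga u s w).
Proof.
move=> u0 n4; have [mg _] := tame_ga s u0.
have := tameMl mg (fun w => ga_bound s w u0) (tame_exp R n4).
by congr quartic_growth; apply/funext => w; rewrite mulrC.
Qed.

Lemma tame_exp_gb u s n : 0 < u -> (n <= 4)%N -> quartic_growth (fun w => w ^+ n * gb u s w).
Proof.
move=> u0 n4; have [mg _] := tame_gb s u0.
have := tameMl mg (fun w => gb_bound s w u0) (tame_exp R n4).
by congr quartic_growth; apply/funext => w; rewrite mulrC.
Qed.

Lemma E1_ga' u s : 0 < u -> E1 (ga' u s) = E1 (fun w => w * gb u s w).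
Proof.
move=> u0; symmetry; apply: E1_stein.
- by move=> w; exact: is_derive_gb_w.
- exact: continuous_ga'.
- by apply: tame_gint; apply: tame_bounded (fun w => ga'_bound s w u0); exact: continuous_ga'.
- have := tame_gint (tame_exp_gb s u0 (isT : (1 <= 4)%N)).
  by congr gint; apply/funext => w; rewrite expr1.
- have [_ [C hC]] := tame_exp_gb s u0 (isT : (1 <= 4)%N).
  by exists C => w; have := hC w; rewrite expr1 mulrC.
Qed.

Lemma E1_gb' u s : 0 < u -> E1 (gb' u s) = - E1 (fun w => w * ga u s w).
Proof.
move=> u0; apply/eqP; rewrite -eqr_oppLR; apply/eqP; symmetry.
have ig : gint (gb' u s).
  by apply: tame_gint; apply: tame_bounded (fun w => gb'_bound s w u0); exact: continuous_gb'.
rewrite -mulN1r -(E1Z (-1) ig).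
under [RHS]E1_ext do rewrite mulN1r.
apply: E1_stein.
- by move=> w; exact: is_derive_ga_w.
- by move=> w; apply: cvgN; exact: continuous_gb'.
- by have := gintZ (-1) ig; congr gint; apply/funext => w; rewrite mulN1r.
- have := tame_gint (tame_exp_ga s u0 (isT : (1 <= 4)%N)).
  by congr gint; apply/funext => w; rewrite expr1.
- have [_ [C hC]] := tame_exp_ga s u0 (isT : (1 <= 4)%N).
  by exists C => w; have := hC w; rewrite expr1 mulrC.
Qed.

End Resolvent.

(** * The differential equation m' = z m - 1 and first bounds on m *)

Section ResolventODE.
Variable R : realType.
Implicit Types (u s w x y : R).
Local Notation mu := (@lebesgue_measure R).

Lemma is_derive_E1 (h h' : R -> R -> R) u :
  0 < u -> (forall x w, 0 < x -> is_derive x 1 (h ^~ w) (h' x w)) ->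
  (forall x, 0 < x -> quartic_growth (h x)) ->
  (forall x w, 0 < x -> `|h' x w| <= x ^- 2) ->
  is_derive u 1 (fun u => E1 (h u)) (E1 (h' u)).
Proof.
move=> u0 dh th bh'.
pose f x w := h x w * phi w.
have Iu : (`](u / 2), (2 * u)[%classic : set R) u.
  by rewrite /= in_itv/=; apply/andP; split; lra.
have I0 x : (`](u / 2), (2 * u)[%classic : set R) x -> 0 < x.
  by rewrite /= in_itv/= => /andP[h1 h2]; lra.
have df x w : 0 < x -> is_derive x 1 (f ^~ w) (h' x w * phi w).
  move=> x0; have dhx := dh x w x0.
  by rewrite /f; apply: is_derive_eq; rewrite /GRing.scale/=; ring.
have d1 x w : 0 < x -> derive1 (f ^~ w) x = h' x w * phi w.
  by move=> x0; rewrite derive1E; have := df x w x0 => -[].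
have intf x : (`](u / 2), (2 * u)[%classic : set R) x ->
    mu.-integrable setT (EFin \o f x).
  by move=> /I0 x0; exact: tame_gint (th x x0).
have derf x w : (`](u / 2), (2 * u)[%classic : set R) x -> setT w -> derivable (f ^~ w) x 1.
  by move=> /I0 x0 _; have := df x w x0 => -[].
pose G (w : R) := (u / 2) ^- 2 * phi w.
have G0 w : 0 <= G w.
  by apply: mulr_ge0; [rewrite invr_ge0 exprn_ge0// divr_ge0// ltW | rewrite ltW// phi_gt0].
have intG : mu.-integrable setT (EFin \o G).
  exact: tame_gint (tame_cst _).
have ubG x w : (`](u / 2), (2 * u)[%classic : set R) x -> setT w ->
    `|derive1 (f ^~ w) x| <= G w.
  move=> Ix _; have x0 := I0 _ Ix; rewrite d1// normrM (gtr0_norm (phi_gt0 w)).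
  apply: ler_wpM2r; first exact: ltW (phi_gt0 w).
  apply: (le_trans (bh' x w x0)).
  move: Ix; rewrite /= in_itv/= => /andP[h1 h2].
  rewrite lef_pV2 ?posrE ?exprn_gt0//; last lra.
  by rewrite ler_sqr ?nnegrE; lra.
have D := derivable_under_integral measurableT Iu intf derf G0 intG ubG.
have E := differentiation_under_integral measurableT Iu intf derf G0 intG ubG.
apply: DeriveDef; first exact: D.
rewrite -derive1E E; congr Rintegral; apply/funext => w.
by rewrite /partial1of2 d1.
Qed.

Lemma E1_w_gb u s : 0 < u -> E1 (fun w => w * gb u s w) = u * mr u s - s * mi u s - 1.
Proof.
move=> u0.
have ia : gint (ga u s) by exact: tame_gint (tame_ga s u0).
have ib : gint (gb u s) by exact: tame_gint (tame_gb s u0).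
have i1 : gint (fun _ : R => -1 : R) by exact: tame_gint (tame_cst _).
rewrite -!mulNr -!E1Z// -(E1_cst (-1)) -E1D//; last 2 first.
- exact: gintZ.
- exact: gintZ.
rewrite -E1D//; last by apply: gintD; exact: gintZ.
by apply: E1_ext => w; have := gab_re s w u0; lra.
Qed.

Lemma E1_w_ga u s : 0 < u -> E1 (fun w => w * ga u s w) = - (u * mi u s + s * mr u s).
Proof.
move=> u0.
have ia : gint (ga u s) by exact: tame_gint (tame_ga s u0).
have ib : gint (gb u s) by exact: tame_gint (tame_gb s u0).
rewrite opprD -!mulNr -!E1Z// -E1D//; last 2 first.
- exact: gintZ.
- exact: gintZ.
by apply: E1_ext => w; have := gab_im u s w; lra.
Qed.

Lemma is_derive_mr u s : 0 < u ->
  is_derive u 1 (fun u => mr u s) (u * mr u s - s * mi u s - 1).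
Proof.
move=> u0; rewrite -E1_w_gb// -E1_ga'//.
apply: (@is_derive_E1 (fun u => ga u s) (fun u => ga' u s) u u0).
- by move=> x w; exact: is_derive_ga_u.
- by move=> x; exact: tame_ga.
- by move=> x w; exact: ga'_bound.
Qed.

Lemma is_derive_mi u s : 0 < u ->
  is_derive u 1 (fun u => mi u s) (u * mi u s + s * mr u s).
Proof.
move=> u0; rewrite -[X in is_derive _ _ _ X]opprK -E1_w_ga// -E1_gb'//.
apply: (@is_derive_E1 (fun u => gb u s) (fun u => gb' u s) u u0).
- by move=> x w; exact: is_derive_gb_u.
- by move=> x; exact: tame_gb.
- by move=> x w; exact: gb'_bound.
Qed.

Lemma E1_bounded (f : R -> R) (C : R) : quartic_growth f -> (forall w, `|f w| <= C) -> `|E1 f| <= C.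
Proof.
move=> tf fC; have i := tame_gint tf.
rewrite ler_norml; apply/andP; split.
  rewrite -(E1_cst (- C)); apply: E1_le => //; first exact: tame_gint (tame_cst _).
  by move=> w; have := fC w; rewrite ler_norml => /andP[].
rewrite -(E1_cst C); apply: E1_le => //; first exact: tame_gint (tame_cst _).
by move=> w; have := fC w; rewrite ler_norml => /andP[].
Qed.

Lemma mr_bound u s : 0 < u -> `|mr u s| <= u^-1.
Proof. by move=> u0; apply: E1_bounded (fun w => ga_bound s w u0); exact: tame_ga. Qed.

Lemma mi_bound u s : 0 < u -> `|mi u s| <= u^-1.
Proof. by move=> u0; apply: E1_bounded (fun w => gb_bound s w u0); exact: tame_gb. Qed.

(* Variance of [1/(z+iw)], combined with [Re (1/(z+iw)) = u |1/(z+iw)|^2]. *)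
Lemma mr_ge u s : 0 < u -> u * (mr u s ^+ 2 + mi u s ^+ 2) <= mr u s.
Proof.
move=> u0; set a := mr u s; set b := mi u s.
have ia : gint (ga u s) by exact: tame_gint (tame_ga s u0).
have ib : gint (gb u s) by exact: tame_gint (tame_gb s u0).
have i1 : gint (fun _ : R => u * (a ^+ 2 + b ^+ 2)) by exact: tame_gint (tame_cst _).
have h : 0 <= E1 (fun w => ((1 - 2 * u * a) * ga u s w + (- (2 * u * b)) * gb u s w)
                           + u * (a ^+ 2 + b ^+ 2)).
  rewrite -(E1_cst 0); apply: E1_le; first exact: tame_gint (tame_cst _).
    by apply: gintD => //; apply: gintD; exact: gintZ.
  move=> w.
  have -> : (1 - 2 * u * a) * ga u s w + - (2 * u * b) * gb u s w + u * (a ^+ 2 + b ^+ 2)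
      = u * ((ga u s w - a) ^+ 2 + (gb u s w - b) ^+ 2).
    have : ga u s w = u * (ga u s w ^+ 2 + gb u s w ^+ 2).
      by have /(_ w) d := den_gt0 s _ u0; rewrite /ga /gb; field; rewrite gt_eqF.
    by clearbody a b; move: (ga u s w) (gb u s w) => x y e; lra.
  by apply: mulr_ge0; [exact: ltW | apply: addr_ge0; exact: sqr_ge0].
rewrite E1D// in h; last by apply: gintD; exact: gintZ.
rewrite E1D// in h; [|exact: gintZ..].
rewrite E1_cst (E1Z _ ia) (E1Z _ ib) -/(mr u s) -/(mi u s) -/a -/b in h; lra.
Qed.

End ResolventODE.

(** * Signs of decreasing functions that vanish at infinity *)

Section Monotonicity.
Variable R : realType.
Implicit Types (u s w x y : R).

Lemma decreasing_pos (H H' : R -> R) (a b : R) :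
  (forall u, 0 < u -> is_derive u 1 H (H' u)) -> (forall u, 0 < u -> H' u <= 0) ->
  0 < a -> a <= b -> H b <= H a.
Proof.
move=> dH H'0 a0; rewrite le_eqVlt => /orP[/eqP->//|ab].
have c0 x : x \in `]a, b[ -> 0 < x by rewrite in_itv/= => /andP[/(lt_trans a0)].
have [||c cab e] := @MVT R H H' a b ab.
- by move=> x /c0; exact: dH.
- apply: derivable_within_continuous => x; rewrite in_itv/= => /andP[ax _].
  by have := dH x (lt_le_trans a0 ax) => -[].
rewrite -subr_le0 e; apply: mulr_le0_ge0; first exact: H'0 (c0 _ cab).
by rewrite subr_ge0 ltW.
Qed.

(** A negative value would persist to the right, against the decay. The explicit rate C / u, asked
    only from 1 on, gives a concrete point [v] of contradiction. *)
Lemma decreasing_vanishing_ge0 (H H' : R -> R) (C : R) u :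
  (forall u, 0 < u -> is_derive u 1 H (H' u)) -> (forall u, 0 < u -> H' u <= 0) ->
  (forall u, 1 <= u -> `|H u| <= C / u) -> 0 < u -> 0 <= H u.
Proof.
move=> dH H'0 HC u0; rewrite leNgt; apply/negP => Hu.
pose v := Num.max (Num.max 1 u) ((C + 1) / - H u).
have v1 : 1 <= v by rewrite /v !le_max lexx.
have uv : u <= v by rewrite /v !le_max lexx orbT.
have v0 : 0 < v by apply: lt_le_trans v1.
have := decreasing_pos dH H'0 u0 uv; have := HC v v1.
rewrite ler_norml => /andP[h1 _] h2.
have : (C + 1) / - H u <= v by rewrite /v le_max lexx orbT.
rewrite ler_pdivrMr ?oppr_gt0// => h3.
have : - (C / v) <= H u by exact: le_trans h1 h2.
rewrite lerNl ler_pdivlMr// => h4; lra.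
Qed.

Lemma gauss_decay u : 1 <= u -> expR (- (u ^+ 2 / 2)) <= 8 / u ^+ 4.
Proof.
move=> u1; have u0 : 0 < u by exact: lt_le_trans u1.
rewrite expRN -(invf_div (u ^+ 4)) lef_pV2 ?posrE ?expR_gt0 ?divr_gt0 ?exprn_gt0//.
have := @expR_ge1Dxn R (u ^+ 2 / 2) 1 (divr_ge0 (sqr_ge0 u) (ler0n _ 2)).
by rewrite (exprM u 2 2) (_ : 2`! = 2)%N // => h; lra.
Qed.

Lemma exp_decay u : 1 <= u -> expR (- u) <= 24 / u ^+ 4.
Proof.
move=> u1; have u0 : 0 < u by exact: lt_le_trans u1.
rewrite expRN -(invf_div (u ^+ 4)) lef_pV2 ?posrE ?expR_gt0 ?divr_gt0 ?exprn_gt0//.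
have := @expR_ge1Dxn R u 3 (ltW u0).
by rewrite (_ : 4`! = 24)%N // => h; lra.
Qed.

(** Growth of degree at most three against the decay u^-4 of [gauss_decay] or [exp_decay] leaves the
    rate 1 / u that [decreasing_vanishing_ge0] asks for. *)
Lemma decay_bound (H e : R) (C K u : R) n : 1 <= u -> (n <= 3)%N -> 0 <= C -> 0 <= e ->
  `|H| <= C * u ^+ n -> e <= K / u ^+ 4 -> `|H * e| <= C * K / u.
Proof.
move=> u1 n3 C0 e0 hH he; have u0 : 0 < u by exact: lt_le_trans u1.
rewrite normrM (ger0_norm e0).
apply: (le_trans (ler_pM _ _ hH he)) => //.
have -> : C * u ^+ n * (K / u ^+ 4) = C * K / u * (u ^+ n / u ^+ 3).
  by field; rewrite gt_eqF.
apply: ler_piMr; last by rewrite ler_pdivrMr ?exprn_gt0// mul1r ler_weXn2l.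
have K0 : 0 <= K.
  by have := le_trans e0 he; rewrite pmulr_lge0// invr_gt0 exprn_gt0.
by rewrite divr_ge0 ?mulr_ge0// ltW.
Qed.

Lemma is_derive_gauss u : is_derive u 1 (fun u : R => expR (- (u ^+ 2 / 2)))
  (- u * expR (- (u ^+ 2 / 2))).
Proof. by apply: is_derive_eq; rewrite /GRing.scale/=; field. Qed.

End Monotonicity.

(** * The functions I1 and J2: differential system and growth *)

Section TransformBounds.
Variable R : realType.
Implicit Types (u s w x y : R).
Local Notation gs u := (expR (- (u ^+ 2 / 2))).

(* [I1 = p1 + i q1 = 1 - z m] and [J2 = p2 + i q2 = m - z I1] for [z = u + i s] *)
Definition p1 u s : R := 1 - (u * mr u s - s * mi u s).
Definition q1 u s : R := - (u * mi u s + s * mr u s).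
Definition p2 u s : R := mr u s - (u * p1 u s - s * q1 u s).
Definition q2 u s : R := mi u s - (u * q1 u s + s * p1 u s).

Lemma is_derive_p1 u s : 0 < u -> is_derive u 1 (fun u => p1 u s) (- p2 u s).
Proof.
move=> u0; have d1 := is_derive_mr s u0; have d2 := is_derive_mi s u0.
rewrite /p1; apply: is_derive_eq; rewrite /GRing.scale/= /p2 /p1 /q1; ring.
Qed.

Lemma is_derive_q1 u s : 0 < u -> is_derive u 1 (fun u => q1 u s) (- q2 u s).
Proof.
move=> u0; have d1 := is_derive_mr s u0; have d2 := is_derive_mi s u0.
rewrite /q1; apply: is_derive_eq; rewrite /GRing.scale/= /q2 /p1 /q1; ring.
Qed.

Lemma is_derive_p2 u s : 0 < u ->
  is_derive u 1 (fun u => p2 u s) (u * p2 u s - s * q2 u s - 2 * p1 u s).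
Proof.
move=> u0; have d1 := is_derive_mr s u0.
have d2 := is_derive_p1 s u0; have d3 := is_derive_q1 s u0.
rewrite /p2; apply: is_derive_eq; rewrite /GRing.scale/= /p2 /q2 /p1 /q1; ring.
Qed.

Lemma is_derive_q2 u s : 0 < u ->
  is_derive u 1 (fun u => q2 u s) (u * q2 u s + s * p2 u s - 2 * q1 u s).
Proof.
move=> u0; have d1 := is_derive_mi s u0.
have d2 := is_derive_p1 s u0; have d3 := is_derive_q1 s u0.
rewrite /q2; apply: is_derive_eq; rewrite /GRing.scale/= /p2 /q2 /p1 /q1; ring.
Qed.

(** Jensen's inequality for 1 / x in tangent form: with d the denominator of [ga] and c = u^2 + s^2
    + 1 its mean, 1 / d >= 2 / c - d / c^2, and the right side has mean 1 / c. The gap is (d - c)^2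
    / (c^2 d). *)
Lemma mr_gt0 u s : 0 < u -> 0 < mr u s.
Proof.
move=> u0; pose c := u ^+ 2 + s ^+ 2 + 1.
have c0 : 0 < c by rewrite /c; have := sqr_ge0 u; have := sqr_ge0 s; lra.
have cE : u ^+ 2 + s ^+ 2 = c - 1 by rewrite /c; ring.
clearbody c.
have i1 : gint (fun w : R => w ^+ 1) by exact: gint_exp.
have i2 : gint (fun w : R => w ^+ 2) by exact: gint_exp.
have i0 : gint (fun w : R => u * (2 / c - (u ^+ 2 + s ^+ 2) / c ^+ 2)).
  exact: tame_gint (tame_cst _).
apply: (@lt_le_trans _ _ (u / c)); first exact: divr_gt0.
have -> : u / c = E1 (fun w => (- (2 * u * s / c ^+ 2) * w ^+ 1 + - (u / c ^+ 2) * w ^+ 2)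
    + u * (2 / c - (u ^+ 2 + s ^+ 2) / c ^+ 2)).
  rewrite E1D//; last by apply: gintD; exact: gintZ.
  rewrite E1D; [|exact: gintZ..].
  rewrite E1_cst (E1Z _ i1) (E1Z _ i2) E1_exp1 E1_exp2.
  rewrite cE.
  by field; rewrite gt_eqF.
apply: E1_le; first by apply: gintD => //; apply: gintD; exact: gintZ.
  exact: tame_gint (tame_ga s u0).
move=> w; rewrite /ga; have d := den_gt0 s w u0.
rewrite -subr_ge0.
suff -> : u / (u ^+ 2 + (s + w) ^+ 2) -
  (- (2 * u * s / c ^+ 2) * w ^+ 1 + - (u / c ^+ 2) * w ^+ 2 +
   u * (2 / c - (u ^+ 2 + s ^+ 2) / c ^+ 2)) =
   u * (u ^+ 2 + (s + w) ^+ 2 - c) ^+ 2 / (c ^+ 2 * (u ^+ 2 + (s + w) ^+ 2)).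
  by apply: divr_ge0; apply: mulr_ge0; rewrite ?sqr_ge0//; exact: ltW.
by field; rewrite !gt_eqF.
Qed.

Lemma transform_bounds u s : 1 <= u ->
  [/\ `|mr u s| <= 1, `|mi u s| <= 1, `|p1 u s| <= 2 + `|s|, `|q1 u s| <= 1 + `|s| &
   `|p2 u s| <= (3 + 4 * `|s| + 2 * s ^+ 2) * u /\ `|q2 u s| <= (3 + 4 * `|s| + 2 * s ^+ 2) * u].
Proof.
move=> u1; have u0 : 0 < u by exact: lt_le_trans u1.
have uV : u^-1 <= 1 by rewrite invf_le1.
have hr := mr_bound s u0; have hi := mi_bound s u0.
have um (x : R) : `|x| <= u^-1 -> `|u * x| <= 1.
  by move=> h; rewrite normrM (gtr0_norm u0) -ler_pdivlMl// mulr1.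
have sm (x : R) : `|x| <= u^-1 -> `|s * x| <= `|s|.
  by move=> h; rewrite normrM ler_piMr// (le_trans h).
have hp1 : `|p1 u s| <= 2 + `|s|.
  rewrite /p1 (le_trans (ler_normB _ _))// normr1.
  have := ler_normB (u * mr u s) (s * mi u s); have := um _ hr; have := sm _ hi; lra.
have hq1 : `|q1 u s| <= 1 + `|s|.
  rewrite /q1 normrN (le_trans (ler_normD _ _))//; have := um _ hi; have := sm _ hr; lra.
have s0 := normr_ge0 s.
have z_im : s ^+ 2 = `|s| * `|s| by rewrite -normrM ger0_norm -?expr2 ?sqr_ge0.
have b1 (x : R) : `|x| <= 2 + `|s| -> `|u * x| <= u * (2 + `|s|).
  by move=> h; rewrite normrM (gtr0_norm u0) ler_pM2l.
have b2 (x : R) : `|x| <= 2 + `|s| -> `|s * x| <= `|s| * (2 + `|s|).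
  by move=> h; rewrite normrM ler_wpM2l.
have hq1' : `|q1 u s| <= 2 + `|s| by lra.
have B : 1 + (u * (2 + `|s|) + `|s| * (2 + `|s|)) <= (3 + 4 * `|s| + 2 * s ^+ 2) * u.
  have h1 := ler_wpM2l s0 u1; have h2 := ler_wpM2l (mulr_ge0 s0 s0) u1.
  rewrite z_im; have := mulr_ge0 (mulr_ge0 s0 s0) (ltW u0); have := mulr_ge0 s0 (ltW u0); lra.
split; [exact: le_trans hr uV | exact: le_trans hi uV | done | done | split].
  rewrite /p2 (le_trans (ler_normB _ _))// (le_trans _ B)// lerD//.
    exact: le_trans hr uV.
  by rewrite (le_trans (ler_normB _ _))// lerD// ?b1 ?b2.
rewrite /q2 (le_trans (ler_normB _ _))// (le_trans _ B)// lerD//.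
  exact: le_trans hi uV.
by rewrite (le_trans (ler_normD _ _))// lerD// ?b1 ?b2.
Qed.

End TransformBounds.

(** * Sign information on m, I1 and J2 in the right half-plane *)

Section TransformSigns.
Variable R : realType.
Implicit Types (u s w x y : R).
Local Notation gs u := (expR (- (u ^+ 2 / 2))).

(** This is Im (1 / m) >= s / 2. In [H] the weight s / 2 cancels Re m from the derivative and the
    Gaussian factor cancels Im m, leaving - (u s / 2) |m|^2 times that factor. *)
Lemma mi_upper u s : 0 < u -> 0 <= s -> s / 2 * (mr u s ^+ 2 + mi u s ^+ 2) <= - mi u s.
Proof.
move=> u0 s0.
pose H x := (- mi x s - s / 2 * (mr x s ^+ 2 + mi x s ^+ 2)) * gs x.
pose H' x := - (x * s / 2 * (mr x s ^+ 2 + mi x s ^+ 2)) * gs x.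
have : 0 <= H u.
  apply: (@decreasing_vanishing_ge0 _ _ H' ((1 + s) * 8)); last exact: u0.
  - move=> x x0; have d1 := is_derive_mr s x0; have d2 := is_derive_mi s x0.
    have d3 := is_derive_gauss x.
    by rewrite /H /H'; apply: is_derive_eq; rewrite /GRing.scale/=; field.
  - move=> x x0; rewrite /H' mulr_le0_ge0 ?expR_ge0// oppr_le0.
    apply: mulr_ge0; last by apply: addr_ge0; exact: sqr_ge0.
    apply: divr_ge0 => //; apply: mulr_ge0 => //; exact: ltW.
  - move=> x x1; have [h1 h2 _ _ _] := transform_bounds s x1.
    apply: (@decay_bound _ _ _ _ _ _ 0) => //; rewrite ?expR_ge0//; last exact: gauss_decay.
      by lra.
    rewrite expr0 mulr1 (le_trans (ler_normB _ _))// normrN lerD//.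
    rewrite ger0_norm; last by rewrite mulr_ge0 ?divr_ge0// addr_ge0// sqr_ge0.
    have e1 : mr x s ^+ 2 <= 1 by rewrite -(real_normK (num_real _)) exprn_ile1.
    have e2 : mi x s ^+ 2 <= 1 by rewrite -(real_normK (num_real _)) exprn_ile1.
    have : s * (mr x s ^+ 2 + mi x s ^+ 2) <= s * 2 by apply: ler_wpM2l => //; lra.
    lra.
by rewrite /H pmulr_lge0 ?expR_gt0// subr_ge0.
Qed.

(** As q1 p2 - p1 q2 = Im (I1 conj J2), nonnegativity says Im (2 I1 / J2) >= s / 2 wherever J2 is
    nonzero. The weight s / 2 is the one that cancels Re (I1 conj J2) from the derivative; the
    Gaussian factor then cancels Im (I1 conj J2). *)
Definition skew s x : R :=
  (2 * (q1 x s * p2 x s - p1 x s * q2 x s) - s / 2 * (p2 x s ^+ 2 + q2 x s ^+ 2)) * gs x.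
Definition skew' s x : R := - (x * s / 2 * (p2 x s ^+ 2 + q2 x s ^+ 2)) * gs x.

Lemma is_derive_skew s x : 0 < x -> is_derive x 1 (skew s) (skew' s x).
Proof.
move=> x0; have d1 := is_derive_p1 s x0; have d2 := is_derive_q1 s x0.
have d3 := is_derive_p2 s x0; have d4 := is_derive_q2 s x0.
have d5 := is_derive_gauss x.
by rewrite /skew /skew'; apply: is_derive_eq; rewrite /GRing.scale/=; field.
Qed.

Lemma skew'_le0 s x : 0 < x -> 0 <= s -> skew' s x <= 0.
Proof.
move=> x0 s0; rewrite /skew' mulr_le0_ge0 ?expR_ge0// oppr_le0.
apply: mulr_ge0; last by apply: addr_ge0; exact: sqr_ge0.
apply: divr_ge0 => //; apply: mulr_ge0 => //; exact: ltW.
Qed.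

Lemma skew_ge0 u s : 0 < u -> 0 <= s -> 0 <= skew s u.
Proof.
move=> u0 s0; pose M := 3 + 4 * `|s| + 2 * s ^+ 2.
apply: (@decreasing_vanishing_ge0 _ _ (skew' s) ((4 + s) * M ^+ 2 * 8)); last exact: u0.
- exact: is_derive_skew.
- by move=> x x0; exact: skew'_le0.
- move=> x x1; have [_ _ hp hq [hp2 hq2]] := transform_bounds s x1.
  have x0 : 0 < x by exact: lt_le_trans x1.
  have ns := normr_ge0 s; have s2 := sqr_ge0 s.
  have M0 : 0 <= M by rewrite /M; lra.
  have hp1 : `|p1 x s| <= M by rewrite /M; lra.
  have hq1 : `|q1 x s| <= M by rewrite /M; lra.
  have xx : x <= x ^+ 2 by rewrite expr2 ler_peMr// ltW.
  have pr (a b : R) : `|a| <= M -> `|b| <= M * x -> `|a * b| <= M ^+ 2 * x ^+ 2.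
    move=> ha hb; rewrite normrM (le_trans (ler_pM _ _ ha hb))// mulrA -expr2.
    by rewrite ler_wpM2l// exprn_ge0.
  have sq (b : R) : `|b| <= M * x -> b ^+ 2 <= M ^+ 2 * x ^+ 2.
    move=> hb; rewrite -(real_normK (num_real _)) -exprMn ler_sqr ?nnegrE//.
    by rewrite mulr_ge0// ltW.
  apply: (@decay_bound _ _ _ _ _ _ 2) => //; rewrite ?expR_ge0//; last exact: gauss_decay.
    by rewrite mulr_ge0 ?sqr_ge0//; lra.
  rewrite (le_trans (ler_normB _ _))//.
  have e1 := pr _ _ hq1 hp2; have e2 := pr _ _ hp1 hq2.
  have e3 := sq _ hp2; have e4 := sq _ hq2.
  rewrite normrM (ger0_norm (ler0n _ 2)).
  rewrite [X in _ + X <= _]ger0_norm; last by rewrite mulr_ge0 ?divr_ge0// addr_ge0// sqr_ge0.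
  have := ler_normB (q1 x s * p2 x s) (p1 x s * q2 x s).
  have : s * (p2 x s ^+ 2 + q2 x s ^+ 2) <= s * (2 * (M ^+ 2 * x ^+ 2)).
    by apply: ler_wpM2l => //; lra.
  rewrite -(mulrA (4 + s)); move: (M ^+ 2 * x ^+ 2) e1 e2 e3 e4 => K e1 e2 e3 e4 e5 e6.
  lra.
Qed.

(** Uniqueness from infinity: D = m (u, - s) - conj m (u, s) solves D' = conj z D, so |D|^2 exp (-
    u^2) is constant in [u], and it tends to zero. The minus sign in [H] makes
    [decreasing_vanishing_ge0] give |D|^2 <= 0. *)
Lemma mr_mi_opp u s : 0 < u -> mr u (- s) = mr u s /\ mi u (- s) = - mi u s.
Proof.
move=> u0.
pose N x := (mr x (- s) - mr x s) ^+ 2 + (mi x (- s) + mi x s) ^+ 2.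
pose H x := - (N x * (gs x * gs x)).
have H0 : 0 <= H u.
  apply: (@decreasing_vanishing_ge0 _ _ (fun=> 0) (8 * 64)); last exact: u0.
  - move=> x x0; have d1 := is_derive_mr s x0; have d2 := is_derive_mi s x0.
    have d3 := is_derive_gauss x.
    have d4 := is_derive_mr (- s) x0; have d5 := is_derive_mi (- s) x0.
    rewrite /H /N; apply: is_derive_eq; rewrite /GRing.scale/=.
    by move: (gs x) (mr x s) (mi x s) (mr x (- s)) (mi x (- s)) => g a b a' b'; ring.
  - by [].
  - move=> x x1; have [h1 h2 _ _ _] := transform_bounds s x1.
    have [h3 h4 _ _ _] := transform_bounds (- s) x1.
    rewrite /H -mulNr mulrA.
    have g0 := @expR_ge0 R (- (x ^+ 2 / 2)).
    have g1 : gs x <= 1 by rewrite expR_le1 oppr_le0 divr_ge0// sqr_ge0.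
    have N0 : 0 <= N x by rewrite addr_ge0// sqr_ge0.
    have N8 : N x <= 8.
      have sq (a b : R) : `|a| <= 1 -> `|b| <= 1 -> (a + b) ^+ 2 <= 4.
        move=> ha hb; have hab : `|a + b| <= 2 by rewrite (le_trans (ler_normD _ _))//; lra.
        rewrite -(real_normK (num_real _)) (_ : 4 = 2 ^+ 2); last by ring.
        by rewrite ler_sqr ?nnegrE.
      have e1 := sq (mr x (- s)) (- mr x s); rewrite normrN in e1.
      have e2 := sq (mi x (- s)) (mi x s).
      by have := lerD (e1 h3 h1) (e2 h4 h2); rewrite /N; lra.
    apply: (le_trans (decay_bound (C := 8) (K := 8) (n := 0) x1 _ _ g0 _ (gauss_decay x1))) => //.
      rewrite expr0 mulr1 normrM normrN (ger0_norm N0) (ger0_norm g0).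
      by apply: (le_trans (ler_wpM2l N0 g1)); rewrite mulr1.
    by rewrite ler_wpM2r ?invr_ge0 ?(le_trans _ x1)//; lra.
have g0 : 0 < gs u * gs u by rewrite mulr_gt0 ?expR_gt0.
have : N u <= 0.
  by move: H0; rewrite /H oppr_ge0 pmulr_lle0.
rewrite /N => h; have s1 := sqr_ge0 (mr u (- s) - mr u s).
have s2 := sqr_ge0 (mi u (- s) + mi u s).
have /eqP : (mr u (- s) - mr u s) ^+ 2 = 0 by lra.
have /eqP : (mi u (- s) + mi u s) ^+ 2 = 0 by lra.
by rewrite !sqrf_eq0 subr_eq0 addr_eq0 => /eqP -> /eqP ->.
Qed.

Lemma mi_u0 u : 0 < u -> mi u 0 = 0.
Proof. by move=> u0; have [_] := mr_mi_opp 0 u0; rewrite oppr0; lra. Qed.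

(** On the real axis I1 = E (w^2 / (u^2 + w^2)). The tangent bound of [mr_gt0] is used at c = u^2 +
    3, the mean of u^2 + w^2 under the weight w^2. *)
Lemma p1_ge u : 0 < u -> (u ^+ 2 + 3)^-1 <= p1 u 0.
Proof.
move=> u0; rewrite /p1 mul0r subr0.
pose c := u ^+ 2 + 3.
have c0 : 0 < c by rewrite /c; have := sqr_ge0 u; lra.
have cE : u ^+ 2 = c - 3 by rewrite /c; ring.
have i2 : gint (fun w : R => w ^+ 2) by exact: gint_exp.
have i4 : gint (fun w : R => w ^+ 4) by exact: gint_exp.
have ia := tame_gint (tame_ga 0 u0).
have i1 : gint (fun _ : R => 1 : R) by exact: tame_gint (tame_cst _).
have -> : 1 - u * mr u 0 = E1 (fun w => 1 + - u * ga u 0 w).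
  by rewrite E1D//; [rewrite E1_1 E1Z// mulNr | exact: gintZ].
have -> : (u ^+ 2 + 3)^-1 =
    E1 (fun w => (2 / c - u ^+ 2 / c ^+ 2) * w ^+ 2 + (- c ^- 2) * w ^+ 4).
  rewrite E1D; [|exact: gintZ..].
  rewrite (E1Z _ i2) (E1Z _ i4) E1_exp2 E1_exp4 -/c cE.
  by field; rewrite gt_eqF.
apply: E1_le; [by apply: gintD; exact: gintZ | by apply: gintD => //; exact: gintZ |].
move=> w; rewrite /ga add0r -subr_ge0; have := den_gt0 0 w u0; rewrite add0r => d.
suff -> : 1 + - u * (u / (u ^+ 2 + w ^+ 2)) -
  ((2 / c - u ^+ 2 / c ^+ 2) * w ^+ 2 + - c ^- 2 * w ^+ 4) =
   w ^+ 2 * (u ^+ 2 + w ^+ 2 - c) ^+ 2 / (c ^+ 2 * (u ^+ 2 + w ^+ 2)).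
  by apply: divr_ge0; apply: mulr_ge0; rewrite ?sqr_ge0//; exact: ltW.
by field; rewrite !gt_eqF.
Qed.

Lemma p1_gt0 u : 0 < u -> 0 < p1 u 0.
Proof.
move=> u0; apply: lt_le_trans (p1_ge u0); rewrite invr_gt0.
by have := sqr_ge0 u; lra.
Qed.

Lemma q1_u0 u : 0 < u -> q1 u 0 = 0.
Proof. by move=> u0; rewrite /q1 mi_u0// mul0r mulr0 addr0 oppr0. Qed.

Lemma q2_u0 u : 0 < u -> q2 u 0 = 0.
Proof. by move=> u0; rewrite /q2 q1_u0// mi_u0// mul0r mulr0 addr0 subr0. Qed.

Lemma p2_ge0 u : 0 < u -> 0 <= p2 u 0.
Proof.
move=> u0; rewrite -(pmulr_lge0 _ (expR_gt0 (- (u ^+ 2 / 2)))).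
apply: (@decreasing_vanishing_ge0 _ (fun x => p2 x 0 * gs x)
  (fun x => - (2 * p1 x 0) * gs x) (3 * 8)); last exact: u0.
- move=> x x0; have d1 := is_derive_p2 0 x0; have d3 := is_derive_gauss x.
  by apply: is_derive_eq; rewrite /GRing.scale/=; ring.
- move=> x x0; rewrite mulr_le0_ge0 ?expR_ge0// oppr_le0 mulr_ge0//.
  exact: ltW (p1_gt0 x0).
- move=> x x1; have [_ _ _ _ [h _]] := transform_bounds 0 x1.
  apply: (@decay_bound _ _ _ _ _ _ 1) => //; rewrite ?expR_ge0//; last exact: gauss_decay.
  by move: h; rewrite normr0 expr0n/= !mulr0 !addr0 expr1.
Qed.

(** The weight exp (- u), unlike the Gaussian one, cancels I1 from the derivative and leaves - (1 +
    u) J2. The outcome 2 I1 / J2 >= 1 is what [diff_data] needs. *)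
Lemma p2_le u : 0 < u -> p2 u 0 <= 2 * p1 u 0.
Proof.
move=> u0; rewrite -subr_ge0 -(pmulr_lge0 _ (expR_gt0 (- u))).
apply: (@decreasing_vanishing_ge0 _ (fun x => (2 * p1 x 0 - p2 x 0) * expR (- x))
  (fun x => - ((1 + x) * p2 x 0) * expR (- x)) (7 * 24)); last exact: u0.
- move=> x x0; have d1 := is_derive_p2 0 x0; have d3 := is_derive_p1 0 x0.
  by apply: is_derive_eq; rewrite /GRing.scale/=; ring.
- move=> x x0; rewrite mulr_le0_ge0 ?expR_ge0// oppr_le0 mulr_ge0//; first by lra.
  exact: p2_ge0.
- move=> x x1; have [_ _ hp _ [h _]] := transform_bounds 0 x1.
  apply: (@decay_bound _ _ _ _ _ _ 1) => //; rewrite ?expR_ge0//; last exact: exp_decay.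
  move: h hp; rewrite normr0 expr0n/= !mulr0 !addr0 expr1 => h hp.
  rewrite (le_trans (ler_normB _ _))// normrM (ger0_norm (ler0n _ 2)); lra.
Qed.

Lemma mr_inj u v : 0 < u -> 0 < v -> mr u 0 = mr v 0 -> u = v.
Proof.
have lt (x y : R) : 0 < x -> x < y -> mr y 0 < mr x 0.
  move=> x0 xy.
  have dm (t : R) : 0 < t -> is_derive t 1 (fun t => mr t 0) (- p1 t 0).
    move=> t0; have d := is_derive_mr 0 t0.
    by apply: is_derive_eq; rewrite /p1; ring.
  have [||c cab e] := @MVT R (fun t => mr t 0) (fun t => - p1 t 0) x y xy.
  - by move=> t; rewrite in_itv/= => /andP[/(lt_trans x0) t0 _]; exact: dm.
  - apply: derivable_within_continuous => t; rewrite in_itv/= => /andP[xt _].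
    by have := dm t (lt_le_trans x0 xt) => -[].
  rewrite -subr_lt0 e nmulr_rlt0 ?subr_gt0// oppr_lt0 p1_gt0//.
  by move: cab; rewrite in_itv/= => /andP[/(lt_trans x0)].
move=> u0 v0 e; have [uv|vu|//] := ltgtP u v.
  by have := lt _ _ u0 uv; rewrite e ltxx.
by have := lt _ _ v0 vu; rewrite e ltxx.
Qed.

Lemma derive_zero_right (F : R -> R) u x d :
  (forall y, u < y -> F y = 0) -> u < x -> is_derive x 1 F d -> d = 0.
Proof.
move=> F0 ux dF.
have h : \near x, F x = cst 0 x by near=> y; rewrite F0//; near: y; exact: lt_nbhsr.
have [_ <-] := dF; rewrite (near_eq_derive _ h).
by have [] := @is_derive_cst R R R 0 x 1.
Unshelve. all: by end_near. Qed.

(* If [J2] vanished at [u + i s], the monotone functional would force it to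
   vanish on the whole half-line to the right; there [I1 = 0], hence
   [J2 = m <> 0]. *)
Lemma J2_neq0_ge0 u s : 0 < u -> 0 <= s -> p2 u s ^+ 2 + q2 u s ^+ 2 != 0.
Proof.
move=> u0 s0; apply/eqP => h.
have sq0 (a b : R) : a ^+ 2 + b ^+ 2 = 0 -> a = 0 /\ b = 0.
  move=> e; have ha := sqr_ge0 a; have hb := sqr_ge0 b.
  have /eqP : a ^+ 2 = 0 by lra.
  have /eqP : b ^+ 2 = 0 by lra.
  by rewrite !sqrf_eq0 => /eqP -> /eqP ->.
have [pu qu] := sq0 _ _ h.
have J0 x : u < x -> p2 x s = 0 /\ q2 x s = 0.
  move=> ux; have x0 : 0 < x by exact: lt_trans ux.
  move: s0; rewrite le_eqVlt => /orP[/eqP s0|s0].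
    rewrite -s0 in pu *; rewrite q2_u0//; split=> //.
    have dK y : 0 < y -> is_derive y 1 (fun x => p2 x 0 * gs x) (- (2 * p1 y 0) * gs y).
      move=> y0; have d1 := is_derive_p2 0 y0; have d3 := is_derive_gauss y.
      by apply: is_derive_eq; rewrite /GRing.scale/=; ring.
    have dK0 y : 0 < y -> - (2 * p1 y 0) * gs y <= 0.
      move=> y0; rewrite mulr_le0_ge0 ?expR_ge0// oppr_le0 mulr_ge0//.
      exact: ltW (p1_gt0 y0).
    have := decreasing_pos dK dK0 u0 (ltW ux).
    rewrite pu mul0r pmulr_lle0 ?expR_gt0// => hx; apply/eqP.
    by rewrite eq_le hx p2_ge0.
  have H0 y : u < y -> skew s y = 0.
    move=> uy; have y0 : 0 < y by exact: lt_trans uy.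
    apply/eqP; rewrite eq_le skew_ge0 ?andbT ?(ltW s0)//.
    have -> : 0 = skew s u by rewrite /skew pu qu !mulr0 expr0n/=; ring.
    have dK0 t : 0 < t -> skew' s t <= 0 by move=> t0; exact: skew'_le0 t0 (ltW s0).
    exact: (decreasing_pos (@is_derive_skew s) dK0 u0 (ltW uy)).
  have := derive_zero_right H0 ux (is_derive_skew s x0).
  rewrite /skew' => /eqP; rewrite mulf_eq0 (gt_eqF (expR_gt0 _)) orbF oppr_eq0.
  have xs : 0 < x * s / 2 by rewrite divr_gt0// mulr_gt0.
  rewrite mulf_eq0 (gt_eqF xs) => /eqP e.
  exact: sq0 e.
have ux : u < u + 1 by rewrite ltrDl.
have x0 : 0 < u + 1 by exact: lt_trans ux.
have [e1 e2] := J0 _ ux.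
have dp := derive_zero_right (fun y h => (J0 y h).1) ux (is_derive_p2 s x0).
have dq := derive_zero_right (fun y h => (J0 y h).2) ux (is_derive_q2 s x0).
rewrite e1 e2 in dp dq.
have p10 : p1 (u + 1) s = 0 by lra.
have q10 : q1 (u + 1) s = 0 by lra.
move: e1; rewrite /p2 p10 q10 !mulr0 !subr0 => e1.
by have := mr_gt0 s x0; rewrite e1 ltxx.
Qed.

End TransformSigns.

(** * Invariance of Lebesgue measure under shears *)

Section Shear.
Variable R : realType.
Local Notation mu := (@lebesgue_measure R).
Local Notation mR := (measurableTypeR R).

Lemma lebesgue_translation (c : R) (A : set mR) : measurable A ->
  mu ((fun x => x + c) @^-1` A) = mu A.
Proof.
move=> mA.
have mc : measurable_fun setT (fun x : mR => x + c : mR) by exact: measurable_funD.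
rewrite -/(pushforward mu (fun x : mR => x + c : mR) A).
symmetry; apply: (@lebesgue_measure_unique R (pushforward mu (fun x : mR => x + c : mR))) => //.
move=> _ [[a b] ab <-] /=.
have -> : pushforward mu (fun x : mR => x + c : mR) `]a, b] = mu `]a - c, b - c].
  rewrite /pushforward; congr (mu _); apply/seteqP; split=> x /=;
    by rewrite !in_itv/= ltrBlDr lerBrDr.
rewrite !lebesgue_measure_itv/= !lte_fin ltrD2r.
by case: ifP => // _; rewrite -!EFinB; congr (_%:E); ring.
Qed.

Lemma integral_translation (c : R) (f : mR -> \bar R) :
  measurable_fun setT f -> (forall x, 0 <= f x)%E ->
  (\int[mu]_x f (x + c)%R = \int[mu]_x f x)%E.
Proof.
move=> mf f0.
have mc : measurable_fun setT (fun x : mR => x + c : mR) by exact: measurable_funD.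
have := @ge0_integral_pushforward _ _ _ _ R _ mc mu setT f measurableT mf (fun x _ => f0 x).
rewrite preimage_setT => <-.
by apply: eq_measure_integral => A mA _; rewrite -[RHS](lebesgue_translation c mA).
Qed.

Local Open Scope ereal_scope.

(** By Tonelli the map is a translation in each fibre. *)
Lemma shear2 d (T : measurableType d) (m : {sigma_finite_measure set T -> \bar R})
  (c : T -> mR) (F : T * mR -> \bar R) :
  measurable_fun setT c -> measurable_fun setT F -> (forall v, 0 <= F v) ->
  \int[m \x mu]_v F (v.1, (v.2 + c v.1)%R) = \int[m \x mu]_v F v.
Proof.
move=> mc mF F0.
have mG : measurable_fun setT (fun v : T * mR => F (v.1, (v.2 + c v.1)%R)).
  apply: measurableT_comp => //; apply: measurable_fun_pair => //=.
  by apply: measurable_funD => //; exact: measurableT_comp.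
rewrite [RHS](fubini_tonelli1 F mF F0) [LHS](fubini_tonelli1 _ mG (fun v => F0 _)).
apply: eq_integral => x _; rewrite /fubini_F /=.
apply: (@integral_translation (c x) (fun y => F (x, y))) => //.
by apply: measurableT_comp => //; exact: measurable_pair1.
Qed.

Lemma shear1 d (T : measurableType d) (m : {sigma_finite_measure set T -> \bar R})
  (c : T -> mR) (F : mR * T -> \bar R) :
  measurable_fun setT c -> measurable_fun setT F -> (forall v, 0 <= F v) ->
  \int[mu \x m]_v F ((v.1 + c v.2)%R, v.2) = \int[mu \x m]_v F v.
Proof.
move=> mc mF F0.
have mG : measurable_fun setT (fun v : mR * T => F ((v.1 + c v.2)%R, v.2)).
  apply: measurableT_comp => //; apply: measurable_fun_pair => //=.
  by apply: measurable_funD => //; exact: measurableT_comp.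
rewrite [RHS](etrans (fubini_tonelli1 F mF F0) (fubini_tonelli F mF F0)).
rewrite [LHS](etrans (fubini_tonelli1 _ mG (fun v => F0 _)) (fubini_tonelli _ mG (fun v => F0 _))).
apply: eq_integral => x _; rewrite /fubini_G /=.
apply: (@integral_translation (c x) (fun y => F (y, x))) => //.
by apply: measurableT_comp => //; exact: measurable_pair2.
Qed.

(* The product measure [mu \x mu] has no sigma-finite instance, hence the copy. *)
Definition leb2 : set (mR * mR)%type -> \bar R := mu \x mu.

HB.instance Definition _ := Measure.copy leb2 (mu \x mu).

Let leb2_sigma_finite : sigma_finite [set: (mR * mR)%type] leb2.
Proof.
have /sigma_finiteP[F [TF ndF Foo]] := sigma_finiteT mu.
exists (fun n => F n `*` F n).
  rewrite -setXTT TF predeqE => -[x y]; split.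
    move=> [/= [n _ Fnx] [k _ Gky]]; exists (maxn n k) => //; split => /=.
    - by move: x Fnx; exact/subsetPset/ndF/leq_maxl.
    - by move: y Gky; exact/subsetPset/ndF/leq_maxr.
  by move=> [n _ []/= ? ?]; split; exists n.
move=> k; have [? ?] := Foo k.
split; first exact: measurableX.
by rewrite /leb2 product_measure1E// lte_mul_pinfty// ge0_fin_numE.
Qed.

HB.instance Definition _ := Measure_isSigmaFinite.Build _ _ _ leb2 leb2_sigma_finite.

Lemma leb3E : leb3 R = (leb2 \x mu) :> {measure set (R3 R) -> \bar R}.
Proof. by []. Qed.

(** Tested on nonnegative functions, where Tonelli asks for no integrability; [inv3_integral] passes
    to signed ones by positive and negative parts. *)
Definition inv3 (T : R3 R -> R3 R) := measurable_fun setT T /\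
  forall F : R3 R -> \bar R, measurable_fun setT F -> (forall v, 0 <= F v) ->
  \int[leb3 R]_v F (T v) = \int[leb3 R]_v F v.

Lemma inv3_comp T U : inv3 T -> inv3 U -> inv3 (T \o U).
Proof.
move=> [mT hT] [mU hU]; split; first exact: measurableT_comp.
move=> F mF F0; rewrite -(hT F)// -(hU (F \o T))//; last by move=> v; exact: F0.
exact: measurableT_comp.
Qed.

Lemma inv3_shear_z (a b : R) :
  inv3 (fun v => (v.1.1, v.1.2, (v.2 + (a * v.1.1 + b * v.1.2))%R)).
Proof.
have mc : measurable_fun setT (fun p : mR * mR => (a * p.1 + b * p.2)%R : mR).
  by apply: measurable_funD; apply: measurable_funM.
split.
  apply: measurable_fun_pair => /=.
    have -> : (fun v : R3 R => (v.1.1, v.1.2)) = fst by apply/funext => -[[]].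
    exact: measurable_fst.
  by apply: measurable_funD => //; exact: (measurableT_comp mc measurable_fst).
move=> F mF F0; rewrite leb3E.
rewrite -[RHS](@shear2 _ _ leb2 _ F mc mF F0).
by apply: eq_integral => -[[x y] z].
Qed.

(** With the last coordinate as outer variable of integration, shears of the first two reduce to
    maps of the plane with [z] as a parameter. *)
Lemma inv3_shear_xy (T : mR -> mR * mR -> mR * mR) :
  measurable_fun setT (fun v : R3 R => T v.2 v.1) ->
  (forall z F, measurable_fun setT F -> (forall v, 0 <= F v) ->
    \int[leb2]_p F (T z p) = \int[leb2]_p F p) ->
  inv3 (fun v => (T v.2 v.1, v.2)).
Proof.
move=> mT hT.
have mTT : measurable_fun setT (fun v : R3 R => (T v.2 v.1, v.2) : R3 R).
  by apply: measurable_fun_pair.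
split=> // F mF F0; rewrite leb3E.
have mG : measurable_fun setT (fun v : R3 R => F (T v.2 v.1, v.2)).
  exact: (measurableT_comp mF).
rewrite [RHS](etrans (fubini_tonelli1 F mF F0) (fubini_tonelli F mF F0)).
rewrite [LHS](etrans (fubini_tonelli1 _ mG (fun v => F0 _)) (fubini_tonelli _ mG (fun v => F0 _))).
apply: eq_integral => z _; rewrite /fubini_G /=.
apply: (hT z (fun p => F (p, z))) => //.
by apply: measurableT_comp => //; exact: measurable_pair2.
Qed.

Lemma inv3_shear_y (a b : R) :
  inv3 (fun v => (v.1.1, (v.1.2 + (a * v.1.1 + b * v.2))%R, v.2)).
Proof.
apply: (@inv3_shear_xy (fun z p => (p.1, (p.2 + (a * p.1 + b * z))%R))).
  apply: measurable_fun_pair => /=; first exact: measurableT_comp.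
  apply: measurable_funD; first exact: measurableT_comp.
  by apply: measurable_funD; apply: measurable_funM => //; exact: measurableT_comp.
move=> z F mF F0.
apply: (@shear2 _ _ mu (fun x => (a * x + b * z)%R)) => //.
by apply: measurable_funD => //; exact: measurable_funM.
Qed.

Lemma inv3_shear_x (a b : R) :
  inv3 (fun v => ((v.1.1 + (a * v.1.2 + b * v.2))%R, v.1.2, v.2)).
Proof.
apply: (@inv3_shear_xy (fun z p => ((p.1 + (a * p.2 + b * z))%R, p.2))).
  apply: measurable_fun_pair => /=; last exact: measurableT_comp.
  apply: measurable_funD; first exact: measurableT_comp.
  by apply: measurable_funD; apply: measurable_funM => //; exact: measurableT_comp.
move=> z F mF F0.
apply: (@shear1 _ _ mu (fun x => (a * x + b * z)%R)) => //.
by apply: measurable_funD => //; exact: measurable_funM.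
Qed.

End Shear.

(** * Gaussian elimination for matrices of determinant one *)

Section Unimodular.
Variable R : realType.
Implicit Types (a b c d e f g h i : R).

Definition lin3 a b c d e f g h i (v : R3 R) : R3 R :=
  (a * v.1.1 + b * v.1.2 + c * v.2, d * v.1.1 + e * v.1.2 + f * v.2,
   g * v.1.1 + h * v.1.2 + i * v.2).

Lemma inv3_ext (T U : R3 R -> R3 R) : T =1 U -> inv3 T -> inv3 U.
Proof. by move=> /funext ->. Qed.

(** Stated backwards, for use as an elimination step: the caller chooses multipliers [x] and [y],
    and the inverse shear undoes the row operation. *)
Lemma inv3_row0 x y a b c d e f g h i :
  inv3 (lin3 (a + (x * d + y * g)) (b + (x * e + y * h)) (c + (x * f + y * i)) d e f g h i) ->
  inv3 (lin3 a b c d e f g h i).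
Proof.
move=> H; apply: inv3_ext (inv3_comp (inv3_shear_x (- x) (- y)) H) => v.
by rewrite /lin3 /=; congr (_, _, _); ring.
Qed.

Lemma inv3_row1 x y a b c d e f g h i :
  inv3 (lin3 a b c (d + (x * a + y * g)) (e + (x * b + y * h)) (f + (x * c + y * i)) g h i) ->
  inv3 (lin3 a b c d e f g h i).
Proof.
move=> H; apply: inv3_ext (inv3_comp (inv3_shear_y (- x) (- y)) H) => v.
by rewrite /lin3 /=; congr (_, _, _); ring.
Qed.

Lemma inv3_row2 x y a b c d e f g h i :
  inv3 (lin3 a b c d e f (g + (x * a + y * d)) (h + (x * b + y * e)) (i + (x * c + y * f))) ->
  inv3 (lin3 a b c d e f g h i).
Proof.
move=> H; apply: inv3_ext (inv3_comp (inv3_shear_z (- x) (- y)) H) => v.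
by rewrite /lin3 /=; congr (_, _, _); ring.
Qed.

Lemma inv3_id : inv3 (@id (R3 R)).
Proof. by split; [exact: measurable_id | ]. Qed.

(* A matrix of determinant one is a product of transvections, and each of
   these preserves Lebesgue measure. *)
Lemma inv3_step4 b c e f i : e = 1 -> e * i = 1 -> inv3 (lin3 1 b c 0 e f 0 0 i).
Proof.
move=> ->; rewrite mul1r => ->.
apply: (@inv3_row0 (- b) (- c + b * f)); apply: (@inv3_row1 0 (- f)).
apply: inv3_ext inv3_id => -[[x y] z].
by rewrite /lin3 /=; congr (_, _, _); ring.
Qed.

(** Transvections cannot rescale a row, so the pivot one is made by adding (1 - e) / h times the
    last row. If h = 0 then e is nonzero, and adding the middle row to the last one first makes h
    nonzero. *)
Lemma inv3_step3 b c e f h i : e * i - f * h = 1 -> inv3 (lin3 1 b c 0 e f 0 h i).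
Proof.
have H e' f' h' i' : h' != 0 -> e' * i' - f' * h' = 1 -> inv3 (lin3 1 b c 0 e' f' 0 h' i').
  move=> h0 D; apply: (@inv3_row1 0 ((1 - e') / h')).
  have -> : 0 + (0 * 1 + (1 - e') / h' * 0) = 0 by ring.
  have -> : e' + (0 * b + (1 - e') / h' * h') = 1 by field.
  apply: (@inv3_row2 0 (- h')).
  have -> : 0 + (0 * 1 + - h' * 0) = 0 by ring.
  have -> : h' + (0 * b + - h' * 1) = 0 by ring.
  apply: inv3_step4 => //; rewrite mul1r.
  have -> : i' + (0 * c + - h' * (f' + (0 * c + (1 - e') / h' * i')))
     = i' + - (f' * h' + (1 - e') * i') by field.
  by apply: etrans D; ring.
have [->|h0] := eqVneq h 0; last exact: H.
rewrite mulr0 subr0 => D.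
have e0 : e != 0 by apply/eqP => e0; move: D; rewrite e0 mul0r => /eqP; rewrite eq_sym oner_eq0.
apply: (@inv3_row2 0 1).
have -> : 0 + (0 * 1 + 1 * 0) = 0 :> R by ring.
apply: H; first by rewrite add0r mul0r mul1r add0r.
by apply: etrans D; ring.
Qed.

Lemma inv3_step1 b c d e f g h i :
  e * i - f * h - b * (d * i - f * g) + c * (d * h - e * g) = 1 ->
  inv3 (lin3 1 b c d e f g h i).
Proof.
move=> D; apply: (@inv3_row1 (- d) 0); apply: (@inv3_row2 (- g) 0).
have -> : d + (- d * 1 + 0 * g) = 0 by ring.
have -> : g + (- g * 1 + 0 * 0) = 0 by ring.
by apply: inv3_step3; apply: etrans D; ring.
Qed.

(** The corner is made one with the help of a nonzero entry below it. If d and g both vanish, the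
    determinant forces a to be nonzero, and adding the first row to the second creates such an
    entry. *)
Lemma inv3_lin3 a b c d e f g h i :
  a * (e * i - f * h) - b * (d * i - f * g) + c * (d * h - e * g) = 1 ->
  inv3 (lin3 a b c d e f g h i).
Proof.
have Hd a' d' e' f' : d' != 0 ->
  a' * (e' * i - f' * h) - b * (d' * i - f' * g) + c * (d' * h - e' * g) = 1 ->
  inv3 (lin3 a' b c d' e' f' g h i).
  move=> d0 D; apply: (@inv3_row0 ((1 - a') / d') 0).
  have -> : a' + ((1 - a') / d' * d' + 0 * g) = 1 by field.
  by apply: inv3_step1; apply: etrans D; field.
have [d0|d0] := eqVneq d 0; last exact: Hd.
move=> D; have [g0|g0] := eqVneq g 0.
  have a0 : a != 0.
    apply/eqP => a0; have : (0 : R) = 1 by apply: etrans D; rewrite a0 d0 g0; ring.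
    by move/eqP; rewrite eq_sym oner_eq0.
  apply: (@inv3_row1 1 0); apply: Hd; last by apply: etrans D; ring.
  by have -> : d + (1 * a + 0 * g) = a by rewrite d0 g0; ring.
apply: (@inv3_row0 0 ((1 - a) / g)).
have -> : a + (0 * d + (1 - a) / g * g) = 1 by field.
by apply: inv3_step1; apply: etrans D; field.
Qed.

Lemma lin3_det (Q : 'M[R]_3) : \det Q =
  Q 0 0 * (Q 1 1 * Q 2 2 - Q 1 2 * Q 2 1) - Q 0 1 * (Q 1 0 * Q 2 2 - Q 1 2 * Q 2 0)
  + Q 0 2 * (Q 1 0 * Q 2 1 - Q 1 1 * Q 2 0).
Proof.
rewrite (expand_det_row _ 0) !big_ord_recl big_ord0 /cofactor.
rewrite !(expand_det_row _ 0) !big_ord_recl !big_ord0 /cofactor !det_mx11.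
rewrite !mxE /=.
(* Reading entries through natural numbers lets the nested [lift] indices of the expansion compute,
   after which both sides are the same polynomial. *)
pose F (m n : nat) := Q (inord m) (inord n).
have E (i j : 'I_3) : Q i j = F i j by rewrite /F !inord_val.
rewrite !E /= /bump /= !addn0 !add0n !addn1 /=; clearbody F.
rewrite !(expr0, expr1, sqrrN, expr1n); ring.
Qed.

Definition act3 (Q : 'M[R]_3) : R3 R -> R3 R :=
  lin3 (Q 0 0) (Q 0 1) (Q 0 2) (Q 1 0) (Q 1 1) (Q 1 2) (Q 2 0) (Q 2 1) (Q 2 2).

Lemma inv3_act3 Q : \det Q = 1 -> inv3 (act3 Q).
Proof. by move=> D; apply: inv3_lin3; rewrite -D lin3_det. Qed.

End Unimodular.

(** * Integrals of products of functions of separate variables *)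

Section Product.
Context d1 d2 (T1 : measurableType d1) (T2 : measurableType d2) (R : realType).
Variables (m1 : {sigma_finite_measure set T1 -> \bar R})
  (m2 : {sigma_finite_measure set T2 -> \bar R}).
Variables (f : T1 -> R) (g : T2 -> R).
Hypothesis (intf : m1.-integrable setT (EFin \o f)).
Hypothesis (intg : m2.-integrable setT (EFin \o g)).

Lemma integrable_prod : (m1 \x m2)%E.-integrable setT (fun v => (f v.1 * g v.2)%:E).
Proof.
have mf : measurable_fun setT f by apply/measurable_EFinP; exact: measurable_int intf.
have mg : measurable_fun setT g by apply/measurable_EFinP; exact: measurable_int intg.
have mfg : measurable_fun setT (fun v : T1 * T2 => (f v.1 * g v.2)%:E).
  apply/measurable_EFinP; apply: measurable_funM.
    exact: (measurableT_comp mf measurable_fst).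
  exact: (measurableT_comp mg measurable_snd).
apply/(integrable12ltyP _ _ mfg).
have ng : (\int[m2]_y `|(g y)%:E| < +oo)%E by have /integrableP[] := intg.
have nf : (\int[m1]_x `|(f x)%:E| < +oo)%E by have /integrableP[] := intf.
under eq_integral => x _ do under eq_integral => y _ do rewrite /= normrM EFinM.
under eq_integral => x _.
  rewrite ge0_integralZl//; last exact/measurable_EFinP/measurableT_comp.
  over.
rewrite ge0_integralZr//; last 2 first.
- exact/measurable_EFinP/measurableT_comp.
- by apply: integral_ge0.
rewrite lte_mul_pinfty//.
  exact: integral_ge0.
by rewrite ge0_fin_numE// integral_ge0.
Qed.

Lemma Rintegral_prod :
  \int[(m1 \x m2)%E]_v (f v.1 * g v.2) = (\int[m1]_x f x) * (\int[m2]_y g y).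
Proof.
rewrite /Rintegral -integral12_prod_meas1; last exact: integrable_prod.
rewrite /fubini_F /=.
under eq_integral => x _.
  under eq_integral => y _ do rewrite EFinM.
  rewrite integralZl//.
  over.
have fing : (\int[m2]_y (g y)%:E)%E \is a fin_num by apply: integrable_fin_num.
have finf : (\int[m1]_x (f x)%:E)%E \is a fin_num by apply: integrable_fin_num.
rewrite -(fineK fing) integralZr// fineM//.
Qed.

End Product.

(** * The Gaussian expectation in three dimensions and its rotation invariance *)

Section Gauss3.
Variable R : realType.
Local Notation mu := (@lebesgue_measure R).
Local Notation mR := (measurableTypeR R).
Implicit Types F G : R3 R -> R.

Lemma inv3_integral (T : R3 R -> R3 R) (F : R3 R -> \bar R) :
  inv3 T -> measurable_fun setT F ->
  (\int[leb3 R]_v F (T v) = \int[leb3 R]_v F v)%E.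
Proof.
move=> [mT hT] mF; rewrite [LHS]integralE [RHS]integralE.
congr (_ - _)%E.
- apply: etrans (hT (F^\+)%E _ _) => //; last exact: measurable_funepos.
  by apply: eq_integral => v _; rewrite !funeposE.
- apply: etrans (hT (F^\-)%E _ _) => //; last exact: measurable_funeneg.
  by apply: eq_integral => v _; rewrite !funenegE.
Qed.

Lemma inv3_integrable (T : R3 R -> R3 R) (F : R3 R -> \bar R) :
  inv3 T -> (leb3 R).-integrable setT F -> (leb3 R).-integrable setT (F \o T).
Proof.
move=> [mT hT] /integrableP[mF iF]; apply/integrableP; split.
  exact: measurableT_comp.
by rewrite /= (hT (fun v => `|F v|)%E)//; exact: measurableT_comp.
Qed.

Definition gint3 F := (leb3 R).-integrable setT (fun v => (F v * maxwellian v)%:E).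
Definition E3 F : R := \int[leb3 R]_v (F v * maxwellian v).

Lemma maxwellianE (v : R3 R) : maxwellian v = phi v.1.1 * phi v.1.2 * phi v.2.
Proof.
rewrite /maxwellian /phi /sqnorm3.
set c := Num.sqrt _.
have -> : - ((v.1.1 ^+ 2 + v.1.2 ^+ 2 + v.2 ^+ 2) / 2)
  = - (v.1.1 ^+ 2 / 2) + - (v.1.2 ^+ 2 / 2) + - (v.2 ^+ 2 / 2) by ring.
rewrite !expRD exprSr expr2 !invfM; ring.
Qed.

Lemma maxwellian_gt0 (v : R3 R) : 0 < maxwellian v.
Proof. by rewrite maxwellianE; apply: mulr_gt0; [apply: mulr_gt0|]; exact: phi_gt0. Qed.

Lemma measurable_maxwellian : measurable_fun setT (@maxwellian R).
Proof.
have -> : @maxwellian R = (fun v => phi v.1.1 * phi v.1.2 * phi v.2).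
  by apply/funext => v; rewrite maxwellianE.
have m1 : measurable_fun setT (fun v : R3 R => v.1.1) by exact: measurableT_comp.
have m2 : measurable_fun setT (fun v : R3 R => v.1.2) by exact: measurableT_comp.
apply: measurable_funM; last exact: (measurableT_comp (@measurable_phi R) measurable_snd).
apply: measurable_funM; first exact: (measurableT_comp (@measurable_phi R) m1).
exact: (measurableT_comp (@measurable_phi R) m2).
Qed.

Lemma gint3_prod (a b c : R -> R) : gint a -> gint b -> gint c ->
  gint3 (fun v => a v.1.1 * b v.1.2 * c v.2) /\
  E3 (fun v => a v.1.1 * b v.1.2 * c v.2) = E1 a * E1 b * E1 c.
Proof.
move=> ia ib ic.
pose A (w : mR) := a w * phi w; pose B (w : mR) := b w * phi w.
pose C (w : mR) := c w * phi w.
have i2 : (@leb2 R).-integrable setT (EFin \o (fun p : mR * mR => A p.1 * B p.2)).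
  exact: (@integrable_prod _ _ _ _ R mu mu A B ia ib).
have e2 : \int[@leb2 R]_p (A p.1 * B p.2) = E1 a * E1 b.
  exact: (@Rintegral_prod _ _ _ _ R mu mu A B ia ib).
have i3 := @integrable_prod _ _ _ _ R (@leb2 R) mu (fun p => A p.1 * B p.2) C i2 ic.
have e3 := @Rintegral_prod _ _ _ _ R (@leb2 R) mu (fun p => A p.1 * B p.2) C i2 ic.
have E (v : R3 R) : A v.1.1 * B v.1.2 * C v.2 = a v.1.1 * b v.1.2 * c v.2 * maxwellian v.
  by rewrite maxwellianE /A /B /C; ring.
split.
  rewrite /gint3 leb3E; apply: eq_integrable i3 => // v _.
  by rewrite -E.
rewrite -e2 [in RHS]/E1 -[X in _ = _ * X]/(\int[mu]_y C y) -e3 /E3 leb3E.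
by congr Rintegral; apply/funext => v; rewrite -E.
Qed.

Lemma E3D F G : gint3 F -> gint3 G -> E3 (fun v => F v + G v) = E3 F + E3 G.
Proof.
move=> hf hg; rewrite /E3 -RintegralD//.
by congr Rintegral; apply/funext => v; rewrite mulrDl.
Qed.

Lemma E3Z (c : R) F : gint3 F -> E3 (fun v => c * F v) = c * E3 F.
Proof.
move=> hf; rewrite /E3 -RintegralZl//.
by congr Rintegral; apply/funext => v; rewrite mulrA.
Qed.

Lemma gint3D F G : gint3 F -> gint3 G -> gint3 (fun v => F v + G v).
Proof.
move=> hf hg; rewrite /gint3.
by under eq_fun do rewrite mulrDl EFinD; exact: integrableD.
Qed.

Lemma gint3Z (c : R) F : gint3 F -> gint3 (fun v => c * F v).
Proof.
move=> hf; rewrite /gint3.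
by under eq_fun do rewrite -mulrA EFinM; exact: integrableZl.
Qed.

Definition orth3 (Q : 'M[R]_3) := Q^T *m Q = 1%:M /\ \det Q = 1.

Lemma big_ord3 (V : nmodType) (F : 'I_3 -> V) : \sum_(i < 3) F i = F 0 + F 1 + F 2.
Proof.
rewrite !big_ord_recl big_ord0 addr0 addrA.
by congr (_ + F _ + F _); apply/val_inj.
Qed.

Lemma orth3_col Q (i j : 'I_3) : orth3 Q ->
  Q 0 i * Q 0 j + Q 1 i * Q 1 j + Q 2 i * Q 2 j = (i == j)%:R.
Proof.
move=> [h _]; have := congr1 (fun M : 'M[R]_3 => M i j) h.
by rewrite /= !mxE big_ord3 !mxE.
Qed.

Lemma sqnorm3_act3 Q v : orth3 Q -> sqnorm3 (act3 Q v) = sqnorm3 v.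
Proof.
move=> hQ; have e00 := orth3_col 0 0 hQ; have e11 := orth3_col 1 1 hQ.
have e22 := orth3_col 2 2 hQ; have e01 := orth3_col 0 1 hQ.
have e02 := orth3_col 0 2 hQ; have e12 := orth3_col 1 2 hQ.
move: e00 e11 e22 e01 e02 e12; rewrite /= /sqnorm3 /act3 /lin3 /=.
move: v => [[x y] z] /= e00 e11 e22 e01 e02 e12.
have -> : (Q 0 0 * x + Q 0 1 * y + Q 0 2 * z) ^+ 2 +
  (Q 1 0 * x + Q 1 1 * y + Q 1 2 * z) ^+ 2 + (Q 2 0 * x + Q 2 1 * y + Q 2 2 * z) ^+ 2
  = (Q 0 0 * Q 0 0 + Q 1 0 * Q 1 0 + Q 2 0 * Q 2 0) * x ^+ 2
  + (Q 0 1 * Q 0 1 + Q 1 1 * Q 1 1 + Q 2 1 * Q 2 1) * y ^+ 2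
  + (Q 0 2 * Q 0 2 + Q 1 2 * Q 1 2 + Q 2 2 * Q 2 2) * z ^+ 2
  + 2 * (Q 0 0 * Q 0 1 + Q 1 0 * Q 1 1 + Q 2 0 * Q 2 1) * x * y
  + 2 * (Q 0 0 * Q 0 2 + Q 1 0 * Q 1 2 + Q 2 0 * Q 2 2) * x * z
  + 2 * (Q 0 1 * Q 0 2 + Q 1 1 * Q 1 2 + Q 2 1 * Q 2 2) * y * z by ring.
rewrite e00 e11 e22 e01 e02 e12; ring.
Qed.

Lemma maxwellian_act3 Q v : orth3 Q -> maxwellian (act3 Q v) = maxwellian v.
Proof. by move=> hQ; rewrite /maxwellian sqnorm3_act3. Qed.

Lemma E3_rot Q F : orth3 Q -> measurable_fun setT F -> E3 (F \o act3 Q) = E3 F.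
Proof.
move=> hQ mF; rewrite /E3 /Rintegral; congr fine.
have mFM : measurable_fun setT (fun v => (F v * maxwellian v)%:E).
  apply/measurable_EFinP; apply: measurable_funM => //; exact: measurable_maxwellian.
rewrite -[RHS](inv3_integral (inv3_act3 hQ.2) mFM).
by apply: eq_integral => v _ /=; rewrite maxwellian_act3.
Qed.

Lemma gint3_rot Q F : orth3 Q -> gint3 F -> gint3 (F \o act3 Q).
Proof.
move=> hQ iF; have := inv3_integrable (inv3_act3 hQ.2) iF.
apply: eq_integrable => // v _.
by rewrite /= maxwellian_act3.
Qed.

End Gauss3.

(** * Complex Gaussian integrals and their reduction to one-dimensional moments *)

Section ComplexGauss.
Variable R : realType.
Local Notation C := R[i].
Implicit Types (f g : R3 R -> C).

Lemma complex_ReM (x y : C) : Re (x * y) = Re x * Re y - Im x * Im y.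
Proof. by case: x y => [a b] [c d]. Qed.
Lemma complex_ImM (x y : C) : Im (x * y) = Re x * Im y + Im x * Re y.
Proof. by case: x y => [a b] [c d]; rewrite /= addrC. Qed.
Lemma complex_ReD (x y : C) : Re (x + y) = Re x + Re y. Proof. by case: x y => [a b] [c d]. Qed.
Lemma complex_ImD (x y : C) : Im (x + y) = Im x + Im y. Proof. by case: x y => [a b] [c d]. Qed.
Lemma complex_ext (x y : C) : Re x = Re y -> Im x = Im y -> x = y.
Proof. by case: x y => [a b] [c d] /= -> ->. Qed.

Definition cgint3 f := gint3 (fun v => Re (f v)) /\ gint3 (fun v => Im (f v)).
Definition CE3 f : C := E3 (fun v => Re (f v)) +i* E3 (fun v => Im (f v)).
Definition cgint1 (g : R -> C) := gint (fun w => Re (g w)) /\ gint (fun w => Im (g w)).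
Definition CE1 (g : R -> C) : C := E1 (fun w => Re (g w)) +i* E1 (fun w => Im (g w)).

Lemma CE3_ext f g : f =1 g -> CE3 f = CE3 g.
Proof. by move=> /funext ->. Qed.

Lemma cgint3_ext f g : f =1 g -> cgint3 f -> cgint3 g.
Proof. by move=> /funext ->. Qed.

Lemma CE3D f g : cgint3 f -> cgint3 g -> CE3 (fun v => f v + g v) = CE3 f + CE3 g.
Proof.
move=> [rf jf] [rg jg]; apply: complex_ext; rewrite ?complex_ReD ?complex_ImD /= -E3D//.
  by congr E3; apply/funext => v; rewrite complex_ReD.
by congr E3; apply/funext => v; rewrite complex_ImD.
Qed.

Lemma cgint3D f g : cgint3 f -> cgint3 g -> cgint3 (fun v => f v + g v).
Proof.
move=> [rf jf] [rg jg]; split.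
  by under eq_fun do rewrite complex_ReD; exact: gint3D.
by under eq_fun do rewrite complex_ImD; exact: gint3D.
Qed.

Lemma cgint3Z (c : C) f : cgint3 f -> cgint3 (fun v => c * f v).
Proof.
move=> [rf jf]; split.
  under eq_fun do rewrite complex_ReM -mulNr; apply: gint3D; exact: gint3Z.
by under eq_fun do rewrite complex_ImM; apply: gint3D; exact: gint3Z.
Qed.

Lemma CE3Z (c : C) f : cgint3 f -> CE3 (fun v => c * f v) = c * CE3 f.
Proof.
move=> [rf jf]; apply: complex_ext; rewrite ?complex_ReM ?complex_ImM /=.
  rewrite -mulNr -!E3Z// -E3D; [|exact: gint3Z..].
  by congr E3; apply/funext => v; rewrite complex_ReM mulNr.
rewrite -!E3Z// -E3D; [|exact: gint3Z..].
by congr E3; apply/funext => v; rewrite complex_ImM.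
Qed.

Lemma cgint30 : cgint3 (fun=> 0).
Proof.
split; rewrite /gint3 /=; under eq_fun do rewrite mul0r; exact: integrable0.
Qed.

Lemma CE30 : CE3 (fun=> 0) = 0.
Proof.
by have := CE3Z 0 cgint30; rewrite !mul0r.
Qed.

(** Integrability controls only the product with the weight; dividing by the positive Maxwellian
    recovers [F]. *)
Lemma gint3_measurable (F : R3 R -> R) : gint3 F -> measurable_fun setT F.
Proof.
move=> /measurable_int/measurable_EFinP mF.
have -> : F = (fun v => F v * maxwellian v * (maxwellian v)^-1).
  by apply/funext => v; rewrite mulfK// gt_eqF// maxwellian_gt0.
apply: measurable_funM => //.
have -> : (fun v : R3 R => (maxwellian v)^-1) =
    (fun v => Num.sqrt (2 * pi) ^+ 3 * expR (sqnorm3 v / 2)).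
  by apply/funext => v; rewrite /maxwellian invfM invrK -expRN opprK.
apply: measurable_funM => //; apply: (measurableT_comp (@measurable_expR R)).
apply: measurable_funM => //; rewrite /sqnorm3.
apply: measurable_funD; [apply: measurable_funD|]; apply: measurable_funX => //;
  exact: measurableT_comp.
Qed.

Lemma cgint3_rot Q f : orth3 Q -> cgint3 f -> cgint3 (f \o act3 Q).
Proof.
by move=> hQ [rf jf]; split; [exact: (gint3_rot hQ rf) | exact: (gint3_rot hQ jf)].
Qed.

Lemma CE3_rot Q f : orth3 Q -> cgint3 f -> CE3 (f \o act3 Q) = CE3 f.
Proof.
move=> hQ [rf jf]; apply: complex_ext => /=.
  exact: (E3_rot hQ (gint3_measurable rf)).
exact: (E3_rot hQ (gint3_measurable jf)).
Qed.

Lemma E3_ae (F G : R3 R -> R) : measurable_fun setT F -> measurable_fun setT G ->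
  {ae leb3 R, forall v, F v = G v} -> E3 F = E3 G.
Proof.
move=> mF mG h; rewrite /E3 /Rintegral; congr fine.
apply: ae_eq_integral => //.
- by apply/measurable_EFinP; apply: measurable_funM => //; exact: measurable_maxwellian.
- by apply/measurable_EFinP; apply: measurable_funM => //; exact: measurable_maxwellian.
- by apply: filterS h => v -> _.
Qed.

Definition cmeas f := measurable_fun setT (fun v => Re (f v)) /\
  measurable_fun setT (fun v => Im (f v)).

Lemma cgint3_meas f : cgint3 f -> cmeas f.
Proof. by move=> [/gint3_measurable ? /gint3_measurable ?]. Qed.

Lemma CE3_ae f g : cmeas f -> cmeas g -> aeq f g -> CE3 f = CE3 g.
Proof.
move=> [rf jf] [rg jg] h; apply: complex_ext => /=.
  by apply: E3_ae => //; apply: filterS h => v ->.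
by apply: E3_ae => //; apply: filterS h => v ->.
Qed.

Definition mono3 n a b (v : R3 R) : R := v.1.1 ^+ n * v.1.2 ^+ a * v.2 ^+ b.

Lemma CE3_tensor (g : R -> C) n a b :
  cgint1 (fun w => g w * (w ^+ n)%:C) -> (a <= 4)%N -> (b <= 4)%N ->
  cgint3 (fun v => g v.1.1 * (mono3 n a b v)%:C) /\
  CE3 (fun v => g v.1.1 * (mono3 n a b v)%:C) =
   CE1 (fun w => g w * (w ^+ n)%:C) * (E1 (fun w : R => w ^+ a) * E1 (fun w : R => w ^+ b))%:C.
Proof.
move=> [ir ij] a4 b4; have ia := @gint_exp R a a4; have ib := @gint_exp R b b4.
have [r1 r2] := gint3_prod ir ia ib; have [j1 j2] := gint3_prod ij ia ib.
have eR v : Re (g v.1.1 * (v.1.1 ^+ n)%:C) * v.1.2 ^+ a * v.2 ^+ b =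
            Re (g v.1.1 * (mono3 n a b v)%:C).
  by rewrite !complex_ReM /= /mono3; ring.
have eI v : Im (g v.1.1 * (v.1.1 ^+ n)%:C) * v.1.2 ^+ a * v.2 ^+ b =
            Im (g v.1.1 * (mono3 n a b v)%:C).
  by rewrite !complex_ImM /= /mono3; ring.
move: r1 r2 j1 j2; rewrite (funext eR) (funext eI) => r1 r2 j1 j2.
split=> //; apply: complex_ext; rewrite [LHS]/=.
  by rewrite r2 complex_ReM /=; ring.
by rewrite j2 complex_ImM /=; ring.
Qed.

Definition mom (a : nat) : R := nth 0 [:: 1; 0; 1; 0; 3] a.

Lemma momE a : (a <= 4)%N -> E1 (fun w : R => w ^+ a) = mom a.
Proof.
case: a => [|[|[|[|[|//]]]]] _; rewrite /mom /=.
- exact: E1_1.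
- exact: E1_exp1.
- exact: E1_exp2.
- exact: E1_exp3.
- exact: E1_exp4.
Qed.

(** Makes each moment a finite computation: an integrand that is [g] of the first velocity times a
    polynomial is listed as coefficients with exponents, and the transverse factors integrate to
    [mom]. Both the integrand identity and the result are then left to [ring]. *)
Lemma CE3_expand (g : R -> C) (N : nat) (l : seq (C * (nat * nat * nat))) f :
  (forall n, (n <= N)%N -> cgint1 (fun w => g w * (w ^+ n)%:C)) ->
  all (fun t => [&& (t.2.1.1 <= N)%N, (t.2.1.2 <= 4)%N & (t.2.2 <= 4)%N]) l ->
  (forall v, f v = \sum_(t <- l) t.1 * (g v.1.1 * (mono3 t.2.1.1 t.2.1.2 t.2.2 v)%:C)) ->
  cgint3 f /\ CE3 f = \sum_(t <- l) t.1 *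
    (CE1 (fun w => g w * (w ^+ t.2.1.1)%:C) * (mom t.2.1.2 * mom t.2.2)%:C).
Proof.
move=> hg; elim: l f => [|[c [[n a] b]] l IH] f /=.
  move=> _ hf; have -> : f = (fun=> 0) by apply/funext => v; rewrite hf big_nil.
  by rewrite big_nil CE30; split=> //; exact: cgint30.
move=> /andP[/and3P[nN a4 b4] hl] hf.
have [g1 e1] := CE3_tensor (hg n nN) a4 b4.
have [g2 e2] := IH _ hl (fun v => erefl).
have -> : f = (fun v => c * (g v.1.1 * (mono3 n a b v)%:C) +
   \sum_(t <- l) t.1 * (g v.1.1 * (mono3 t.2.1.1 t.2.1.2 t.2.2 v)%:C)).
  by apply/funext => v; rewrite hf big_cons.
split; first by apply: cgint3D => //; exact: cgint3Z.
rewrite CE3D//; last exact: cgint3Z.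
by rewrite CE3Z// e1 e2 big_cons /= !momE.
Qed.

End ComplexGauss.

(** * Moments of the candidate eigenfunction in the aligned frame *)

Section Frame.
Variable R : realType.
Local Notation C := R[i].
Local Notation ii := ('i%C : C).

Lemma ii2 : ii * ii = -1.
Proof. by rewrite -expr2 sqr_i. Qed.

Variables (u s : R).
Hypothesis u0 : 0 < u.

Definition Gc (w : R) : C := ga u s w +i* gb u s w.
Definition zc : C := u +i* s.
Definition mc : C := mr u s +i* mi u s.
Definition I1c : C := p1 u s +i* q1 u s.
Definition J2c : C := p2 u s +i* q2 u s.

Lemma GcE w : zc * Gc w + ii * w%:C * Gc w = 1.
Proof.
have h1 := gab_re s w u0; have h2 := gab_im u s w.
by apply: complex_ext => /=; [apply: etrans h1|apply: etrans h2]; ring.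
Qed.

Lemma I1cE : I1c = 1 - zc * mc.
Proof. by apply: complex_ext; rewrite /= /p1 /q1; ring. Qed.

Lemma J2cE : J2c = mc - zc * I1c.
Proof. by apply: complex_ext; rewrite /= /p2 /q2; ring. Qed.

Lemma cgint1_Gc n : (n <= 4)%N -> cgint1 (fun w => Gc w * (w ^+ n)%:C).
Proof.
move=> n4; split.
  have := tame_gint (tame_exp_ga s u0 n4); congr gint; apply/funext => w.
  by rewrite complex_ReM /=; ring.
have := tame_gint (tame_exp_gb s u0 n4); congr gint; apply/funext => w.
by rewrite complex_ImM /=; ring.
Qed.

Lemma CE1_Gc0 : CE1 (fun w => Gc w * (w ^+ 0)%:C) = mc.
Proof.
by apply: complex_ext => /=; apply: E1_ext => w; rewrite ?complex_ReM ?complex_ImM /= expr0; ring.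
Qed.

Lemma CE1_Gc1 : CE1 (fun w => Gc w * (w ^+ 1)%:C) = - ii * I1c.
Proof.
have ha := E1_w_ga s u0; have hb := E1_w_gb s u0.
apply: complex_ext => /=.
  transitivity (E1 (fun w => w * ga u s w)).
    by apply: E1_ext => w; rewrite expr1; ring.
  by rewrite ha /p1 /q1; ring.
transitivity (E1 (fun w => w * gb u s w)).
  by apply: E1_ext => w; rewrite expr1; ring.
by rewrite hb /p1 /q1; ring.
Qed.

Lemma CE1_Gc2 : CE1 (fun w => Gc w * (w ^+ 2)%:C) = zc * I1c.
Proof.
have ha := E1_w_ga s u0; have hb := E1_w_gb s u0.
have ia : gint (fun w => w * ga u s w).
  have := tame_gint (tame_exp_ga s u0 (isT : (1 <= 4)%N)).
  by congr gint; apply/funext => w; rewrite expr1.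
have ib : gint (fun w => w * gb u s w).
  have := tame_gint (tame_exp_gb s u0 (isT : (1 <= 4)%N)).
  by congr gint; apply/funext => w; rewrite expr1.
have i1 : gint (fun w : R => w ^+ 1) by exact: gint_exp.
apply: complex_ext => /=.
  transitivity (E1 (fun w => (- u) * (w * gb u s w) + (- s) * (w * ga u s w))).
    apply: E1_ext => w; have h := gab_im u s w.
    have -> : ga u s w * w ^+ 2 - gb u s w * 0 = w * ((s + w) * ga u s w) - s * (w * ga u s w).
      by ring.
    have -> : (s + w) * ga u s w = - (u * gb u s w) by lra.
    by ring.
  rewrite E1D; [|exact: gintZ..].
  by rewrite (E1Z _ ia) (E1Z _ ib) ha hb /p1 /q1; ring.
transitivity (E1 (fun w => (u * (w * ga u s w) + (- s) * (w * gb u s w)) + (-1) * w ^+ 1)).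
  apply: E1_ext => w; have h := gab_re s w u0.
  have -> : ga u s w * 0 + gb u s w * w ^+ 2 = w * ((s + w) * gb u s w) - s * (w * gb u s w).
    by ring.
  have -> : (s + w) * gb u s w = u * ga u s w - 1 by lra.
  by ring.
rewrite E1D; [|by apply: gintD; exact: gintZ|exact: gintZ].
rewrite E1D; [|exact: gintZ..].
by rewrite (E1Z _ ia) (E1Z _ ib) (E1Z _ i1) ha hb E1_exp1 /p1 /q1; ring.
Qed.

Lemma cgint1_one n : (n <= 4)%N -> cgint1 (fun w : R => (1 : C) * (w ^+ n)%:C).
Proof.
move=> n4; split.
  by have := @gint_exp R n n4; congr gint; apply/funext => w /=; ring.
have := tame_gint (tame_cst (0 : R)); congr gint; apply/funext => w /=; ring.
Qed.

Lemma CE1_one n : (n <= 4)%N -> CE1 (fun w : R => (1 : C) * (w ^+ n)%:C) = (mom R n)%:C.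
Proof.
move=> n4; apply: complex_ext => /=.
  by rewrite -momE//; apply: E1_ext => w; ring.
rewrite -[RHS](@E1_cst R 0); apply: E1_ext => w; ring.
Qed.

(* [pt] is the local Maxwellian with moments [h] in the frame aligned with
   the wave vector, [Ft] the corresponding eigenfunction *)
Variables (kap : R) (h0 h1 h2 h3 h4 : C).

Definition pt (v : R3 R) : C := h0 + h1 * (v.1.1)%:C + h2 * (v.1.2)%:C + h3 * (v.2)%:C
  + h4 * ((sqnorm3 v - 3) / Num.sqrt 6)%:C.
Definition Ft (v : R3 R) : C := kap%:C * pt v * Gc v.1.1.

Let r6 : C := ((Num.sqrt 6)^-1)%:C.

Lemma sqrt6_neq0 : Num.sqrt 6 != 0 :> R.
Proof. by rewrite gt_eqF ?sqrtr_gt0. Qed.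

Lemma CE3_Ft : cgint3 Ft /\ CE3 Ft = kap%:C * (h0 * mc - ii * I1c * h1 - J2c * h4 * r6).
Proof.
have [] := @CE3_expand R Gc 4 [:: (kap%:C * h0, (0, 0, 0)%N); (kap%:C * h1, (1, 0, 0)%N);
  (kap%:C * h2, (0, 1, 0)%N); (kap%:C * h3, (0, 0, 1)%N); (kap%:C * (h4 * r6), (2, 0, 0)%N);
  (kap%:C * (h4 * r6), (0, 2, 0)%N); (kap%:C * (h4 * r6), (0, 0, 2)%N);
  (kap%:C * (- (3 * h4 * r6)), (0, 0, 0)%N)] Ft cgint1_Gc isT.
  by move=> v; rewrite !big_cons big_nil /Ft /pt /mono3 /r6 /sqnorm3 /=; ring.
move=> i1 ->; split=> //; rewrite !big_cons big_nil /= CE1_Gc0 CE1_Gc1 CE1_Gc2 /mom /= J2cE.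
ring.
Qed.

Lemma CE3_Ft_v2 : cgint3 (fun v => Ft v * (v.1.2)%:C) /\
  CE3 (fun v => Ft v * (v.1.2)%:C) = kap%:C * mc * h2.
Proof.
have [] := @CE3_expand R Gc 4 [:: (kap%:C * h0, (0, 1, 0)%N); (kap%:C * h1, (1, 1, 0)%N);
  (kap%:C * h2, (0, 2, 0)%N); (kap%:C * h3, (0, 1, 1)%N); (kap%:C * (h4 * r6), (2, 1, 0)%N);
  (kap%:C * (h4 * r6), (0, 3, 0)%N); (kap%:C * (h4 * r6), (0, 1, 2)%N);
  (kap%:C * (- (3 * h4 * r6)), (0, 1, 0)%N)] (fun v => Ft v * (v.1.2)%:C) cgint1_Gc isT.
  by move=> v; rewrite !big_cons big_nil /Ft /pt /mono3 /r6 /sqnorm3 /=; ring.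
move=> i1 ->; split=> //.
rewrite !big_cons big_nil /= ?CE1_Gc0 ?CE1_Gc1 ?CE1_Gc2 /mom /=.
ring.
Qed.

Lemma CE3_Ft_v3 : cgint3 (fun v => Ft v * (v.2)%:C) /\
  CE3 (fun v => Ft v * (v.2)%:C) = kap%:C * mc * h3.
Proof.
have [] := @CE3_expand R Gc 4 [:: (kap%:C * h0, (0, 0, 1)%N); (kap%:C * h1, (1, 0, 1)%N);
  (kap%:C * h2, (0, 1, 1)%N); (kap%:C * h3, (0, 0, 2)%N); (kap%:C * (h4 * r6), (2, 0, 1)%N);
  (kap%:C * (h4 * r6), (0, 2, 1)%N); (kap%:C * (h4 * r6), (0, 0, 3)%N);
  (kap%:C * (- (3 * h4 * r6)), (0, 0, 1)%N)] (fun v => Ft v * (v.2)%:C) cgint1_Gc isT.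
  by move=> v; rewrite !big_cons big_nil /Ft /pt /mono3 /r6 /sqnorm3 /=; ring.
move=> i1 ->; split=> //.
rewrite !big_cons big_nil /= ?CE1_Gc0 ?CE1_Gc1 ?CE1_Gc2 /mom /=.
ring.
Qed.

(** The transverse part of [e4] is orthogonal to everything in [pt] but the transverse energy, and
    its squared norm is 4. Hence only m appears, which makes the energy equation free of J2. *)
Lemma CE3_Ft_perp : cgint3 (fun v => Ft v * (v.1.2 ^+ 2 + v.2 ^+ 2 - 2)%:C) /\
  CE3 (fun v => Ft v * (v.1.2 ^+ 2 + v.2 ^+ 2 - 2)%:C) = 4 * kap%:C * mc * (h4 * r6).
Proof.
have [] := @CE3_expand R Gc 4 [:: (kap%:C * h0, (0, 2, 0)%N); (kap%:C * h1, (1, 2, 0)%N);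
  (kap%:C * h2, (0, 3, 0)%N); (kap%:C * h3, (0, 2, 1)%N); (kap%:C * (h4 * r6), (2, 2, 0)%N);
  (kap%:C * (h4 * r6), (0, 4, 0)%N); (kap%:C * (h4 * r6), (0, 2, 2)%N);
  (kap%:C * (- (3 * h4 * r6)), (0, 2, 0)%N); (kap%:C * h0, (0, 0, 2)%N);
  (kap%:C * h1, (1, 0, 2)%N); (kap%:C * h2, (0, 1, 2)%N); (kap%:C * h3, (0, 0, 3)%N);
  (kap%:C * (h4 * r6), (2, 0, 2)%N); (kap%:C * (h4 * r6), (0, 2, 2)%N);
  (kap%:C * (h4 * r6), (0, 0, 4)%N); (kap%:C * (- (3 * h4 * r6)), (0, 0, 2)%N);
  (-2 * (kap%:C * h0), (0, 0, 0)%N); (-2 * (kap%:C * h1), (1, 0, 0)%N);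
  (-2 * (kap%:C * h2), (0, 1, 0)%N); (-2 * (kap%:C * h3), (0, 0, 1)%N);
  (-2 * (kap%:C * (h4 * r6)), (2, 0, 0)%N); (-2 * (kap%:C * (h4 * r6)), (0, 2, 0)%N);
  (-2 * (kap%:C * (h4 * r6)), (0, 0, 2)%N);
  (-2 * (kap%:C * (- (3 * h4 * r6))), (0, 0, 0)%N)] (fun v => Ft v * (v.1.2 ^+ 2 + v.2 ^+ 2 - 2)%:C) cgint1_Gc isT.
  by move=> v; rewrite !big_cons big_nil /Ft /pt /mono3 /r6 /sqnorm3 /=; ring.
move=> i1 ->; split=> //.
rewrite !big_cons big_nil /= ?CE1_Gc0 ?CE1_Gc1 ?CE1_Gc2 /mom /=.
ring.
Qed.

Lemma CE3_pt : cgint3 pt /\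
  CE3 pt = h0.
Proof.
have [] := @CE3_expand R (fun=> 1) 4 [:: (h0, (0, 0, 0)%N); (h1, (1, 0, 0)%N);
  (h2, (0, 1, 0)%N); (h3, (0, 0, 1)%N); ((h4 * r6), (2, 0, 0)%N); ((h4 * r6), (0, 2, 0)%N);
  ((h4 * r6), (0, 0, 2)%N); ((- (3 * h4 * r6)), (0, 0, 0)%N)] pt cgint1_one isT.
  by move=> v; rewrite !big_cons big_nil /Ft /pt /mono3 /r6 /sqnorm3 /=; ring.
move=> i1 ->; split=> //.
rewrite !big_cons big_nil /= !CE1_one// /mom /=.
ring.
Qed.

Lemma CE3_pt_v1 : cgint3 (fun v => pt v * (v.1.1)%:C) /\
  CE3 (fun v => pt v * (v.1.1)%:C) = h1.
Proof.
have [] := @CE3_expand R (fun=> 1) 4 [:: (h0, (1, 0, 0)%N); (h1, (2, 0, 0)%N);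
  (h2, (1, 1, 0)%N); (h3, (1, 0, 1)%N); ((h4 * r6), (3, 0, 0)%N); ((h4 * r6), (1, 2, 0)%N);
  ((h4 * r6), (1, 0, 2)%N);
  ((- (3 * h4 * r6)), (1, 0, 0)%N)] (fun v => pt v * (v.1.1)%:C) cgint1_one isT.
  by move=> v; rewrite !big_cons big_nil /Ft /pt /mono3 /r6 /sqnorm3 /=; ring.
move=> i1 ->; split=> //.
rewrite !big_cons big_nil /= !CE1_one// /mom /=.
ring.
Qed.

(** The equation (z + i v1) Ft = kap pt solved for v1 Ft: it trades a power of v1 for a known moment
    of [pt]. *)
Lemma Ft_v1 v : Ft v * (v.1.1)%:C = (- ii * kap%:C) * pt v + (ii * zc) * Ft v.
Proof.
have h := GcE v.1.1.
have -> : Ft v * (v.1.1)%:C = - ii * kap%:C * pt v * (ii * (v.1.1)%:C * Gc v.1.1).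
  apply: etrans (_ : - (ii * ii) * (Ft v * (v.1.1)%:C) = _); first by rewrite ii2; ring.
  by rewrite /Ft; ring.
have -> : ii * (v.1.1)%:C * Gc v.1.1 = 1 - zc * Gc v.1.1 by rewrite -h; ring.
by rewrite /Ft; ring.
Qed.

Lemma CE3_Ft_v1 : cgint3 (fun v => Ft v * (v.1.1)%:C) /\
  CE3 (fun v => Ft v * (v.1.1)%:C) = - ii * kap%:C * h0 + ii * zc * CE3 Ft.
Proof.
have [ip ep] := CE3_pt; have [iF _] := CE3_Ft.
rewrite (funext Ft_v1); split; first by apply: cgint3D; exact: cgint3Z.
by rewrite CE3D; [|exact: cgint3Z..]; rewrite !CE3Z// ep.
Qed.

Lemma CE3_Ft_v1sq : cgint3 (fun v => Ft v * (v.1.1 ^+ 2)%:C) /\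
  CE3 (fun v => Ft v * (v.1.1 ^+ 2)%:C) =
  - ii * kap%:C * h1 + ii * zc * CE3 (fun v => Ft v * (v.1.1)%:C).
Proof.
have [ip ep] := CE3_pt_v1; have [iF _] := CE3_Ft_v1.
have E v : Ft v * (v.1.1 ^+ 2)%:C =
    (- ii * kap%:C) * (pt v * (v.1.1)%:C) + (ii * zc) * (Ft v * (v.1.1)%:C).
  have -> : (v.1.1 ^+ 2)%:C = (v.1.1)%:C * (v.1.1)%:C by rewrite expr2 rmorphM.
  by rewrite mulrA [X in X * _]Ft_v1; ring.
rewrite (funext E); split; first by apply: cgint3D; exact: cgint3Z.
by rewrite CE3D; [|exact: cgint3Z..]; rewrite !CE3Z// ep.
Qed.

Lemma CE3_Ft_e4 : cgint3 (fun v => Ft v * ((sqnorm3 v - 3) / Num.sqrt 6)%:C) /\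
  CE3 (fun v => Ft v * ((sqnorm3 v - 3) / Num.sqrt 6)%:C) =
  r6 * (CE3 (fun v => Ft v * (v.1.1 ^+ 2)%:C) - CE3 Ft + 4 * kap%:C * mc * (h4 * r6)).
Proof.
have [i1 e1] := CE3_Ft_v1sq; have [i0 e0] := CE3_Ft; have [ip ep] := CE3_Ft_perp.
have E v : Ft v * ((sqnorm3 v - 3) / Num.sqrt 6)%:C = r6 * ((Ft v * (v.1.1 ^+ 2)%:C + (-1) * Ft v)
   + Ft v * (v.1.2 ^+ 2 + v.2 ^+ 2 - 2)%:C).
  by rewrite /r6 /sqnorm3; ring.
have iA : cgint3 (fun v => Ft v * (v.1.1 ^+ 2)%:C + (-1) * Ft v).
  by apply: cgint3D => //; exact: cgint3Z.
rewrite (funext E); split; first by apply: cgint3Z; exact: cgint3D.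
rewrite CE3Z ?CE3D//; [|exact: cgint3Z|exact: cgint3D].
by rewrite CE3Z// ep mulN1r.
Qed.

(** The eigenvalue problem reduced to a linear system: the function built from [h] has [h] as its
    own moments. *)
Definition consistent := [/\ CE3 Ft = h0, CE3 (fun v => Ft v * (v.1.1)%:C) = h1,
  CE3 (fun v => Ft v * (v.1.2)%:C) = h2, CE3 (fun v => Ft v * (v.2)%:C) = h3 &
  CE3 (fun v => Ft v * ((sqnorm3 v - 3) / Num.sqrt 6)%:C) = h4].

Let eta : C := zc - kap%:C.

Lemma r6_neq0 : r6 != 0.
Proof. by rewrite /r6 (fmorph_eq0 (real_complex R)) invr_eq0 sqrt6_neq0. Qed.

Lemma r6_sq : r6 * r6 * 6 = 1.
Proof.
have h : Num.sqrt 6 ^+ 2 = 6 :> R by rewrite sqr_sqrtr.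
have -> : (6 : C) = (Num.sqrt 6 ^+ 2)%:C by rewrite h rmorph_nat.
rewrite /r6 -!rmorphM /= -[RHS](rmorph1 (real_complex R)); congr (_%:C).
by field; exact: sqrt6_neq0.
Qed.

Lemma consistent_shear : consistent -> kap%:C * mc * h2 = h2 /\ kap%:C * mc * h3 = h3.
Proof. by case=> _ _ e2 e3 _; rewrite -CE3_Ft_v2.2 -CE3_Ft_v3.2 e2 e3. Qed.

(** The v1 moment is conservation of mass. The density moment, computed directly, brings in J2; the
    energy moment, computed with two uses of [Ft_v1], does not. So h4 is determined twice, and the
    compatibility of the two values is what [long_rel] exploits. *)
Lemma consistent_long : consistent ->
  [/\ h1 = ii * eta * h0,
      h4 * r6 * J2c * kap%:C = h0 * (kap%:C * (mc + eta * I1c) - 1) &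
      2 * (h4 * r6) * (3 - 2 * kap%:C * mc) = - (1 + eta ^+ 2) * h0].
Proof.
case=> e0 e1 _ _ e4.
have A : h1 = ii * eta * h0 by rewrite -e1 CE3_Ft_v1.2 e0 /eta; ring.
split=> //.
  have := CE3_Ft.2; rewrite e0 A => D.
  have D1 : h0 = kap%:C * (h0 * mc - (ii * ii) * I1c * eta * h0 - J2c * h4 * r6).
    by rewrite [LHS]D; ring.
  by rewrite ii2 in D1; rewrite mulrBr mulr1 {2}D1; ring.
have := CE3_Ft_e4.2; rewrite e4 e0 CE3_Ft_v1sq.2 e1 A => D.
have D1 : h4 * r6 = r6 * r6 * ((ii * ii) * eta ^+ 2 * h0 - h0 + 4 * kap%:C * mc * (h4 * r6)).
  by rewrite [in LHS]D /eta; ring.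
rewrite ii2 in D1.
have D2 : 6 * (h4 * r6) = r6 * r6 * 6 * (-1 * eta ^+ 2 * h0 - h0 + 4 * kap%:C * mc * (h4 * r6)).
  by rewrite {1}D1; ring.
rewrite r6_sq in D2.
have -> : 2 * (h4 * r6) * (3 - 2 * kap%:C * mc) = 6 * (h4 * r6) - 4 * kap%:C * mc * (h4 * r6) by ring.
by rewrite D2; ring.
Qed.

End Frame.

(** * The block rotation on moment vectors *)

Section Qtilde.
Variables (R : realType) (Q : 'M[R]_3).
Local Notation C := R[i].

Lemma QtildeE : Qtilde Q = mx_of_rows 5 5
  [:: [:: 1; 0; 0; 0; 0]; [:: 0; (Q 0 0)%:C; (Q 0 1)%:C; (Q 0 2)%:C; 0];
      [:: 0; (Q 1 0)%:C; (Q 1 1)%:C; (Q 1 2)%:C; 0];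
      [:: 0; (Q 2 0)%:C; (Q 2 1)%:C; (Q 2 2)%:C; 0]; [:: 0; 0; 0; 0; 1]].
Proof.
apply/matrixP; change (1 + (3 + 1))%N with 5%N => i j; rewrite /Qtilde.
rewrite !mxE; case: (@splitP 1 (3 + 1) i) => i1 Ei; rewrite mxE; case: (@splitP 1 (3 + 1) j) => j1 Ej;
  rewrite ?mxE.
- by rewrite Ei Ej !ord1.
- rewrite Ei !ord1 /= Ej /=; by case: j1 Ej => [[|[|[|[|//]]]] hj] /=.
- rewrite Ej !ord1 /= Ei /=; by case: i1 Ei => [[|[|[|[|//]]]] hi] /=.
- case: (@splitP 3 1 i1) => i2 Ei2; rewrite mxE; case: (@splitP 3 1 j1) => j2 Ej2; rewrite ?mxE.
  + rewrite Ei Ei2 Ej Ej2 /=.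
    case: i2 Ei2 => [[|[|[|//]]] hi] _; case: j2 Ej2 => [[|[|[|//]]] hj] _ /=;
    congr ((Q _ _)%:C); exact/val_inj.
  + by rewrite Ei Ei2 Ej Ej2 !ord1 /=; case: i2 Ei2 => [[|[|[|//]]] hi].
  + by rewrite Ei Ei2 Ej Ej2 !ord1 /=; case: j2 Ej2 => [[|[|[|//]]] hj].
  + by rewrite Ei Ei2 Ej Ej2 !ord1 /=.
Qed.

Lemma big_ord5 (V : nmodType) (F : 'I_5 -> V) : \sum_(i < 5) F i = F 0 + F 1 + F 2 + F 3 + F 4.
Proof.
rewrite !big_ord_recl big_ord0 addr0 !addrA.
by congr (_ + F _ + F _ + F _ + F _); apply/val_inj.
Qed.

Lemma ord5_ind (P : 'I_5 -> Prop) : P 0 -> P 1 -> P 2 -> P 3 -> P 4 -> forall i, P i.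
Proof.
move=> p0 p1 p2 p3 p4; case=> [[|[|[|[|[|//]]]]] hi].
- by move: p0; congr P; exact/val_inj.
- by move: p1; congr P; exact/val_inj.
- by move: p2; congr P; exact/val_inj.
- by move: p3; congr P; exact/val_inj.
- by move: p4; congr P; exact/val_inj.
Qed.

Lemma Qtilde_mul (h : 'cV[C]_5) :
  [/\ (Qtilde Q *m h) 0 0 = h 0 0,
      (Qtilde Q *m h) 1 0 = (Q 0 0)%:C * h 1 0 + (Q 0 1)%:C * h 2 0 + (Q 0 2)%:C * h 3 0,
      (Qtilde Q *m h) 2 0 = (Q 1 0)%:C * h 1 0 + (Q 1 1)%:C * h 2 0 + (Q 1 2)%:C * h 3 0,
      (Qtilde Q *m h) 3 0 = (Q 2 0)%:C * h 1 0 + (Q 2 1)%:C * h 2 0 + (Q 2 2)%:C * h 3 0 &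
      (Qtilde Q *m h) 4 0 = h 4 0].
Proof.
by rewrite QtildeE; split; rewrite !mxE big_ord5 !mxE /= ?mul0r ?mul1r ?add0r ?addr0.
Qed.

Hypothesis hQ : orth3 Q.

Lemma Qtilde_orth : (Qtilde Q)^T *m Qtilde Q = 1%:M.
Proof.
pose A := block_mx (map_mx (real_complex R) Q) 0 0 1%:M : 'M[C]_(3 + 1).
have AA : A^T *m A = 1%:M.
  rewrite /A tr_block_mx mulmx_block !trmx0 !trmx1 !mul0mx !mulmx0 !mulmx1 ?addr0 ?add0r.
  by rewrite map_trmx -map_mxM hQ.1 map_mx1 -scalar_mx_block.
pose B := block_mx 1%:M 0 0 A : 'M[C]_(1 + (3 + 1)).
suff : B^T *m B = 1%:M by [].
rewrite /B tr_block_mx mulmx_block !trmx0 !trmx1 !mul0mx !mulmx0 !mulmx1 ?addr0 ?add0r.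
by rewrite AA -scalar_mx_block.
Qed.

Lemma det_Qtilde : \det (Qtilde Q) = 1.
Proof.
pose A := block_mx (map_mx (real_complex R) Q) 0 0 1%:M : 'M[C]_(3 + 1).
have dA : \det A = 1 by rewrite /A det_ublock det1 mulr1 det_map_mx hQ.2 rmorph1.
pose B := block_mx 1%:M 0 0 A : 'M[C]_(1 + (3 + 1)).
suff : \det B = 1 by [].
by rewrite /B det_ublock det1 dA mulr1.
Qed.

End Qtilde.

Lemma det3 (T : comNzRingType) (A : 'M[T]_3) : \det A =
  A 0 0 * (A 1 1 * A 2 2 - A 1 2 * A 2 1) - A 0 1 * (A 1 0 * A 2 2 - A 1 2 * A 2 0)
  + A 0 2 * (A 1 0 * A 2 1 - A 1 1 * A 2 0).
Proof.
rewrite (expand_det_row _ 0) !big_ord_recl big_ord0 /cofactor.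
rewrite !(expand_det_row _ 0) !big_ord_recl !big_ord0 /cofactor !det_mx11.
rewrite !mxE /=.
pose F (m n : nat) := A (inord m) (inord n).
have E (i j : 'I_3) : A i j = F i j by rewrite /F !inord_val.
rewrite !E /= /bump /= !addn0 !add0n !addn1 /=; clearbody F.
rewrite !(expr0, expr1, sqrrN, expr1n); ring.
Qed.

(** * The conjugated matrix by Cramer's rule *)

Section Cramer.
Variable R : realType.
Local Notation C := R[i].
Local Notation ii := ('i%C : C).

Lemma det5 (a0 a1 a2 b0 b1 b2 c0 c1 c2 : C) :
  \det (mx_of_rows 5 5 [:: [:: a0; a1; a2; 0; 0]; [:: b0; b1; b2; 0; 0];
    [:: 0; 0; 0; 1; 0]; [:: 0; 0; 0; 0; 1]; [:: c0; c1; c2; 0; 0]]) =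
  a0 * (b1 * c2 - b2 * c1) - a1 * (b0 * c2 - b2 * c0) + a2 * (b0 * c1 - b1 * c0).
Proof.
set A := mx_of_rows _ _ _.
have A2 : A 2 3 = 1 by rewrite mxE.
rewrite (expand_det_row A 2) (bigD1 (3 : 'I_5))//= big1 ?addr0 => [|j]; last first.
  by elim/ord5_ind: j => // _; rewrite mxE mul0r.
rewrite A2 mul1r /cofactor; set B := row' _ _.
(* Deleting row 2 and column 3 moves the other unit entry from (3, 4) to (2, 3), so the two cofactor
   signs cancel. *)
have B2 : B 2 3 = 1 by rewrite !mxE.
have Bz (j : 'I_4) : j != 3 -> B 2 j = 0.
  by case: j => [[|[|[|[|//]]]] hj] // _; rewrite !mxE.
rewrite (expand_det_row B 2) (bigD1 (3 : 'I_4))//= big1 ?addr0 => [|j /Bz ->]; last by rewrite mul0r.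
rewrite B2 mul1r /cofactor det3 !mxE /=.
rewrite -signr_odd -[X in _ * (X * _)]signr_odd /= expr1; ring.
Qed.

Section Entries.
Variables (k : R) (th : C -> C) (l1 l2 l3 ls : C).
Hypothesis k0 : k != 0.
Let K := k%:C.
Let I := ii / K.

Definition Hhat : 'M[C]_5 := mx_of_rows 5 5
    [:: [:: 1;      1;        1;         0; 0];
        [:: I * l1; I * l2; I * l3; 0; 0];
        [:: 0;      0;        0;         1; 0];
        [:: 0;      0;        0;         0; 1];
        [:: th l1;   th l2;   th l3;   0; 0]].

(** It vanishes exactly when the three points (l, th l) are collinear. Under conjugation of l2 and
    l3 it is purely imaginary, so its imaginary part carries all the information. *)
Definition gram : C := (l2 - l1) * (th l3 - th l1) - (l3 - l1) * (th l2 - th l1).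

Lemma det_Hhat : \det Hhat = I * gram.
Proof. by rewrite det5 /gram; ring. Qed.

Let K0 : K != 0. Proof. by rewrite (fmorph_eq0 (real_complex R)). Qed.

Lemma ik_sq : I * I = - (K ^+ 2)^-1.
Proof. by rewrite /I mulrACA ii2 -invfM -expr2 mulN1r. Qed.

Let D := \det Hhat.
Hypothesis D0 : D != 0.
Let DV : D^-1 * D = 1. Proof. exact: mulVf. Qed.

Lemma C1_det : C1 k D th l1 l2 l3 * D = - (I * I) *
  (l1 * l3 * (l1 - l3) * th l2 + l2 * l1 * (l2 - l1) * th l3 + l3 * l2 * (l3 - l2) * th l1).
Proof.
rewrite /C1 /cyc_sum ik_sq -/K div1r invfM.
set S := _ + _ + _; transitivity ((K ^+ 2)^-1 * S * (D^-1 * D)); first by ring.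
by rewrite DV opprK mulr1.
Qed.

Lemma C2_det : C2 k D th l1 l2 l3 * D = I *
  ((l1 ^+ 2 - l3 ^+ 2) * th l2 + (l2 ^+ 2 - l1 ^+ 2) * th l3 + (l3 ^+ 2 - l2 ^+ 2) * th l1).
Proof.
rewrite /C2 /cyc_sum -/K invfM.
set S := _ + _ + _; transitivity (ii / K * S * (D^-1 * D)); first by ring.
by rewrite DV mulr1.
Qed.

Lemma C3_det : C3 k D l1 l2 l3 * D = (I * I) * ((l1 - l2) * (l2 - l3) * (l3 - l1)).
Proof.
rewrite /C3 /cyc_prod ik_sq -/K div1r invfM.
set S := _ * _ * (_ - _); transitivity (- (K ^+ 2)^-1 * S * (D^-1 * D)); first by ring.
by rewrite DV mulr1.
Qed.

Lemma C4_det : C4 k D th l1 l2 l3 * D = I *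
  (l2 * (l1 - l3) * th l1 * th l3 + l3 * (l2 - l1) * th l2 * th l1 + l1 * (l3 - l2) * th l3 * th l2).
Proof.
rewrite /C4 /cyc_sum -/K invfM.
set S := _ + _ + _; transitivity (ii / K * S * (D^-1 * D)); first by ring.
by rewrite DV mulr1.
Qed.

Lemma C5_det : C5 D th l1 l2 l3 * D =
  (l3 - l1) * th l1 * th l3 + (l1 - l2) * th l2 * th l1 + (l2 - l3) * th l3 * th l2.
Proof.
rewrite /C5 /cyc_sum div1r.
set S := _ + _ + _; transitivity (S * (D^-1 * D)); first by ring.
by rewrite DV mulr1.
Qed.

Lemma C6_det : C6 k D th l1 l2 l3 * D = - I *
  (l1 * th l1 * (l2 - l3) + l2 * th l2 * (l3 - l1) + l3 * th l3 * (l1 - l2)).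
Proof.
rewrite /C6 /cyc_sum -/K invfM.
set S := _ + _ + _; transitivity (- (ii / K) * S * (D^-1 * D)); first by ring.
by rewrite DV mulr1.
Qed.

Definition Cmx : 'M[C]_5 := mx_of_rows 5 5
  [:: [:: 0;  - ii * K; 0; 0; 0];
      [:: C1 k D th l1 l2 l3; C2 k D th l1 l2 l3; 0; 0; C3 k D l1 l2 l3];
      [:: 0;  0;           ls; 0; 0];
      [:: 0;  0;           0; ls; 0];
      [:: C4 k D th l1 l2 l3; C5 D th l1 l2 l3; 0; 0; C6 k D th l1 l2 l3]].

(** An interpolation problem: (C1, C2, C3) is the row sending (1, I l, th l) to I l^2 at three
    nodes. After multiplication by the determinant, Cramer's solution becomes a polynomial identity
    at each node. *)
Lemma Cmx_row1 l : l \in [:: l1; l2; l3] ->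
  C1 k D th l1 l2 l3 + C2 k D th l1 l2 l3 * (I * l) + C3 k D l1 l2 l3 * th l = I * l * l.
Proof.
move=> hl; apply: (mulIf D0).
transitivity (C1 k D th l1 l2 l3 * D + C2 k D th l1 l2 l3 * D * (I * l) + C3 k D l1 l2 l3 * D * th l).
  by ring.
rewrite C1_det C2_det C3_det /D det_Hhat /gram.
by move: hl; rewrite !inE => /or3P[] /eqP ->; ring.
Qed.

Lemma Cmx_row4 l : l \in [:: l1; l2; l3] ->
  C4 k D th l1 l2 l3 + C5 D th l1 l2 l3 * (I * l) + C6 k D th l1 l2 l3 * th l = th l * l.
Proof.
move=> hl; apply: (mulIf D0).
transitivity (C4 k D th l1 l2 l3 * D + C5 D th l1 l2 l3 * D * (I * l) + C6 k D th l1 l2 l3 * D * th l).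
  by ring.
rewrite C4_det C5_det C6_det /D det_Hhat /gram.
by move: hl; rewrite !inE => /or3P[] /eqP ->; ring.
Qed.

(** The first row is the continuity equation. *)
Lemma Cmx_row0 l : - ii * K * (I * l) = l.
Proof.
rewrite /I; transitivity (- (ii * ii) * (K * K^-1) * l); first by ring.
by rewrite ii2 opprK mulfV// !mul1r.
Qed.

Lemma Hhat_diag :
  Hhat *m diag_mx (mx_of_rows 1 5 [:: [:: l1; l2; l3; ls; ls]]) = Cmx *m Hhat.
Proof.
have h1 : l1 \in [:: l1; l2; l3] by rewrite !inE eqxx.
have h2 : l2 \in [:: l1; l2; l3] by rewrite !inE eqxx orbT.
have h3 : l3 \in [:: l1; l2; l3] by rewrite !inE eqxx !orbT.
have [[r01 r11] r41] := (Cmx_row0 l1, Cmx_row1 h1, Cmx_row4 h1).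
have [[r02 r12] r42] := (Cmx_row0 l2, Cmx_row1 h2, Cmx_row4 h2).
have [[r03 r13] r43] := (Cmx_row0 l3, Cmx_row1 h3, Cmx_row4 h3).
rewrite mul_mx_diag /Cmx /Hhat -/D; move: r01 r11 r41 r02 r12 r42 r03 r13 r43.
move: (C1 _ _ _ _ _ _) (C2 _ _ _ _ _ _) (C3 _ _ _ _ _) (C4 _ _ _ _ _ _) (C5 _ _ _ _ _) (C6 _ _ _ _ _ _).
move=> c1 c2 c3 c4 c5 c6 r01 r11 r41 r02 r12 r42 r03 r13 r43.
apply/matrixP => i j; rewrite !mxE big_ord5 !mxE /=.
elim/ord5_ind: i; elim/ord5_ind: j => /=;
  rewrite ?mul0r ?mulr0 ?add0r ?addr0 ?mul1r ?mulr1 ?mul1r//.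
Qed.

End Entries.
End Cramer.

(** * The moment map and rotations of velocity space *)

Section Moments.
Variable R : realType.
Local Notation C := R[i].
Implicit Types (f g : R3 R -> C).

Definition ebasisr (j : 'I_5) (v : R3 R) : R :=
  nth 0 [:: 1; v.1.1; v.1.2; v.2; (sqnorm3 v - 3) / Num.sqrt 6] j.

Lemma innerE f j : inner f (ebasis j) = CE3 (fun v => f v * (ebasisr j v)%:C).
Proof.
rewrite /inner /cintegral /CE3 /E3 /ebasis.
congr (_ +i* _); congr Rintegral; apply/funext => v.
  by rewrite !complex_ReM !complex_ImM /= -/(ebasisr j v); ring.
by rewrite !complex_ImM !complex_ReM /= -/(ebasisr j v); ring.
Qed.

Lemma measurable_ebasisr j : measurable_fun setT (ebasisr j).
Proof.
have m1 : measurable_fun setT (fun v : R3 R => v.1.1) by exact: measurableT_comp.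
have m2 : measurable_fun setT (fun v : R3 R => v.1.2) by exact: measurableT_comp.
have m3 : measurable_fun setT (fun v : R3 R => v.2) by exact: measurable_snd.
elim/ord5_ind: j; [exact: measurable_cst|exact: m1|exact: m2|exact: m3|].
apply: measurable_funM; last exact: measurable_cst.
apply: measurable_funB; last exact: measurable_cst.
by apply: measurable_funD; [apply: measurable_funD|]; apply: measurable_funX.
Qed.

Lemma cmeas_ebasisr f j : cmeas f -> cmeas (fun v => f v * (ebasisr j v)%:C).
Proof.
move=> [mr mi]; have mj := measurable_ebasisr j; split.
  by under eq_fun do rewrite complex_ReM /= mulr0 subr0; exact: measurable_funM.
by under eq_fun do rewrite complex_ImM /= mulr0 add0r; exact: measurable_funM.
Qed.

Lemma inL2_cmeas f : inL2 f -> cmeas f. Proof. by case. Qed.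

Lemma moments_ae f g : cmeas f -> cmeas g -> aeq f g -> moments f = moments g.
Proof.
move=> mf mg h; apply/matrixP => j l; rewrite !mxE !innerE; apply: CE3_ae.
- exact: cmeas_ebasisr.
- exact: cmeas_ebasisr.
- by apply: filterS h => v ->.
Qed.

End Moments.

Section Rotation.
Variables (R : realType) (Q : 'M[R]_3).
Local Notation C := R[i].
Hypothesis hQ : orth3 Q.

Lemma orth3_tr : orth3 Q^T.
Proof. by split; rewrite ?trmxK ?det_tr; [exact: (mulmx1C hQ.1) | exact: hQ.2]. Qed.

Lemma act3_trK v : act3 Q^T (act3 Q v) = v.
Proof.
have E i j := orth3_col i j hQ.
move: v => [[x y] z]; rewrite /act3 /lin3 /= !mxE.
have := (E 0 0, E 0 1, E 0 2, E 1 0, E 1 1, E 1 2, E 2 0, E 2 1, E 2 2).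
rewrite /= => -[[[[[[[[e00 e01] e02] e10] e11] e12] e20] e21] e22].
congr (_, _, _).
- transitivity ((Q 0 0 * Q 0 0 + Q 1 0 * Q 1 0 + Q 2 0 * Q 2 0) * x
   + (Q 0 0 * Q 0 1 + Q 1 0 * Q 1 1 + Q 2 0 * Q 2 1) * y
   + (Q 0 0 * Q 0 2 + Q 1 0 * Q 1 2 + Q 2 0 * Q 2 2) * z); first by ring.
  by rewrite e00 e01 e02; ring.
- transitivity ((Q 0 1 * Q 0 0 + Q 1 1 * Q 1 0 + Q 2 1 * Q 2 0) * x
   + (Q 0 1 * Q 0 1 + Q 1 1 * Q 1 1 + Q 2 1 * Q 2 1) * y
   + (Q 0 1 * Q 0 2 + Q 1 1 * Q 1 2 + Q 2 1 * Q 2 2) * z); first by ring.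
  by rewrite e10 e11 e12; ring.
- transitivity ((Q 0 2 * Q 0 0 + Q 1 2 * Q 1 0 + Q 2 2 * Q 2 0) * x
   + (Q 0 2 * Q 0 1 + Q 1 2 * Q 1 1 + Q 2 2 * Q 2 1) * y
   + (Q 0 2 * Q 0 2 + Q 1 2 * Q 1 2 + Q 2 2 * Q 2 2) * z); first by ring.
  by rewrite e20 e21 e22; ring.
Qed.

End Rotation.

(** * Eigenfunctions as solutions of the reduced moment system *)

Section Eigen.
Variables (R : realType) (tau : R) (kv : 'cV[R]_3) (Q : 'M[R]_3) (lam : R[i]).
Local Notation C := R[i].
Local Notation ii := ('i%C : C).
Let k := enorm kv.
Hypothesis tau0 : 0 < tau.
Hypothesis k0 : 0 < k.
Hypothesis al : aligns Q kv.
Hypothesis hlam : - tau^-1 < Re lam.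
Let hQ : orth3 Q. Proof. by case: al. Qed.
Let hQt := orth3_tr hQ.

Definition inv_ktau := (k * tau)^-1.
Definition z_re := inv_ktau * (tau * Re lam + 1).
Definition z_im := inv_ktau * (tau * Im lam).

Lemma inv_ktau_gt0 : 0 < inv_ktau. Proof. by rewrite invr_gt0 mulr_gt0. Qed.

Lemma z_re_gt0 : 0 < z_re.
Proof.
apply: mulr_gt0; first exact: inv_ktau_gt0.
have : tau * (- tau^-1) < tau * Re lam by rewrite ltr_pM2l.
by rewrite mulrN mulfV ?gt_eqF//; lra.
Qed.
Let u0 := z_re_gt0.

Lemma zcE : zc z_re z_im = inv_ktau%:C * (tau%:C * lam + 1).
Proof.
apply: complex_ext; rewrite !(complex_ReM, complex_ImM, complex_ReD, complex_ImD) /= /z_re /z_im; ring.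
Qed.

Lemma act3_Qtr v : act3 Q (act3 Q^T v) = v.
Proof. by have := act3_trK hQt v; rewrite trmxK. Qed.

Lemma kvE i : kv i 0 = Q i 0 * k.
Proof.
case: al => _ _ /(congr1 (fun M : 'cV[R]_3 => M i 0)) <-.
by rewrite !mxE big_ord3 !mxE /= !mulr0 !addr0.
Qed.

Lemma dot3_act v : dot3 (act3 Q v) kv = k * v.1.1.
Proof.
have h := congr1 (fun w : R3 R => w.1.1) (act3_trK hQ v); rewrite /act3 /lin3 /= !mxE in h.
by rewrite -[in RHS]h /dot3 !kvE /act3 /lin3 /=; ring.
Qed.

Definition Fh (h : 'cV[C]_5) := Ft z_re z_im inv_ktau (h 0 0) (h 1 0) (h 2 0) (h 3 0) (h 4 0).
Definition pth (h : 'cV[C]_5) := @pt R (h 0 0) (h 1 0) (h 2 0) (h 3 0) (h 4 0).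
Definition resf (h : 'cV[C]_5) v := Fh h (act3 Q^T v).
Definition selfcons (h : 'cV[C]_5) := consistent z_re z_im inv_ktau (h 0 0) (h 1 0) (h 2 0) (h 3 0) (h 4 0).

Lemma P5_act f h v : moments f = Qtilde Q *m h -> P5 f (act3 Q v) = pth h v.
Proof.
move=> hm; have E i j := orth3_col i j hQ.
rewrite /P5 (eq_bigr (fun j => moments f j 0 * ebasis j (act3 Q v))); last first.
  by move=> j _; rewrite !mxE.
rewrite hm big_ord5; have [-> -> -> -> ->] := Qtilde_mul Q h.
rewrite /ebasis sqnorm3_act3// /pth /pt.
have := (E 0 0, E 0 1, E 0 2, E 1 0, E 1 1, E 1 2, E 2 0, E 2 1, E 2 2).
rewrite /= => -[[[[[[[[e00 e01] e02] e10] e11] e12] e20] e21] e22].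
move: v => [[x y] z]; rewrite /sqnorm3 /=.
transitivity (h 0 0 + (h 1 0 *
  ((Q 0 0 * Q 0 0 + Q 1 0 * Q 1 0 + Q 2 0 * Q 2 0) * x
   + (Q 0 0 * Q 0 1 + Q 1 0 * Q 1 1 + Q 2 0 * Q 2 1) * y
   + (Q 0 0 * Q 0 2 + Q 1 0 * Q 1 2 + Q 2 0 * Q 2 2) * z)%:C
  + h 2 0 * ((Q 0 1 * Q 0 0 + Q 1 1 * Q 1 0 + Q 2 1 * Q 2 0) * x
   + (Q 0 1 * Q 0 1 + Q 1 1 * Q 1 1 + Q 2 1 * Q 2 1) * y
   + (Q 0 1 * Q 0 2 + Q 1 1 * Q 1 2 + Q 2 1 * Q 2 2) * z)%:C
  + h 3 0 * ((Q 0 2 * Q 0 0 + Q 1 2 * Q 1 0 + Q 2 2 * Q 2 0) * x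
   + (Q 0 2 * Q 0 1 + Q 1 2 * Q 1 1 + Q 2 2 * Q 2 1) * y
   + (Q 0 2 * Q 0 2 + Q 1 2 * Q 1 2 + Q 2 2 * Q 2 2) * z)%:C)
   + h 4 0 * ((x ^+ 2 + y ^+ 2 + z ^+ 2 - 3) / Num.sqrt 6)%:C); first by ring.
rewrite e00 e01 e02 e10 e11 e12 e20 e21 e22 !mul0r !mul1r !addr0 !add0r; ring.
Qed.

Definition Mh (h : 'cV[C]_5) : 'cV[C]_5 := \col_j CE3 (fun v => Fh h v * (ebasisr j v)%:C).

Lemma cgint3_Fh h j : cgint3 (fun v => Fh h v * (ebasisr j v)%:C).
Proof.
elim/ord5_ind: j; rewrite /ebasisr /=.
- apply: cgint3_ext (CE3_Ft z_im u0 inv_ktau (h 0 0) (h 1 0) (h 2 0) (h 3 0) (h 4 0)).1 => v.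
  by rewrite mulr1.
- exact: (CE3_Ft_v1 z_im u0 _ _ _ _ _ _).1.
- exact: (CE3_Ft_v2 z_im u0 _ _ _ _ _ _).1.
- exact: (CE3_Ft_v3 z_im u0 _ _ _ _ _ _).1.
- exact: (CE3_Ft_e4 z_im u0 _ _ _ _ _ _).1.
Qed.

Lemma selfconsE h : selfcons h <-> Mh h = h.
Proof.
have E0 : CE3 (Fh h) = CE3 (fun v => Fh h v * (ebasisr 0 v)%:C).
  by apply: CE3_ext => v; rewrite /ebasisr mulr1.
split=> [[e0 e1 e2 e3 e4]|e].
  apply/matrixP => i j; rewrite ord1 !mxE; elim/ord5_ind: i => //.
  by rewrite -E0.
have e' i : Mh h i 0 = h i 0 by rewrite e.
split; rewrite -/(Fh h).
- by rewrite E0 -(e' 0) mxE.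
- by rewrite -(e' 1) mxE.
- by rewrite -(e' 2) mxE.
- by rewrite -(e' 3) mxE.
- by rewrite -(e' 4) mxE.
Qed.

(** A rotation mixes the three velocity moments among themselves and fixes [e0] and [e4], which is
    the block structure of [Qtilde]. *)
Lemma resf_ebasisr h j : cgint3 (fun v => resf h v * (ebasisr j v)%:C) /\
  CE3 (fun v => resf h v * (ebasisr j v)%:C) = (Qtilde Q *m Mh h) j 0.
Proof.
have [q0 q1 q2 q3 q4] := Qtilde_mul Q (Mh h).
pose G (v : R3 R) := Fh h v * (ebasisr j (act3 Q v))%:C.
have EG : (fun v => resf h v * (ebasisr j v)%:C) = G \o act3 Q^T.
  by apply/funext => v; rewrite /G /= act3_Qtr.
suff [iG ->] : cgint3 G /\ (Qtilde Q *m Mh h) j 0 = CE3 G.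
  by rewrite EG; split; [exact: cgint3_rot | exact: CE3_rot].
have lin (a b c : R) (G' := fun v => a%:C * (Fh h v * (ebasisr 1 v)%:C)
    + b%:C * (Fh h v * (ebasisr 2 v)%:C) + c%:C * (Fh h v * (ebasisr 3 v)%:C)) :
    cgint3 G' /\ CE3 G' = a%:C * Mh h 1 0 + b%:C * Mh h 2 0 + c%:C * Mh h 3 0.
  have i1 := cgint3Z a%:C (cgint3_Fh h 1); have i2 := cgint3Z b%:C (cgint3_Fh h 2).
  have i3 := cgint3Z c%:C (cgint3_Fh h 3).
  have i12 := cgint3D i1 i2.
  split; first exact: cgint3D.
  by rewrite CE3D// CE3D// !CE3Z ?mxE//; exact: cgint3_Fh.
have linE (a b c : R) : (fun v => Fh h v * (a * v.1.1 + b * v.1.2 + c * v.2)%:C) =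
  (fun v => a%:C * (Fh h v * (ebasisr 1 v)%:C)
    + b%:C * (Fh h v * (ebasisr 2 v)%:C) + c%:C * (Fh h v * (ebasisr 3 v)%:C)).
  by apply/funext => v; rewrite /ebasisr /=; ring.
rewrite /G; elim/ord5_ind: j {G EG}.
- by split; [exact: (cgint3_Fh h 0) | rewrite q0 mxE].
- rewrite q1; have [i e] := lin (Q 0 0) (Q 0 1) (Q 0 2).
  by rewrite -e -linE; split=> //; rewrite linE.
- rewrite q2; have [i e] := lin (Q 1 0) (Q 1 1) (Q 1 2).
  by rewrite -e -linE; split=> //; rewrite linE.
- rewrite q3; have [i e] := lin (Q 2 0) (Q 2 1) (Q 2 2).
  by rewrite -e -linE; split=> //; rewrite linE.
- have E : (fun v => Fh h v * (ebasisr 4 (act3 Q v))%:C) = (fun v => Fh h v * (ebasisr 4 v)%:C).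
    by apply/funext => v; rewrite /ebasisr /= sqnorm3_act3.
  by rewrite E; split; [exact: (cgint3_Fh h 4) | rewrite q4 mxE].
Qed.

Lemma moments_resf h : moments (resf h) = Qtilde Q *m Mh h.
Proof.
apply/matrixP => j l; rewrite ord1 !mxE innerE (resf_ebasisr h j).2.
by rewrite mxE.
Qed.

(** Once the moments are fixed, P5 f is a known function and the eigenvalue equation at [v] is a
    scalar linear equation for f v; its coefficient, a multiple of z + i v1, is invertible. The
    equivalence is pointwise, so it passes to almost-everywhere statements. *)
Lemma resf_pde f h : moments f = Qtilde Q *m h ->
  forall v, Lop tau kv f v = lam * f v <-> f v = resf h v.
Proof.
move=> hm v; pose w := act3 Q^T v; have vE : v = act3 Q w by rewrite act3_Qtr.
have hP := P5_act w hm; have hd := dot3_act w; rewrite -vE in hP hd.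
have hG := GcE z_im u0 w.1.1; rewrite zcE in hG.
have t0 : tau%:C != 0 :> C by rewrite (fmorph_eq0 (real_complex R)) gt_eqF.
have kt : (inv_ktau * (tau * k))%:C = 1 :> C.
  by rewrite /inv_ktau mulrC [k * _]mulrC mulfV// gt_eqF// mulr_gt0.
rewrite /Lop hP hd /resf -/w /Fh /Ft -/(pth h w).
have ti : tau%:C * (tau^-1)%:C = 1 :> C by rewrite -rmorphM mulfV// gt_eqF.
have G1 : (inv_ktau%:C * ((tau%:C * lam + 1) + (tau * k)%:C * ii * (w.1.1)%:C)) * Gc z_re z_im w.1.1 = 1.
  apply: etrans hG; transitivity (inv_ktau%:C * (tau%:C * lam + 1) * Gc z_re z_im w.1.1
     + (inv_ktau * (tau * k))%:C * (ii * (w.1.1)%:C * Gc z_re z_im w.1.1)); first by ring.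
  by rewrite kt mul1r.
have key : tau%:C * (- ii * (k * w.1.1)%:C * f v - (tau^-1)%:C * (f v - pth h w) - lam * f v)
   = pth h w - ((tau%:C * lam + 1) + (tau * k)%:C * ii * (w.1.1)%:C) * f v.
  transitivity ((tau%:C * (tau^-1)%:C) * (pth h w - f v)
    - (tau * k)%:C * ii * (w.1.1)%:C * f v - tau%:C * lam * f v); first by ring.
  by rewrite ti; ring.
split=> [e|e].
  have {}e : pth h w = ((tau%:C * lam + 1) + (tau * k)%:C * ii * (w.1.1)%:C) * f v.
    by apply/eqP; rewrite -subr_eq0 -key e subrr mulr0.
  apply: (etrans (esym (mul1r _))); rewrite -[X in X * _]G1 e; ring.
have e2 : pth h w = ((tau%:C * lam + 1) + (tau * k)%:C * ii * (w.1.1)%:C) * f v.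
  by rewrite e; apply: (etrans (esym (mul1r _))); rewrite -[X in X * _]G1; ring.
apply/eqP; rewrite -subr_eq0 -(mulrI_eq0 _ (mulfI t0)) key e2 subrr.
exact: eqxx.
Qed.

Lemma eigen_res f : eigenspace_of tau kv lam f ->
  exists h, [/\ selfcons h, moments f = Qtilde Q *m h & aeq f (resf h)].
Proof.
move=> [[f2 _] hf]; pose h := (Qtilde Q)^T *m moments f.
have hm : moments f = Qtilde Q *m h.
  by rewrite /h mulmxA (mulmx1C (Qtilde_orth hQ)) mul1mx.
have hae : aeq f (resf h) by apply: filterS hf => v /(resf_pde hm v).
exists h; split=> //; apply/selfconsE.
have mres : cmeas (resf h).
  have := cgint3_meas (resf_ebasisr h 0).1; congr cmeas; apply/funext => v.
  by rewrite /ebasisr mulr1.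
have := moments_ae (inL2_cmeas f2) mres hae; rewrite moments_resf hm => e.
by rewrite -[LHS]mul1mx -[RHS]mul1mx -(Qtilde_orth hQ) -!mulmxA e.
Qed.

Lemma res_pde h : selfcons h -> moments (resf h) = Qtilde Q *m h /\
  forall v, Lop tau kv (resf h) v = lam * resf h v.
Proof.
move=> /selfconsE hM; have hm : moments (resf h) = Qtilde Q *m h by rewrite moments_resf hM.
by split=> // v; apply/(resf_pde hm v).
Qed.

End Eigen.

(** * Linearity and boundedness of the moments on the Hilbert space *)

Section L2.
Variable R : realType.
Local Notation C := R[i].
Implicit Types (f g : R3 R -> C).

Lemma gint3_dominated (F G : R3 R -> R) : measurable_fun setT F ->
  (forall v, `|F v| <= G v) -> gint3 G -> gint3 F.
Proof.
move=> mF h; apply: le_integrable => //.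
  apply/measurable_EFinP; apply: measurable_funM => //; exact: measurable_maxwellian.
move=> v _; rewrite /= !normrM lee_fin; apply: ler_pM => //.
exact: le_trans (h v) (ler_norm _).
Qed.

Definition sqn f v : R := Re (f v) ^+ 2 + Im (f v) ^+ 2.

Lemma sqn_ge0 f v : 0 <= sqn f v.
Proof. by rewrite addr_ge0// sqr_ge0. Qed.

Lemma inL2E f : inL2 f <-> cmeas f /\ gint3 (sqn f).
Proof. by split=> [[a b c]|[[a b] c]]. Qed.

Lemma measurable_sqn f : cmeas f -> measurable_fun setT (sqn f).
Proof. by move=> [a b]; apply: measurable_funD; exact: measurable_funX. Qed.

Lemma cmeasD f g : cmeas f -> cmeas g -> cmeas (fun v => f v + g v).
Proof.
move=> [rf jf] [rg jg]; split.
  by under eq_fun do rewrite complex_ReD; exact: measurable_funD.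
by under eq_fun do rewrite complex_ImD; exact: measurable_funD.
Qed.

Lemma cmeasM f g : cmeas f -> cmeas g -> cmeas (fun v => f v * g v).
Proof.
move=> [rf jf] [rg jg]; split.
  under eq_fun do rewrite complex_ReM.
  by apply: measurable_funB; exact: measurable_funM.
under eq_fun do rewrite complex_ImM.
by apply: measurable_funD; exact: measurable_funM.
Qed.

Lemma cmeas_cst (c : C) : cmeas (fun=> c).
Proof. by split; exact: measurable_cst. Qed.

Lemma cmeas_real (F : R3 R -> R) : measurable_fun setT F -> cmeas (fun v => (F v)%:C).
Proof. by move=> mF; split => //; exact: measurable_cst. Qed.

Lemma cmeasZ (c : C) f : cmeas f -> cmeas (fun v => c * f v).
Proof. by move=> mf; apply: cmeasM => //; exact: cmeas_cst. Qed.

Lemma inL2Z (c : C) f : inL2 f -> inL2 (fun v => c * f v).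
Proof.
move=> /inL2E[mf gf]; apply/inL2E; split; first exact: cmeasZ.
have := gint3Z (Re c ^+ 2 + Im c ^+ 2) gf; congr gint3; apply/funext => v.
by rewrite /sqn complex_ReM complex_ImM; ring.
Qed.

Lemma inL2D f g : inL2 f -> inL2 g -> inL2 (fun v => f v + g v).
Proof.
move=> /inL2E[mf gf] /inL2E[mg gg]; apply/inL2E; split; first exact: cmeasD.
have h := gint3Z 2 (gint3D gf gg); apply: gint3_dominated h.
  by apply: measurable_sqn; exact: cmeasD.
move=> v; rewrite ger0_norm ?sqn_ge0// /sqn complex_ReD complex_ImD.
have := sqr_ge0 (Re (f v) - Re (g v)); have := sqr_ge0 (Im (f v) - Im (g v)).
by nra.
Qed.

Lemma inL2_0 : inL2 (fun=> 0 : C).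
Proof.
apply/inL2E; split; first exact: cmeas_cst.
have := (@cgint30 R).1; congr gint3; apply/funext => v.
by rewrite /sqn /=; ring.
Qed.

Lemma inL2_lincomb n (c : 'I_n -> C) b : (forall i, inL2 (b i)) -> inL2 (lincomb c b).
Proof.
move=> h; rewrite /lincomb; elim: (index_enum _) => [|i l IH].
  by under eq_fun do rewrite big_nil; exact: inL2_0.
by under eq_fun do rewrite big_cons; apply: inL2D => //; exact: inL2Z.
Qed.

Lemma gint3_ae (F G : R3 R -> R) : measurable_fun setT F -> measurable_fun setT G ->
  {ae leb3 R, forall v, F v = G v} -> gint3 G -> gint3 F.
Proof.
move=> mF mG h /integrableP[m1 i1]; apply/integrableP; split.
  apply/measurable_EFinP; apply: measurable_funM => //; exact: measurable_maxwellian.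
apply: le_lt_trans i1; rewrite le_eqVlt; apply/orP; left; apply/eqP.
apply: ae_eq_integral => //.
- apply: measurableT_comp => //.
  apply/measurable_EFinP; apply: measurable_funM => //; exact: measurable_maxwellian.
- exact: measurableT_comp.
- by apply: filterS h => v -> _.
Qed.

Lemma inL2_ae f g : cmeas f -> aeq f g -> inL2 g -> inL2 f.
Proof.
move=> mf h /inL2E[mg gg]; apply/inL2E; split=> //.
apply: gint3_ae gg; [exact: measurable_sqn | exact: measurable_sqn |].
by apply: filterS h => v e; rewrite /sqn e.
Qed.

Lemma gint3_ebasisr_sq (j : 'I_5) : gint3 (fun v : R3 R => ebasisr j v ^+ 2).
Proof.
pose r := ((Num.sqrt 6)^-1)%:C : C.
have H f l := @CE3_expand R (fun=> 1) 4 l f (@cgint1_one R).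
suff [] : cgint3 (fun v : R3 R => (ebasisr j v ^+ 2)%:C) by [].
elim/ord5_ind: j; rewrite /ebasisr /=.
- have [] := H (fun v => (1 ^+ 2)%:C) [:: (1, (0, 0, 0)%N)] isT => //.
  by move=> v; rewrite !big_cons big_nil /mono3 /=; ring.
- have [] := H (fun v => (v.1.1 ^+ 2)%:C) [:: (1, (2, 0, 0)%N)] isT => //.
  by move=> v; rewrite !big_cons big_nil /mono3 /=; ring.
- have [] := H (fun v => (v.1.2 ^+ 2)%:C) [:: (1, (0, 2, 0)%N)] isT => //.
  by move=> v; rewrite !big_cons big_nil /mono3 /=; ring.
- have [] := H (fun v => (v.2 ^+ 2)%:C) [:: (1, (0, 0, 2)%N)] isT => //.
  by move=> v; rewrite !big_cons big_nil /mono3 /=; ring.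
have [] := H (fun v => (((sqnorm3 v - 3) / Num.sqrt 6) ^+ 2)%:C)
  [:: (r * r, (4, 0, 0)%N); (r * r, (0, 4, 0)%N); (r * r, (0, 0, 4)%N);
      (2 * r * r, (2, 2, 0)%N); (2 * r * r, (2, 0, 2)%N); (2 * r * r, (0, 2, 2)%N);
      (- 6 * r * r, (2, 0, 0)%N); (- 6 * r * r, (0, 2, 0)%N); (- 6 * r * r, (0, 0, 2)%N);
      (9 * r * r, (0, 0, 0)%N)] isT => //.
by move=> v; rewrite !big_cons big_nil /mono3 /r /sqnorm3 /=; ring.
Qed.

Lemma gint3M_ebasisr (F G : R3 R -> R) j : measurable_fun setT F -> gint3 G ->
  (forall v, F v ^+ 2 <= G v) -> gint3 (fun v => F v * ebasisr j v).
Proof.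
move=> mF gG h; apply: gint3_dominated (gint3D gG (gint3_ebasisr_sq j)).
  by apply: measurable_funM => //; exact: measurable_ebasisr.
move=> v; rewrite ler_norml; have := h v.
have := sqr_ge0 (F v - ebasisr j v); have := sqr_ge0 (F v + ebasisr j v).
have := sqr_ge0 (F v); have := sqr_ge0 (ebasisr j v).
by rewrite !sqrrB !sqrrD => *; apply/andP; split; lra.
Qed.

Lemma inL2_ebasisr f j : inL2 f -> cgint3 (fun v => f v * (ebasisr j v)%:C).
Proof.
move=> /inL2E[[mr mi] gf]; split.
  under eq_fun do rewrite complex_ReM /= mulr0 subr0.
  by apply: gint3M_ebasisr gf _ => // v; rewrite /sqn lerDl sqr_ge0.
under eq_fun do rewrite complex_ImM /= mulr0 add0r.
by apply: gint3M_ebasisr gf _ => // v; rewrite /sqn lerDr sqr_ge0.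
Qed.

Lemma momentsD f g : inL2 f -> inL2 g ->
  moments (fun v => f v + g v) = moments f + moments g.
Proof.
move=> hf hg; apply/matrixP => j l; rewrite !mxE !innerE -CE3D; try exact: inL2_ebasisr.
by apply: CE3_ext => v; rewrite mulrDl.
Qed.

Lemma momentsZ (c : C) f : inL2 f -> moments (fun v => c * f v) = c *: moments f.
Proof.
move=> hf; apply/matrixP => j l; rewrite !mxE !innerE -CE3Z; try exact: inL2_ebasisr.
by apply: CE3_ext => v; rewrite mulrA.
Qed.

Lemma moments0 : moments (fun=> 0 : C) = 0.
Proof. by have := momentsZ 0 inL2_0; rewrite scale0r mul0r. Qed.

Lemma moments_lincomb n (c : 'I_n -> C) b : (forall i, inL2 (b i)) ->
  moments (lincomb c b) = \sum_i c i *: moments (b i).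
Proof.
move=> h; rewrite /lincomb.
suff [] : inL2 (fun v => \sum_(i <- index_enum _) c i * b i v) /\
   moments (fun v => \sum_(i <- index_enum _) c i * b i v) =
   \sum_(i <- index_enum _) c i *: moments (b i) by [].
elim: (index_enum _) => [|i l [IH1 IH2]].
  rewrite big_nil; under eq_fun do rewrite big_nil.
  by split; [exact: inL2_0 | exact: moments0].
under eq_fun do rewrite big_cons; split; first by apply: inL2D => //; exact: inL2Z.
by rewrite big_cons momentsD//; [rewrite momentsZ// IH2 | exact: inL2Z].
Qed.

Lemma P5E f v : P5 f v = \sum_(j < 5) moments f j 0 * (ebasisr j v)%:C.
Proof. by apply: eq_bigr => j _; rewrite mxE. Qed.

(** The hypotheses separate the two ways in which [Lop] sees [f], by its value at [v] and by its
    moments. Almost-everywhere equality provides the first at almost every [v] and the second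
    outright. *)
Lemma Lop_lincomb tau kv n (c : 'I_n -> C) b f v : (forall i, inL2 (b i)) ->
  moments f = moments (lincomb c b) -> f v = lincomb c b v ->
  Lop tau kv f v = \sum_i c i * Lop tau kv (b i) v.
Proof.
move=> h hm hv; rewrite /Lop P5E hm moments_lincomb// hv /lincomb.
have -> : \sum_j (\sum_i c i *: moments (b i)) j 0 * (ebasisr j v)%:C = \sum_i c i * P5 (b i) v.
  under eq_bigr => j _ do rewrite summxE big_distrl /=.
  rewrite exchange_big /=; apply: eq_bigr => i _; rewrite P5E big_distrr /=.
  by apply: eq_bigr => j _; rewrite !mxE mulrA.
rewrite -sumrB big_distrr big_distrr /= -sumrB; apply: eq_bigr => i _; ring.
Qed.

Lemma cmeas_Lop tau kv f : cmeas f -> cmeas (Lop tau kv f).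
Proof.
move=> mf; have mP : cmeas (P5 f).
  have -> : P5 f = (fun v => \sum_(j < 5) moments f j 0 * (ebasisr j v)%:C).
    by apply/funext => v; exact: P5E.
  under eq_fun do rewrite big_ord5.
  do !apply: cmeasD; apply: cmeasZ; apply: cmeas_real; exact: measurable_ebasisr.
have md : cmeas (fun v : R3 R => (dot3 v kv)%:C).
  have m1 : measurable_fun setT (fun v : R3 R => v.1.1) by exact: measurableT_comp.
  have m2 : measurable_fun setT (fun v : R3 R => v.1.2) by exact: measurableT_comp.
  have m3 : measurable_fun setT (fun v : R3 R => v.2) by exact: measurable_snd.
  apply: cmeas_real; rewrite /dot3.
  by apply: measurable_funD; [apply: measurable_funD|];
    apply: measurable_funM => //; exact: measurable_cst.
have -> : Lop tau kv f = (fun v => (- 'i%C * (dot3 v kv)%:C) * f v +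
    (- (tau^-1)%:C) * (f v + (-1) * P5 f v)).
  by apply/funext => v; rewrite /Lop; ring.
apply: cmeasD; first by apply: cmeasM => //; exact: cmeasZ.
by apply: cmeasZ; apply: cmeasD => //; exact: cmeasZ.
Qed.

Lemma E3_le (F G : R3 R -> R) : gint3 F -> gint3 G -> (forall v, F v <= G v) -> E3 F <= E3 G.
Proof.
move=> iF iG h; apply: le_Rintegral => // v _.
by rewrite ler_pM2r ?maxwellian_gt0.
Qed.

Lemma normvE f : normv f ^+ 2 = E3 (sqn f).
Proof.
have e : Re (inner f f) = E3 (sqn f).
  rewrite /inner /cintegral /E3 /=; congr Rintegral; apply/funext => v.
  by rewrite /sqn; case: (f v) => a b /=; ring.
rewrite /normv e sqr_sqrtr//; apply: Rintegral_ge0 => v _.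
by apply: mulr_ge0; [exact: sqn_ge0 | exact/ltW/maxwellian_gt0].
Qed.

Definition ebasisr_bound j : R := 1 + E3 (fun v : R3 R => ebasisr j v ^+ 2).

(** Young's inequality 2 |f e| <= |f|^2 / N + N e^2 replaces Cauchy-Schwarz. It bounds the real and
    the imaginary part by half of the right side each; the summand 1 in [ebasisr_bound] comes from
    the term |f|^2 / N. *)
Lemma moments_bound f j N : inL2 f -> 0 < N -> normv f <= N ->
  ComplexField.Normc.normc (moments f j 0) <= N * ebasisr_bound j.
Proof.
move=> f2 N0 hN; have /inL2E[[mr mi] gf] := f2.
have hA : E3 (sqn f) <= N ^+ 2.
  by rewrite -normvE ler_sqr ?nnegrE ?(ltW N0)// /normv sqrtr_ge0.
have [ir ij] := inL2_ebasisr j f2.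
have D (F : R3 R -> R) : gint3 F -> (forall v, `|F v| * 2 <= N^-1 * sqn f v + N * ebasisr j v ^+ 2) ->
    `|E3 F| * 2 <= N * ebasisr_bound j.
  move=> iF hF; have g1 := gint3Z N^-1 gf; have g2 := gint3Z N (gint3_ebasisr_sq j).
  have g12 := gint3D g1 g2.
  have e12 : E3 (fun v => N^-1 * sqn f v + N * ebasisr j v ^+ 2) <= N * ebasisr_bound j.
    rewrite E3D// E3Z// E3Z; last exact: gint3_ebasisr_sq.
    rewrite /ebasisr_bound mulrDr mulr1 lerD2r.
    by rewrite mulrC ler_pdivrMr// -expr2.
  have a : 2 * E3 F <= E3 (fun v => N^-1 * sqn f v + N * ebasisr j v ^+ 2).
    rewrite -E3Z//; apply: E3_le => //; first exact: gint3Z.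
    by move=> v; have := hF v; have := ler_norm (F v); lra.
  have b : -2 * E3 F <= E3 (fun v => N^-1 * sqn f v + N * ebasisr j v ^+ 2).
    rewrite -E3Z//; apply: E3_le => //; first exact: gint3Z.
    by move=> v; have := hF v; have := ler_norm (- F v); rewrite normrN; lra.
  by case: (ler0P (E3 F)) => _; lra.
have P (a b e : R) : `|a * e| * 2 <= N^-1 * (a ^+ 2 + b ^+ 2) + N * e ^+ 2.
  rewrite -(ler_pM2l N0).
  have -> : N * (N^-1 * (a ^+ 2 + b ^+ 2) + N * e ^+ 2) = a ^+ 2 + b ^+ 2 + (N * e) ^+ 2.
    by field; rewrite gt_eqF.
  have := sqr_ge0 (a - N * e); have := sqr_ge0 (a + N * e); have := sqr_ge0 b.
  by case: (ler0P (a * e)) => _; nra.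
have hr := D _ ir _; have hi := D _ ij _.
rewrite mxE innerE.
have Er v : `|Re (f v * (ebasisr j v)%:C)| * 2 <= N^-1 * sqn f v + N * ebasisr j v ^+ 2.
  by rewrite complex_ReM /= mulr0 subr0; exact: P.
have Ei v : `|Im (f v * (ebasisr j v)%:C)| * 2 <= N^-1 * sqn f v + N * ebasisr j v ^+ 2.
  by rewrite complex_ImM /= mulr0 add0r /sqn [Re _ ^+ 2 + _]addrC; exact: P.
move: (hr Er) (hi Ei); rewrite /CE3 /=.
set a := E3 _; set b := E3 _; set M := N * _ => ha hb.
apply: (@le_trans _ _ (`|a| + `|b|)); last by lra.
rewrite -(@ger0_norm _ (`|a| + `|b|)) ?addr_ge0// -sqrtr_sqr ler_sqrt ?sqr_ge0//.
rewrite -(real_normK (num_real a)) -(real_normK (num_real b)).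
by have := normr_ge0 a; have := normr_ge0 b; nra.
Qed.

End L2.

(** * Evolution of the moments along the hydrodynamic manifold *)

Section Evolution.
Variables (R : realType) (tau : R) (kv : 'cV[R]_3) (ldiff : R) (lac : R[i]) (lshear : R).
Local Notation C := R[i].
Variable M : 'M[C]_5.
Hypothesis hM : forall lam g, lam \in hydro_eigenvalues ldiff lac lshear ->
  eigenfunction tau kv lam g -> lam *: moments g = M *m moments g.

Lemma manifold_Lop f : hydro_manifold tau kv ldiff lac lshear f ->
  inL2 (Lop tau kv f) /\ moments (Lop tau kv f) = M *m moments f.
Proof.
move=> [f2 [n [c [g [hg hf]]]]].
have [lam hlam] : exists lam : 'I_n -> C, forall i,
    lam i \in hydro_eigenvalues ldiff lac lshear /\ eigenfunction tau kv (lam i) (g i).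
  suff /boolp.choice[lam hl] : forall i, exists l, l \in hydro_eigenvalues ldiff lac lshear /\ eigenfunction tau kv l (g i) by exists lam.
  by move=> i; have [l h1 h2] := hg i; exists l.
have g2 i : inL2 (g i) by case: (hlam i) => _ [[[]]].
have mf : moments f = moments (lincomb c g).
  by apply: moments_ae hf; apply: inL2_cmeas => //; exact: inL2_lincomb.
pose G := lincomb (fun i => c i * lam i) g.
have G2 : inL2 G by exact: inL2_lincomb.
have mL : cmeas (Lop tau kv f) by apply: cmeas_Lop; exact: inL2_cmeas.
have hL : aeq (Lop tau kv f) G.
  (* Finitely many exceptional null sets are merged into one. *)
  have hall : {ae leb3 R, forall v, forall i, Lop tau kv (g i) v = lam i * g i v}.
    by apply: filter_forall => i; case: (hlam i) => _ [[_ ?] _].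
  apply: filterS2 hf hall => v e1 e2.
  rewrite (Lop_lincomb tau kv g2 mf e1); apply: eq_bigr => i _.
  by rewrite e2 mulrA.
split; first exact: inL2_ae mL hL G2.
rewrite (moments_ae mL (inL2_cmeas G2) hL) mf /G !moments_lincomb// mulmx_sumr.
apply: eq_bigr => i _; case: (hlam i) => hl he.
by rewrite -scalemxAr -(hM hl he) scalerA.
Qed.

Lemma ebasisr_bound_gt0 (j : 'I_5) : 0 < ebasisr_bound R j.
Proof.
rewrite /ebasisr_bound ltr_pwDl// /E3; apply: Rintegral_ge0 => v _.
by apply: mulr_ge0; [exact: sqr_ge0 | exact/ltW/maxwellian_gt0].
Qed.

Lemma hydro_solution_moments (I : interval R) (fhat : R -> R3 R -> C) t :
  hydro_solution tau kv ldiff lac lshear I fhat -> t \in I ->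
  is_deriv_C I (fun t => moments (fhat t)) t (M *m moments (fhat t)).
Proof.
move=> hs tI j; have [ht hd] := hs t tI; have [L2 eL] := manifold_Lop ht.
have f2 s : s \in I -> inL2 (fhat s) by move=> sI; have [[]] := hs s sI.
apply/cvgr0Pnorm_lt => eps eps0.
(* This [N] makes [moments_bound] yield eps / 2; the half turns its weak inequality into a strict
   one. *)
have b0 := ebasisr_bound_gt0 j; pose N := eps / 2 / ebasisr_bound R j.
have N0 : 0 < N by rewrite !divr_gt0.
have := hd; rewrite /is_deriv_Hv => /cvgr0Pnorm_lt /(_ N N0).
rewrite !near_withinE; apply: filterS => s hN st sI.
have sI' : s \in I by exact: sI.
have {}hN := hN st sI.
set F := (fun v => _) in hN.
have F2 : inL2 F.
  have -> : F = (fun v => ((s - t)^-1)%:C * (fhat s v + (-1) * fhat t v) + (-1) * Lop tau kv (fhat t) v).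
    by apply/funext => v; rewrite /F !mulN1r.
  apply: inL2D; last exact: inL2Z.
  by apply: inL2Z; apply: inL2D; [exact: f2|apply: inL2Z; exact: f2].
have FE : moments F = ((s - t)^-1)%:C *: (moments (fhat s) - moments (fhat t)) - M *m moments (fhat t).
  have -> : F = (fun v => ((s - t)^-1)%:C * (fhat s v + (-1) * fhat t v) + (-1) * Lop tau kv (fhat t) v).
    by apply/funext => v; rewrite /F !mulN1r.
  have i1 : inL2 (fun v => (-1) * fhat t v) by apply: inL2Z; exact: f2.
  have i2 : inL2 (fun v => fhat s v + (-1) * fhat t v) by apply: inL2D => //; exact: f2.
  rewrite momentsD; [|exact: inL2Z..].
  rewrite momentsZ// momentsZ// momentsD//; last exact: f2.
  by rewrite momentsZ ?eL ?scaleN1r//; exact: f2.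
have -> : ((s - t)^-1)%:C * (moments (fhat s) j 0 - moments (fhat t) j 0) - (M *m moments (fhat t)) j 0
   = moments F j 0 by rewrite FE !mxE.
have hN' : normv F <= N by apply: ltW; apply: le_lt_trans hN; exact: ler_norm.
have := moments_bound j F2 N0 hN'.
have -> : N * ebasisr_bound R j = eps / 2 by rewrite /N divfK// gt_eqF.
rewrite ger0_norm; last by case: (moments F j 0) => a b; exact: sqrtr_ge0.
by lra.
Qed.

End Evolution.

(** * The plasma dispersion function and a closed form of theta *)

Section DispersionFunction.
Variables (R : realType) (u s : R).
Local Notation C := R[i].
Local Notation ii := ('i%C : C).
Hypothesis u0 : 0 < u.

Lemma J2c_neq0 : J2c u s != 0.
Proof.
have H t : 0 <= t -> J2c u t != 0.
  move=> t0; apply/eqP => /eqP; rewrite eq_complex /= => /andP[/eqP a /eqP b].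
  by have := J2_neq0_ge0 u0 t0; rewrite a b expr0n /= addr0 eqxx.
have [s0|s0] := leP 0 s; first exact: H.
have [a b] := mr_mi_opp (- s) u0; rewrite opprK in a b.
have := H (- s); rewrite oppr_ge0 (ltW s0) => /(_ isT).
apply: contraNneq => /eqP; rewrite !eq_complex /= => /andP[/eqP c /eqP d].
move: c d; rewrite /p2 /q2 /p1 /q1 a b => c d.
by apply/andP; split; apply/eqP; lra.
Qed.

Lemma plasmaZE : plasmaZ (ii * zc u s) = ii * mc u s.
Proof.
have pos : 0 < Num.sqrt (2 * pi) :> R by rewrite sqrtr_gt0 mulr_gt0 ?pi_gt0.
have Gi v : (v%:C - ii * zc u s)^-1 = ii * Gc u s v.
  have h := GcE s u0 v.
  have e : (v%:C - ii * zc u s) * (ii * Gc u s v) = 1.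
    transitivity (- (ii * ii) * (zc u s * Gc u s v) + ii * v%:C * Gc u s v); first by ring.
    by rewrite ii2 opprK mul1r.
  have nz : v%:C - ii * zc u s != 0.
    by apply/eqP => z0; move: e; rewrite z0 mul0r => /eqP; rewrite eq_sym oner_eq0.
  by rewrite -[RHS](mulKf nz) e mulr1.
have red (F : R -> R) : gint F ->
    (Num.sqrt (2 * pi))^-1 * \int[@lebesgue_measure R]_x (expR (- (x ^+ 2 / 2)) * F x) = E1 F.
  move=> iF.
  have -> : (fun x : measurableTypeR R => expR (- (x ^+ 2 / 2)) * F x) =
     (fun x => Num.sqrt (2 * pi) * (F x * phi x)).
    by apply/funext => x; rewrite /phi; field; rewrite gt_eqF.
  by rewrite RintegralZl// mulrA mulVf ?gt_eqF// mul1r.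
have ga1 := tame_gint (tame_ga s u0); have gb1 := tame_gint (tame_gb s u0).
rewrite /plasmaZ /cintegral; apply: complex_ext.
  rewrite complex_ReM [Re (_)%:C]/= [Im (_)%:C]/= mul0r subr0.
  rewrite complex_ReM [Re ii]/= [Im ii]/= mul0r mul1r sub0r [Im (mc _ _)]/=.
  rewrite [Re (_ +i* _)]/=.
  have -> : (fun v : measurableTypeR R => Re ((expR (- (v ^+ 2 / 2)))%:C / (v%:C - ii * zc u s)))
     = (fun v => expR (- (v ^+ 2 / 2)) * ((-1) * gb u s v)).
    by apply/funext => v; rewrite Gi /=; ring.
  by rewrite red; [rewrite E1Z// mulN1r | exact: gintZ].
rewrite complex_ImM [Re (_)%:C]/= [Im (_)%:C]/= mul0r addr0.
rewrite complex_ImM [Re ii]/= [Im ii]/= mul0r mul1r add0r [Re (mc _ _)]/=.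
rewrite [Im (_ +i* _)]/=.
have -> : (fun v : measurableTypeR R => Im ((expR (- (v ^+ 2 / 2)))%:C / (v%:C - ii * zc u s)))
   = (fun v => expR (- (v ^+ 2 / 2)) * ga u s v).
  by apply/funext => v; rewrite Gi /=; ring.
by rewrite red.
Qed.

(** With x = k tau, numerator and denominator of [theta] share the factor i x^2; once it is
    cancelled, the denominator is J2, nonzero by [J2c_neq0]. *)
Lemma theta_formula (tau k : R) (lam : C) : 0 < tau -> 0 < k ->
  zc u s = ((k * tau)^-1)%:C * (tau%:C * lam + 1) ->
  theta tau k lam = (Num.sqrt 6)%:C *
   (mc u s + (zc u s - ((k * tau)^-1)%:C) * I1c u s - (k * tau)%:C) / J2c u s.
Proof.
move=> tau0 k0 hz; have J0 := J2c_neq0.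
have x0 : k * tau != 0 by rewrite gt_eqF// mulr_gt0.
pose x : C := (k * tau)%:C.
have xK : ((k * tau)^-1)%:C = x^-1 by rewrite /x -fmorphV.
have x0' : x != 0 by rewrite /x (fmorph_eq0 (real_complex R)).
have hl : tau%:C * lam + 1 = x * zc u s by rewrite hz xK mulrA mulfV// mul1r.
have hl' : tau%:C * lam = x * zc u s - 1 by rewrite -hl addrK.
have xE : k%:C * tau%:C = x by rewrite /x rmorphM.
have iu : ii != 0 by apply/eqP => /(congr1 (@complex.Im R)) /= /eqP; rewrite oner_eq0.
rewrite /theta hl hl'.
have -> : k%:C ^+ 2 * tau%:C ^+ 2 = x ^+ 2 by rewrite -xE; ring.
have -> : ii * k%:C * tau%:C = ii * x by rewrite -xE; ring.
rewrite xE.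
have -> : ii * (x * zc u s) / x = ii * zc u s.
  by rewrite mulrCA -mulrA mulrC mulfVK.
rewrite plasmaZE xK.
have -> : (x ^+ 2 + (x * zc u s) ^+ 2) * (ii * mc u s) - ii * x * (x * zc u s) =
  ii * x ^+ 2 * J2c u s by rewrite J2cE I1cE; ring.
have -> : (x ^+ 2 - (x * zc u s - 1) * (x * zc u s)) * (ii * mc u s) -
    ii * x * (x ^+ 2 - (x * zc u s - 1)) =
   ii * x ^+ 2 * (mc u s + (zc u s - x^-1) * I1c u s - x).
  transitivity (ii * (x ^+ 2 * (mc u s + zc u s * I1c u s - x) - x * (x * x^-1) * I1c u s)).
    by rewrite mulfV// I1cE; ring.
  by ring.
have a0 : ii * x ^+ 2 != 0 by rewrite mulf_neq0// expf_neq0.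
by rewrite mulrCA -mulf_div mulfV// mul1r.
Qed.

Lemma consistent_transverse (kap : R) (a b : C) : kap%:C * mc u s = 1 ->
  consistent u s kap 0 0 a b 0.
Proof.
move=> h; have e0 : CE3 (Ft u s kap 0 0 a b 0) = 0.
  by rewrite (CE3_Ft _ u0 _ _ _ _ _ _).2; ring.
split => //.
- by rewrite (CE3_Ft_v1 _ u0 _ _ _ _ _ _).2 e0; ring.
- by rewrite (CE3_Ft_v2 _ u0 _ _ _ _ _ _).2 h mul1r.
- by rewrite (CE3_Ft_v3 _ u0 _ _ _ _ _ _).2 h mul1r.
- rewrite (CE3_Ft_e4 _ u0 _ _ _ _ _ _).2 (CE3_Ft_v1sq _ u0 _ _ _ _ _ _).2.
  by rewrite (CE3_Ft_v1 _ u0 _ _ _ _ _ _).2 e0; ring.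
Qed.

End DispersionFunction.

Lemma rank1_not_dim2 (R : realType) (V : (R3 R -> R[i]) -> Prop) (r : R3 R -> R[i]) :
  (forall f, V f -> exists a, aeq f (fun v => a * r v)) -> ~ has_dim V 2.
Proof.
move=> hV [b [bV bfree _]]; have H i := hV _ (bV i).
have [a0 h0] := H 0; have [a1 h1] := H 1.
pose c (i : 'I_2) : R[i] := if i == 0 then a1 else - a0.
have /bfree hc : aeq (lincomb c b) (fun=> 0).
  apply: filterS2 h0 h1 => v e0 e1; rewrite /lincomb !big_ord_recl big_ord0 /c /=.
  have -> : lift ord0 ord0 = 1 :> 'I_2 by exact/val_inj.
  have -> : ord0 = 0 :> 'I_2 by exact/val_inj.
  by rewrite e0 e1; ring.
have a1z : a1 = 0 := hc 0.
pose c' (i : 'I_2) : R[i] := if i == 0 then 0 else 1.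
have /bfree hc' : aeq (lincomb c' b) (fun=> 0).
  apply: filterS h1 => v e1; rewrite /lincomb !big_ord_recl big_ord0 /c' /=.
  have -> : lift ord0 ord0 = 1 :> 'I_2 by exact/val_inj.
  by rewrite e1 a1z; ring.
by have /eqP := hc' 1; rewrite /c' /= oner_eq0.
Qed.

(** * Moment vectors of the eigenfunctions *)

Section EigenfunctionMoments.
Variables (R : realType) (tau : R) (kv : 'cV[R]_3) (Q : 'M[R]_3) (lam : R[i]).
Local Notation C := R[i].
Local Notation ii := ('i%C : C).
Let k := enorm kv.
Hypothesis tau0 : 0 < tau.
Hypothesis k0 : 0 < k.
Hypothesis al : aligns Q kv.
Hypothesis hlam : - tau^-1 < Re lam.
Let hQ : orth3 Q. Proof. by case: al. Qed.
Let hQt := orth3_tr hQ.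
Let u := z_re tau kv lam.
Let s := z_im tau kv lam.
Let u0 : 0 < u := z_re_gt0 tau0 k0 hlam.
Let kap := (inv_ktau tau kv)%:C.
Let m := mc u s.
Let r6 : C := ((Num.sqrt 6)^-1)%:C.

Definition etac : C := lam / k%:C.
Definition long_col : 'cV[C]_5 := mx_of_rows 5 1
  [:: [:: 1]; [:: ii / k%:C * lam]; [:: 0]; [:: 0]; [:: theta tau k lam]].

Lemma kap_neq0 : kap != 0.
Proof. by rewrite /kap (fmorph_eq0 (real_complex R)) gt_eqF ?inv_ktau_gt0. Qed.

Lemma eta_zc : zc u s - kap = etac.
Proof.
have kn : k%:C != 0 :> C by rewrite (fmorph_eq0 (real_complex R)) gt_eqF.
have tn : tau%:C != 0 :> C by rewrite (fmorph_eq0 (real_complex R)) gt_eqF.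
rewrite zcE mulrDr mulr1 addrK /etac /inv_ktau -/k.
have -> : ((k * tau)^-1)%:C = (k%:C)^-1 * (tau%:C)^-1 :> C by rewrite fmorphV rmorphM invfM.
by rewrite -mulrA (mulKf tn) mulrC.
Qed.

Lemma thetaE : theta tau k lam = (Num.sqrt 6)%:C *
   (m + etac * I1c u s - (k * tau)%:C) / J2c u s.
Proof. by rewrite -eta_zc; apply: theta_formula => //; exact: zcE. Qed.

Lemma selfcons_form h : selfcons tau kv lam h ->
  [/\ h 1 0 = h 0 0 * long_col 1 0, h 4 0 = h 0 0 * long_col 4 0,
      kap * m * h 2 0 = h 2 0, kap * m * h 3 0 = h 3 0 &
      h 0 0 * (2 * (theta tau k lam * r6) * (3 - 2 * kap * m) + (1 + etac ^+ 2)) = 0].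
Proof.
move=> hc; have [h2 h3] := consistent_shear u0 hc.
have [h1 h4 hE] := consistent_long u0 hc.
rewrite -/kap -/m -/u -/s eta_zc in h1 h4 hE.
have J0 := J2c_neq0 s u0; have kn := kap_neq0.
have xk : kap * (k * tau)%:C = 1.
  by rewrite /kap /inv_ktau -rmorphM -/k mulVf// gt_eqF// mulr_gt0.
have r6n := r6_neq0 R; have r6s := r6_sq R; rewrite -/r6 in r6n r6s h4 hE.
have s6 : (Num.sqrt 6)%:C * r6 = 1 :> C by rewrite /r6 -rmorphM mulfV ?sqrt6_neq0.
have e4 : h 4 0 = h 0 0 * theta tau k lam.
  apply: (mulIf r6n); apply: (mulIf J0); apply: (mulIf kn).
  rewrite h4 thetaE.
  transitivity (h 0 0 * ((Num.sqrt 6)%:C * r6) * (kap * (m + etac * I1c u s) - kap * (k * tau)%:C)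
     * ((J2c u s)^-1 * J2c u s)); last by ring.
  by rewrite mulVf// s6 xk; ring.
split=> //.
- by rewrite h1 !mxE /= /etac; ring.
- by rewrite e4 !mxE.
- rewrite mulrDr.
  have -> : h 0 0 * (2 * (theta tau k lam * r6) * (3 - 2 * kap * m)) =
     2 * (h 4 0 * r6) * (3 - 2 * kap * m) by rewrite e4; ring.
  by rewrite hE; ring.
Qed.

Lemma FhZ a h v : Fh tau kv lam (a *: h) v = a * Fh tau kv lam h v.
Proof. by rewrite /Fh /Ft /pt !mxE; ring. Qed.

Lemma resf_ae0 f h : aeq f (resf tau kv Q lam h) -> h = 0 -> aeq f (fun=> 0).
Proof.
move=> hf h0; apply: filterS hf => v ->.
by rewrite h0 -(scale0r 0) /resf FhZ mul0r.
Qed.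

Lemma selfcons_long h : selfcons tau kv lam h -> kap * m != 1 -> h = h 0 0 *: long_col.
Proof.
move=> hc hk; have [h1 h4 h2 h3 _] := selfcons_form hc.
have Z x : kap * m * x = x -> x = 0.
  move=> /eqP; rewrite -subr_eq0 -{2}[x]mul1r -mulrBl mulf_eq0 subr_eq0 (negbTE hk) /=.
  by move/eqP.
apply/matrixP => i j; rewrite ord1 !mxE; elim/ord5_ind: i => /=.
- by rewrite mulr1.
- by rewrite h1 !mxE.
- by rewrite mulr0; exact: Z.
- by rewrite mulr0; exact: Z.
- by rewrite h4 !mxE.
Qed.

Lemma long_form f : kap * m != 1 -> eigenfunction tau kv lam f ->
  (exists a, moments f = a *: (Qtilde Q *m long_col)) /\
  2 * (theta tau k lam * r6) * (3 - 2 * kap * m) = - (1 + etac ^+ 2).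
Proof.
move=> hk [he fn]; have [h [hc hm hf]] := eigen_res tau0 k0 al hlam he.
have [_ _ _ _ hE] := selfcons_form hc; have hs3 := selfcons_long hc hk.
split; first by exists (h 0 0); rewrite hm {1}hs3 -scalemxAr.
apply/eqP; rewrite -addr_eq0; move/eqP: hE; rewrite mulf_eq0 => /orP[/eqP h0|//].
by case: fn; apply: resf_ae0 hf _; rewrite hs3 h0 scale0r.
Qed.

Definition shear_col (j : 'I_5) : 'cV[C]_5 := delta_mx j 0.

Lemma selfcons_shear_col j : (j == 2) || (j == 3) -> kap * m = 1 -> selfcons tau kv lam (shear_col j).
Proof.
by case/orP => /eqP -> hk; rewrite /selfcons /shear_col !mxE /=; exact: consistent_transverse.
Qed.

(** Needed to exhibit actual transverse eigenfunctions. In the aligned frame the squared modulus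
    factors into kap^2 |1 / (z + i v1)|^2 and the square of one transverse velocity. *)
Lemma inL2_shear_col j : (j == 2) || (j == 3) -> inL2 (resf tau kv Q lam (shear_col j)).
Proof.
move=> hj; apply/inL2E; split.
  have := cgint3_meas (resf_ebasisr tau0 k0 al hlam (shear_col j) 0).1; congr cmeas; apply/funext => v.
  by rewrite /ebasisr mulr1.
pose F := Fh tau kv lam (shear_col j).
suff gF : gint3 (sqn F) by exact: (gint3_rot hQt gF).
have tg : gint (fun w => ga u s w ^+ 2 + gb u s w ^+ 2).
  apply: tame_gint; apply: (@tame_bounded _ _ (u ^- 2)).
    have ca := @continuous_ga R u s u0; have cb := @continuous_gb R u s u0.
    move=> w; apply: cvgD; rewrite expr2.
      by apply: cvgM; exact: ca.
    by apply: cvgM; exact: cb.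
  move=> w; rewrite ger0_norm; first exact: sumsq_gab.
  by rewrite addr_ge0 ?sqr_ge0.
have g0 := @gint_exp R 0 isT; have g2 := @gint_exp R 2 isT.
have [a2 _] := gint3_prod tg g2 g0; have [a3 _] := gint3_prod tg g0 g2.
case/orP: hj => /eqP jE.
  have := gint3Z (inv_ktau tau kv ^+ 2) a2; congr gint3; apply/funext => v.
  by rewrite /F /Fh /sqn /Ft /pt jE /shear_col !mxE /=; ring.
have := gint3Z (inv_ktau tau kv ^+ 2) a3; congr gint3; apply/funext => v.
by rewrite /F /Fh /sqn /Ft /pt jE /shear_col !mxE /=; ring.
Qed.

Lemma eigenspace_shear_col j : (j == 2) || (j == 3) -> kap * m = 1 ->
  eigenspace_of tau kv lam (resf tau kv Q lam (shear_col j)).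
Proof.
move=> hj hk; have h2 := inL2_shear_col hj.
have [_ hp] := res_pde tau0 k0 al hlam (selfcons_shear_col hj hk).
split; last by apply: aeW => v; exact: hp.
by split; [exact: h2 | rewrite (funext hp); exact: inL2Z].
Qed.

Lemma shear_crit : geo_mult tau kv lam 2 -> kap * m = 1.
Proof.
move=> hg; apply/eqP/negPn/negP => hk.
apply: (@rank1_not_dim2 _ _ (resf tau kv Q lam long_col)) hg => f he.
have [h [hc _ hf]] := eigen_res tau0 k0 al hlam he.
exists (h 0 0); apply: filterS hf => v ->.
by rewrite {1}(selfcons_long hc hk) /resf FhZ.
Qed.

Lemma Qtilde_inj (a b : 'cV[C]_5) : Qtilde Q *m a = Qtilde Q *m b -> a = b.
Proof. by move=> e; rewrite -[a]mul1mx -[b]mul1mx -(Qtilde_orth hQ) -!mulmxA e. Qed.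

(* An eigenfunction with nonzero density would be independent of the two
   transverse ones. *)
Lemma shear_form f : geo_mult tau kv lam 2 -> eigenspace_of tau kv lam f ->
  exists a b, moments f = Qtilde Q *m (a *: shear_col 2 + b *: shear_col 3).
Proof.
move=> hg he; have hk := shear_crit hg.
have [h [hc hm hf]] := eigen_res tau0 k0 al hlam he.
have [h1 h4 _ _ _] := selfcons_form hc.
suff h0 : h 0 0 = 0.
  exists (h 2 0), (h 3 0); rewrite hm; congr (_ *m _).
  apply/matrixP => i j; rewrite ord1 !mxE; elim/ord5_ind: i => /=.
  - by rewrite h0; ring.
  - by rewrite h1 h0; ring.
  - by ring.
  - by ring.
  - by rewrite h4 h0; ring.
apply/eqP/negPn/negP => h0.
have [b [bV _ bspan]] := hg.
pose F (i : 'I_3) := nth f [:: f; resf tau kv Q lam (shear_col 2); resf tau kv Q lam (shear_col 3)] i.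
pose hs3 (i : 'I_3) := nth h [:: h; shear_col 2; shear_col 3] i.
have FV i : eigenspace_of tau kv lam (F i).
  case: i => [[|[|[|//]]] hi]; rewrite /F /=; [exact: he|exact: eigenspace_shear_col..].
have Fm i : moments (F i) = Qtilde Q *m hs3 i.
  case: i => [[|[|[|//]]] hi]; rewrite /F /hs3 /=; first exact: hm.
    by have [] := res_pde tau0 k0 al hlam (@selfcons_shear_col 2 isT hk).
  by have [] := res_pde tau0 k0 al hlam (@selfcons_shear_col 3 isT hk).
have b2 i : inL2 (b i) by case: (bV i) => -[].
have /boolp.choice[c hcs] : forall i, exists c, moments (F i) = \sum_j c j *: moments (b j).
  move=> i; have [c hcc] := bspan _ (FV i); exists c; rewrite -moments_lincomb//.
  apply: moments_ae hcc; apply: inL2_cmeas; last exact: inL2_lincomb.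
  by case: (FV i) => -[].
(* Three eigenfunctions expanded in a basis of two: a left kernel vector of [M] is a relation
   between the moment vectors [h], [shear_col 2] and [shear_col 3], which are independent when h 0 0
   is nonzero. *)
pose M : 'M[C]_(3, 2) := \matrix_(i, j) c i j.
have : kermx M != 0.
  rewrite -mxrank_eq0 mxrank_ker subn_eq0 -ltnNge.
  exact: leq_ltn_trans (rank_leq_col _) _.
case/rowV0Pn => v /sub_kermxP vM v0.
have hz : \sum_i v 0 i *: hs3 i = 0.
  apply: Qtilde_inj; rewrite mulmx0 mulmx_sumr.
  under eq_bigr => i _ do rewrite -scalemxAr -Fm hcs scaler_sumr.
  rewrite exchange_big big1//= => j _.
  under eq_bigr => i _ do rewrite scalerA.
  rewrite -scaler_suml; have := congr1 (fun N : 'rV_2 => N 0 j) vM.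
  rewrite !mxE => e; rewrite (_ : \sum_i _ = 0) ?scale0r//.
  by apply: etrans e; apply: eq_bigr => i _; rewrite mxE.
rewrite big_ord3 in hz.
have H i := congr1 (fun N : 'cV[C]_5 => N i 0) hz.
have e i : v 0 0 * h i 0 + v 0 1 * shear_col 2 i 0 + v 0 2 * shear_col 3 i 0 = 0.
  by have := H i; rewrite !mxE.
have e0 := e 0; have e2 := e 2; have e3 := e 3.
rewrite !mxE /= in e0 e2 e3.
have v00 : v 0 0 = 0.
  move: e0; rewrite !mulr0 !addr0 => /eqP; rewrite mulf_eq0 (negbTE h0) orbF => /eqP //.
case/eqP: v0; apply/matrixP => i j; rewrite ord1 !mxE.
move: e2 e3; rewrite v00 !mul0r !mulr0 !mulr1 !add0r addr0 => e2 e3.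
case: j => [[|[|[|//]]] hj].
- by rewrite -[RHS]v00; congr (v _ _); exact/val_inj.
- by rewrite -[RHS]e2; congr (v _ _); exact/val_inj.
- by rewrite -[RHS]e3; congr (v _ _); exact/val_inj.
Qed.

End EigenfunctionMoments.

(** * The dispersion relation and the data it gives at the acoustic pair *)

Section EigenpairRelations.
Variable R : realType.
Local Notation C := R[i].
Local Notation ii := ('i%C : C).

(** Eliminates [th] between the energy equation and the density equation. *)
Lemma long_rel (kap z m I1 J2 th eta : C) : eta = z - kap -> I1 = 1 - z * m -> J2 = m - z * I1 ->
  2 * th * (3 - 2 * kap * m) = - (1 + eta ^+ 2) ->
  kap * th * J2 = kap * (m + eta * I1) - 1 ->
  (1 + eta ^+ 2) * (2 * I1 * (3 - 2 * kap * m) - kap * J2) = - 2 * eta * (3 - 2 * kap * m) * J2.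
Proof.
move=> he hI hJ hE hth; set E := 3 - 2 * kap * m in hE *.
have h1 : (1 + eta ^+ 2) * (kap * J2) = - 2 * E * (kap * (m + eta * I1) - 1).
  rewrite -hth; transitivity (- (2 * th * E) * (kap * J2)); last by ring.
  by rewrite hE opprK.
rewrite mulrBr h1 hJ hI he; ring.
Qed.

(** The energy equation itself excludes E = 3 - 2 kap m = 0, since its right side is nonzero. *)
Lemma long_rel_div (kap z m I1 J2 th eta : C) : eta = z - kap -> I1 = 1 - z * m -> J2 = m - z * I1 ->
  2 * th * (3 - 2 * kap * m) = - (1 + eta ^+ 2) ->
  kap * th * J2 = kap * (m + eta * I1) - 1 ->
  J2 != 0 -> 1 + eta ^+ 2 != 0 ->
  3 - 2 * kap * m != 0 /\
  (1 + eta ^+ 2) * (2 * I1 * J2^-1 - kap * (3 - 2 * kap * m)^-1) = - 2 * eta.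
Proof.
move=> he hI hJ hE hth J0 e0; have h := long_rel he hI hJ hE hth.
have E0 : 3 - 2 * kap * m != 0.
  by apply: contraNneq e0 => E0; move/eqP: hE; rewrite E0 mulr0 eq_sym oppr_eq0.
split=> //; move: h E0; set E := 3 - _ => h E0.
apply: (mulIf E0); apply: (mulIf J0).
transitivity ((1 + eta ^+ 2) * (2 * I1 * E * (J2^-1 * J2) - kap * J2 * (E^-1 * E))); first by ring.
by rewrite !mulVf// !mulr1 h.
Qed.

(** Splits the relations at the acoustic eigenvalue into real ones. The identity for [c] is the
    imaginary part of - 2 eta / (1 + eta^2) divided by [s], with |1 + eta^2|^2 = nu^2 + 4 P^2; the
    formulas for theta are 2 theta = - (1 + eta^2) / E. *)
Lemma ac_data (kap P s : R) (th : C) : 0 < P -> P < kap -> 0 < s ->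
  let u := kap - P in
  2 * th * (3 - 2 * kap%:C * mc u s) = - (1 + ((- P) +i* s) ^+ 2) ->
  kap%:C * th * J2c u s = kap%:C * (mc u s + ((- P) +i* s) * I1c u s) - 1 ->
  exists w sg c lr li : R,
   let nu := P ^+ 2 + s ^+ 2 - 1 in let y := (3 * lr - 2) ^+ 2 + 9 * li ^+ 2 in
   [/\ kap * lr >= kap - P, kap * li >= s / 2,
    (nu ^+ 2 + 4 * P ^+ 2) * c = 2 * nu & c >= 2^-1 + kap * sg] /\
   [/\ sg * s * y = 2 * li, w * y = 3 * (lr ^+ 2 + li ^+ 2) - 2 * lr,
    2 * Re th = (nu - 2 * P ^+ 2) * w + 2 * P * s ^+ 2 * sg &
    2 * Im th = s * (2 * P * w + sg * (2 * P ^+ 2 - nu))].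
Proof.
move=> P0 Pk s0 u hE hth.
have u0 : 0 < u by rewrite subr_gt0.
have k0 : 0 < kap by exact: lt_trans Pk.
pose eta : C := (- P) +i* s.
have J0 := J2c_neq0 s u0.
have e0 : 1 + eta ^+ 2 != 0.
  apply/eqP => /(congr1 (@complex.Im R)) h.
  have h2 : complex.Im (1 + eta ^+ 2) = - 2 * (P * s) by rewrite /eta /=; ring.
  by have := mulr_gt0 P0 s0; move: h; rewrite h2 /=; lra.
have hz : eta = zc u s - kap%:C by apply: complex_ext; rewrite /eta /zc /u /=; ring.
have [E0 hg] := long_rel_div hz (I1cE u s) (J2cE u s) hE hth J0 e0.
set E := 3 - _ in E0 hg hE; set G := 2 * _ / _ in hg.
have m0 : 0 < mr u s ^+ 2 + mi u s ^+ 2.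
  by rewrite ltr_wpDr ?sqr_ge0// exprn_gt0// mr_gt0.
have mn : mc u s != 0.
  rewrite eq_complex /= negb_and gt_eqF ?mr_gt0//.
pose l : C := (kap%:C * mc u s)^-1.
have kn : kap%:C != 0 :> C by rewrite (fmorph_eq0 (real_complex R)) gt_eqF.
(* With l = 1 / (kap m) one has E = 3 - 2 / l, hence 1 / E = l / (3 l - 2); this is the origin of y
   = |3 l - 2|^2. *)
have lE : E * l = 3 * l - 2.
  rewrite /E mulrBl; congr (_ - _).
  by rewrite -[2 * _ * _]mulrA -mulrA /l mulfV ?mulr1// mulf_neq0.
have eE : E^-1 * (3 * l - 2) = l by rewrite -lE mulKf.
have klE : kap%:C * l * mc u s = 1.
  by rewrite /l mulrAC mulfV// mulf_neq0.
clearbody l.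
have kl1 : kap * Re l * mr u s - kap * Im l * mi u s = 1.
  by have := congr1 (@complex.Re R) klE; case: (l) => a b /= <-; ring.
have kl2 : kap * Re l * mi u s + kap * Im l * mr u s = 0.
  by have := congr1 (@complex.Im R) klE; case: (l) => a b /= <-; ring.
have kr : kap * Re l * (mr u s ^+ 2 + mi u s ^+ 2) = mr u s.
  transitivity (mr u s * (kap * Re l * mr u s - kap * Im l * mi u s) +
    mi u s * (kap * Re l * mi u s + kap * Im l * mr u s)); first by ring.
  by rewrite kl1 kl2; ring.
have ki : kap * Im l * (mr u s ^+ 2 + mi u s ^+ 2) = - mi u s.
  transitivity (mr u s * (kap * Re l * mi u s + kap * Im l * mr u s) -
    mi u s * (kap * Re l * mr u s - kap * Im l * mi u s)); first by ring.
  by rewrite kl1 kl2; ring.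
have eE1 : Re E^-1 * (3 * Re l - 2) - Im E^-1 * (3 * Im l) = Re l.
  by have := congr1 (@complex.Re R) eE; case: (E^-1) => c d; case: (l) => a b /= h; rewrite -[RHS]h; ring.
have eE2 : Re E^-1 * (3 * Im l) + Im E^-1 * (3 * Re l - 2) = Im l.
  by have := congr1 (@complex.Im R) eE; case: (E^-1) => c d; case: (l) => a b /= h; rewrite -[RHS]h; ring.
have thE : 2 * th = - ((1 + eta ^+ 2) * E^-1).
  by apply: (mulIf E0); rewrite hE mulNr -mulrA mulVf// mulr1.
set w := Re E^-1 in eE1 eE2; set f := Im E^-1 in eE1 eE2.
have hf : s * (- f / s) = - f by rewrite mulrC divfK// gt_eqF.
set sg := - f / s in hf.
have hg1 : (1 + P ^+ 2 - s ^+ 2) * (Re G - kap * w) - (- 2 * P * s) * (Im G - kap * f) = 2 * P.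
  have := congr1 (@complex.Re R) hg; rewrite /w /f /eta; case: (E^-1) => c d; case: (G) => a b /=.
  by move=> h; apply: (etrans _ (etrans h _)); ring.
have hg2 : (1 + P ^+ 2 - s ^+ 2) * (Im G - kap * f) + (- 2 * P * s) * (Re G - kap * w) = - 2 * s.
  have := congr1 (@complex.Im R) hg; rewrite /w /f /eta; case: (E^-1) => c d; case: (G) => a b /=.
  by move=> h; apply: (etrans _ (etrans h _)); ring.
have GJ : G * J2c u s = 2 * I1c u s by rewrite /G mulfVK.
have GJ1 : Re G * p2 u s - Im G * q2 u s = 2 * p1 u s.
  by have := congr1 (@complex.Re R) GJ; case: (G) => a b /= h; apply: (etrans h); ring.
have GJ2 : Re G * q2 u s + Im G * p2 u s = 2 * q1 u s.
  by have := congr1 (@complex.Im R) GJ; case: (G) => a b /= h; apply: (etrans h); ring.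
have J1 : Im G * (p2 u s ^+ 2 + q2 u s ^+ 2) = 2 * (q1 u s * p2 u s - p1 u s * q2 u s).
  transitivity ((Re G * q2 u s + Im G * p2 u s) * p2 u s - (Re G * p2 u s - Im G * q2 u s) * q2 u s).
    by ring.
  by rewrite GJ1 GJ2; ring.
have J2p : 0 < p2 u s ^+ 2 + q2 u s ^+ 2.
  by rewrite lt0r; apply/andP; split; [exact: (J2_neq0_ge0 u0 (ltW s0)) | rewrite addr_ge0 ?sqr_ge0].
(* The sign of [skew] divided by |J2|^2. *)
have hIm : s / 2 <= Im G.
  rewrite -(ler_pM2r J2p) J1; have := skew_ge0 u0 (ltW s0); rewrite /skew.
  by rewrite pmulr_lge0 ?expR_gt0// subr_ge0.
exists w, sg, ((Im G - kap * f) / s), (Re l), (Im l) => nu y; split; split.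
- rewrite -(ler_pM2r m0) kr; exact: mr_ge.
- rewrite -(ler_pM2r m0) ki; exact: (mi_upper u0 (ltW s0)).
- apply: (mulIf (lt0r_neq0 s0)); rewrite -mulrA divfK ?gt_eqF//.
  transitivity ((1 + P ^+ 2 - s ^+ 2) * (- 2 * s) - (- 2 * P * s) * (2 * P)).
    by rewrite -hg1 -hg2 /nu; ring.
  by rewrite /nu; ring.
- rewrite ler_pdivlMr// mulrDl; have -> : kap * sg * s = - (kap * f) by rewrite -mulrA [sg * s]mulrC hf; ring.
  by have := hIm; lra.
- rewrite [sg * s]mulrC hf /y.
  transitivity ((w * (3 * Re l - 2) - f * (3 * Im l)) * (3 * Im l)
     - (3 * Re l - 2) * (w * (3 * Im l) + f * (3 * Re l - 2))); first by ring.
  by rewrite eE1 eE2; ring.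
- rewrite /y; transitivity ((w * (3 * Re l - 2) - f * (3 * Im l)) * (3 * Re l - 2)
     + (3 * Im l) * (w * (3 * Im l) + f * (3 * Re l - 2))); first by ring.
  by rewrite eE1 eE2; ring.
- have := congr1 (@complex.Re R) thE; rewrite /eta; have : f = - (s * sg) by rewrite hf opprK.
  rewrite /w /f; case: (E^-1) => c d /= -> ; case: (th) => a b /= h.
  by apply: (etrans _ (etrans h _)); rewrite /nu; ring.
- have := congr1 (@complex.Im R) thE; rewrite /eta; have : f = - (s * sg) by rewrite hf opprK.
  rewrite /w /f; case: (E^-1) => c d /= -> ; case: (th) => a b /= h.
  by apply: (etrans _ (etrans h _)); rewrite /nu; ring.
Qed.

End EigenpairRelations.

(* [eta_ac = - P + i s], [eta_diff = - B], [lr + i li = 1 / (kap m_ac)],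
   [w - i s sg = 1 / E_ac], [e = 1 / E_diff], and [C] is the imaginary part of
   [2 I1 / J2 - kap / E_ac] over [s]. The bounded quantity is, up to a positive
   factor, the imaginary part of
   [(eta_ac - eta_diff) conj (theta_ac - theta_diff)]. *)
Lemma gram_sign_bound (R : realFieldType) (kap P s B nu C sg w y lr li e : R) :
  0 < P -> P < kap -> 0 < B -> B < kap ->
  0 < s -> nu = P ^+ 2 + s ^+ 2 - 1 ->
  kap * lr >= kap - P -> kap * li >= s / 2 ->
  y = (3 * lr - 2) ^+ 2 + 9 * li ^+ 2 ->
  (nu ^+ 2 + 4 * P ^+ 2) * C = 2 * nu ->
  C >= 2^-1 + kap * sg -> sg * s * y = 2 * li ->
  w * y = 3 * (lr ^+ 2 + li ^+ 2) - 2 * lr -> 3^-1 < e ->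
  0 < w * (nu - 2 * P * B) + sg * (P * (nu + 2) + B * (nu - 2 * P ^+ 2))
      + (1 + B ^+ 2) * e.
Proof.
move=> P0 Pk B0 Bk s0 nuE lrk lik yE XC Cge sgsy wy he.
have k0 : 0 < kap by lra.
have li0 : 0 < li by rewrite -(pmulr_rgt0 _ k0); lra.
have y0 : 0 < y.
  by rewrite yE; have := sqr_ge0 (3 * lr - 2); have := exprn_gt0 2 li0; lra.
have sg0 : 0 < sg by rewrite -(pmulr_lgt0 _ (mulr_gt0 s0 y0)) mulrA sgsy; lra.
have sgy : 1 <= kap * sg * y.
  rewrite -(ler_pM2r s0) mul1r.
  have -> : kap * sg * y * s = kap * (sg * s * y) by ring.
  by rewrite sgsy; lra.
have ks0 : 0 < kap * sg by apply: mulr_gt0.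
have C2 : 2^-1 < C by lra.
have P2 : 0 < P ^+ 2 by apply: exprn_gt0.
have nu2 : 0 <= nu ^+ 2 by apply: sqr_ge0.
have X0 : 0 < nu ^+ 2 + 4 * P ^+ 2 by lra.
have C0 : 0 < C by lra.
have nu0 : 0 < nu by have := mulr_gt0 X0 C0; lra.
(* C > 1/2 puts (nu, 2 P) inside the disc of radius 2 about (2, 0); both P^2 < nu and P < 1
   follow. *)
have X4 : nu ^+ 2 + 4 * P ^+ 2 < 4 * nu.
  have : 0 < (nu ^+ 2 + 4 * P ^+ 2) * (C - 2^-1) by apply: mulr_gt0 => //; lra.
  lra.
have nuP : P ^+ 2 < nu by lra.
have P1 : P < 1 by have := sqr_ge0 (nu - 2); nra.
(* By [XC] the point (nu C, 2 P C) lies on the unit circle about (1, 0). *)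
have PC : 2 * P * C <= 1.
  have : (nu * C - 1) ^+ 2 + (2 * P * C) ^+ 2 = 1.
    have -> : (nu * C - 1) ^+ 2 + (2 * P * C) ^+ 2
      = C * ((nu ^+ 2 + 4 * P ^+ 2) * C - 2 * nu) + 1 by ring.
    by rewrite XC subrr mulr0 add0r.
  have := sqr_ge0 (nu * C - 1).
  move=> h h1; rewrite leNgt; apply/negP => h2.
  have : 1 * 1 < (2 * P * C) * (2 * P * C) by apply: ltr_pM.
  lra.
have Cy : y / 2 + 1 <= C * y.
  have : (2^-1 + kap * sg) * y <= C * y by rewrite ler_pM2r.
  lra.
(* [w] is the real part of [1/E]; it is below [4/3 C] because [3|l-1|^2 + 1 > 0] *)
have wC : w < 4 / 3 * C.
  rewrite -(ltr_pM2r y0) wy.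
  have := sqr_ge0 (lr - 1); have := sqr_ge0 li.
  by move: Cy; rewrite yE; lra.
have w0 : 0 <= w.
  (* If w < 0 then l lies in the disc of radius 1/3 about 1/3, so lr < 2/3 and li < 1/3. As s >= 1,
     the bound on li gives kap > 3/2, hence P > 1/2 and y > 2; then lr < 1/3, and P >= kap (1 - lr)
     exceeds 1. *)
  rewrite leNgt; apply/negP => wn.
  clear B0 Bk sgsy sg0 sgy ks0 C2 nu2 X0 nu0 X4 P1 XC Cge wC he.
  have h1 : 3 * (lr ^+ 2 + li ^+ 2) < 2 * lr.
    have : 0 < (- w) * y by apply: mulr_gt0 => //; lra.
    lra.
  have lr0 : 0 < lr by nra.
  have lr23 : lr < 2 / 3 by nra.
  have Pk3 : P >= kap * (1 - lr) by nra.
  have Py : P * (y + 2) <= y.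
    have : P * (y / 2 + 1) <= P * (C * y) by rewrite ler_pM2l.
    have : (2 * P * C) * y <= 1 * y by rewrite ler_pM2r.
    lra.
  have s1 : 1 <= s.
    rewrite leNgt; apply/negP => h.
    have : s * s < 1 * 1 by apply: ltr_pM => //; exact: ltW.
    lra.
  have li13 : li < 3^-1.
    rewrite ltNge; apply/negP => h.
    have : 3^-1 * 3^-1 <= li * li by apply: ler_pM => //; lra.
    have := sqr_ge0 (lr - 3^-1); lra.
  have k32 : 3 / 2 < kap.
    have : kap * li < kap * 3^-1 by rewrite ltr_pM2l.
    lra.
  have : kap * 3^-1 < kap * (1 - lr) by rewrite ltr_pM2l //; lra.
  move=> h2; have P12 : 2^-1 < P by lra.
  have ylt : y < 4 - 6 * lr by rewrite yE; lra.
  have : y * 2^-1 < y * P by rewrite ltr_pM2l.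
  move=> h3; have y2 : 2 < y by lra.
  have : kap * (2 / 3) < kap * (1 - lr) by rewrite ltr_pM2l //; lra.
  lra.
have Pw : P * w <= 46 / 100.
  clear lrk lik nuE C2 nu2 X0 nu0 X4 XC wC he B0 Bk.
  have h1 : (3 * w - 1) ^+ 2 * y <= 4.
    have h2 : (3 * w - 1) * y = 2 * (3 * lr - 2).
      have -> : (3 * w - 1) * y = 3 * (w * y) - y by ring.
      by rewrite wy yE; ring.
    have h3 : ((3 * w - 1) * y) ^+ 2 <= 4 * y.
      by rewrite h2 yE; have := sqr_ge0 li; lra.
    by rewrite -(ler_pM2r y0); lra.
  have h2 : (3 * w - 1) ^+ 2 <= 4 * (C - 2^-1).
    have h3 := ler_wpM2r (ltW ks0) h1.
    have h4 : 0 <= (3 * w - 1) ^+ 2 * (kap * sg * y - 1).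
      by apply: mulr_ge0; [apply: sqr_ge0 | rewrite subr_ge0].
    lra.
  have h3 : P * (3 * w - 1) ^+ 2 <= P * (4 * (C - 2^-1)) by rewrite ler_pM2l.
  have h4 := mulr_ge0 (ltW P0) (sqr_ge0 (w - 119 / 207)).
  lra.
(* A quadratic in [B], nonnegative once its discriminant is not positive, that is 9 P^2 w^2 <= 1 + 3
   w nu ([h3]). Eliminating P by [XC], this becomes [h2], which follows from C >= 3 w / 4 and (3 w
   nu + 2)^2 >= 24 w nu. *)
have main : 0 <= w * (nu - 2 * P * B) + (1 + B ^+ 2) / 3.
  clear lrk lik nuE yE wy Cy sgsy sgy Cge sg0 ks0 Pk P1 he li0 y0 s0.
  have h1 : 4 * P ^+ 2 * C = nu * (2 - nu * C).
    have -> : 4 * P ^+ 2 * C = (nu ^+ 2 + 4 * P ^+ 2) * C - nu ^+ 2 * C by ring.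
    by rewrite XC; ring.
  have h2 : 18 * w ^+ 2 * nu <= C * (3 * w * nu + 2) ^+ 2.
    apply: (@le_trans _ _ (3 / 4 * w * (3 * w * nu + 2) ^+ 2)); last first.
      by apply: ler_wpM2r; [apply: sqr_ge0 | lra].
    have : 0 <= w * (3 * w * nu - 2) ^+ 2.
      by apply: mulr_ge0 => //; apply: sqr_ge0.
    by lra.
  have h3 : 9 * P ^+ 2 * w ^+ 2 <= 1 + 3 * w * nu.
    rewrite -(ler_pM2r (_ : 0 < 4 * C)); last lra.
    have -> : 9 * P ^+ 2 * w ^+ 2 * (4 * C) = 9 * w ^+ 2 * (4 * P ^+ 2 * C) by ring.
    by rewrite h1; lra.
  have : 0 <= (B - 3 * P * w) ^+ 2 by apply: sqr_ge0.
  by lra.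
clear - P0 P1 B0 Bk sg0 nu0 nuP X4 XC C0 C2 Cge w0 wC Pw main he P2.
have B2 : 0 < 1 + B ^+ 2 by have := sqr_ge0 B; lra.
have he2 : (1 + B ^+ 2) / 3 < (1 + B ^+ 2) * e by rewrite ltr_pM2l.
have Pn : 0 < P * (nu + 2) by apply: mulr_gt0 => //; exact: addr_gt0.
have /orP[nuP2|nuP2] : (2 * P ^+ 2 <= nu) || (nu < 2 * P ^+ 2) by rewrite leNgt orNb.
  have : 0 <= sg * (P * (nu + 2) + B * (nu - 2 * P ^+ 2)).
    apply: mulr_ge0; first exact: ltW.
    apply: addr_ge0; first exact: ltW.
    by apply: mulr_ge0; [exact: ltW | rewrite subr_ge0].
  by lra.
(* At B = 3 and nu = P^2 the bracket multiplying [sg] is P (1 - P) (2 - P), still nonnegative.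
   Beyond 3 the bracket may be negative, but (1 + B^2) / 3 exceeds B + 1/3, which outweighs 2 P w B
   <= 0.92 B and a loss below 1/2. *)
have /orP[B3|B3] : (B <= 3) || (3 < B) by rewrite leNgt orNb.
  have : 0 <= sg * (P * (nu + 2) + B * (nu - 2 * P ^+ 2)).
    apply: mulr_ge0; first exact: ltW.
    have : B * (2 * P ^+ 2 - nu) <= 3 * (2 * P ^+ 2 - nu).
      by apply: ler_wpM2r => //; rewrite subr_ge0 ltW.
    have : P * P ^+ 2 <= P * nu by apply: ler_wpM2l; exact: ltW.
    have : 0 <= P * ((1 - P) * (2 - P)).
      apply: mulr_ge0; first exact: ltW.
      by apply: mulr_ge0; rewrite subr_ge0 ltW// (lt_trans P1)// ltr1n.
    lra.
  by lra.
have C1 : C < 1.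
  have : C * (nu * (nu + 2)) < C * (nu ^+ 2 + 4 * P ^+ 2).
    by rewrite ltr_pM2l //; nra.
  have -> : C * (nu ^+ 2 + 4 * P ^+ 2) = 2 * nu by rewrite -XC mulrC.
  nra.
have sgB : sg * B <= 2^-1.
  have : sg * B <= sg * kap by apply: ler_wpM2l; exact: ltW.
  lra.
have h1 : sg * B * (2 * P ^+ 2 - nu) <= 2^-1 * (2 * P ^+ 2 - nu).
  by apply: ler_wpM2r => //; rewrite subr_ge0 ltW.
have h2 : 0 < sg * (P * (nu + 2)) by apply: mulr_gt0.
have h3 : P * w * B <= 46 / 100 * B by apply: ler_wpM2r; [exact: ltW | exact: Pw].
have h4 : 0 <= w * nu by apply: mulr_ge0; [exact: w0 | exact: ltW].
have h5 : 3 * B < B ^+ 2 by rewrite expr2 ltr_pM2r.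
have h6 : P ^+ 2 < 1 by rewrite expr_lt1 // ltW.
lra.
Qed.

(** * Real and imaginary coefficients *)

Section Reality.
Variables (R : realType) (k : R) (th : R[i] -> R[i]) (ld : R) (la : R[i]) (r : R).
Hypothesis thd : th ld%:C = r%:C.
Hypothesis thc : th (conjc la) = conjc (th la).
Let D := \det (Hhat k th ld%:C la (conjc la)).

Lemma ReZ (x : R) (y : R[i]) : Re (x%:C * y) = x * Re y.
Proof. by rewrite complex_ReM /=; ring. Qed.
Lemma ImZ (x : R) (y : R[i]) : Im (x%:C * y) = x * Im y.
Proof. by rewrite complex_ImM /=; ring. Qed.

Lemma ReZr (x : R) (y : R[i]) : Re (y * x%:C) = Re y * x.
Proof. by rewrite mulrC ReZ mulrC. Qed.
Lemma ImZr (x : R) (y : R[i]) : Im (y * x%:C) = Im y * x.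
Proof. by rewrite mulrC ImZ mulrC. Qed.

Lemma det_real : D = (Re D)%:C.
Proof.
apply: complex_ext => //=; rewrite /D det_Hhat /gram thc thd.
have -> : 'i%C / k%:C = (k^-1)%:C * 'i%C :> R[i] by rewrite -fmorphV mulrC.
rewrite -mulrA ImZ; case: (la) => p q; case: (th _) => a b /=; ring.
Qed.

(** Conjugation exchanges the last two eigenvalues, and every cyclic sum or product here is
    antisymmetric under that exchange, hence purely imaginary. The prefactors are real for C1, C3,
    C5 and imaginary for C2, C4, C6, as the determinant is real. *)
Lemma coeffs_reality :
 [/\ Re (C1 k D th ld%:C la (conjc la)) = 0, Re (C3 k D ld%:C la (conjc la)) = 0 &
     Re (C5 D th ld%:C la (conjc la)) = 0] /\
 [/\ Im (C2 k D th ld%:C la (conjc la)) = 0, Im (C4 k D th ld%:C la (conjc la)) = 0 &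
     Im (C6 k D th ld%:C la (conjc la)) = 0].
Proof.
rewrite det_real; set d := Re D.
have e1 : 1 / (k%:C ^+ 2 * d%:C) = ((k ^+ 2 * d)^-1)%:C :> R[i].
  by rewrite div1r fmorphV rmorphM rmorphXn.
have e2 : 'i%C / (k%:C * d%:C) = ((k * d)^-1)%:C * 'i%C :> R[i].
  by rewrite fmorphV rmorphM mulrC.
have e3 : 1 / d%:C = (d^-1)%:C :> R[i] by rewrite div1r fmorphV.
rewrite /C1 /C2 /C3 /C4 /C5 /C6 /cyc_sum /cyc_prod e1 e2 e3 thc thd.
have ReN (z : R[i]) : Re (- z) = - Re z by case: z.
have ImN (z : R[i]) : Im (- z) = - Im z by case: z.
rewrite !mulNr !ReN !ImN -!mulrA !ReZ !ImZ.
have Z (x y : R) : y = 0 -> x * y = 0 by move=> ->; rewrite mulr0.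
have ZN (x y : R) : y = 0 -> - (x * y) = 0 by move=> ->; rewrite mulr0 oppr0.
case: (la) => p q; case: (th _) => a b.
by split; split; (apply: Z || apply: ZN) => /=; ring.
Qed.

End Reality.

(** * Nonvanishing of the determinant *)

Section GramSign.
Variable R : realType.
Local Notation C := R[i].

(** On the real axis the dispersion relation gives 2 I1 / J2 - kap / E = 2 B / (1 + B^2) <= 1, while
    2 I1 / J2 >= 1 by [p2_le]. Hence E > 0, and E < 3 because kap m > 0; the witness is 1 / E. *)
Lemma diff_data (kap B : R) (th : C) : 0 < B -> B < kap ->
  let u := kap - B in
  2 * th * (3 - 2 * kap%:C * mc u 0) = - (1 + (- B)%:C ^+ 2) ->
  kap%:C * th * J2c u 0 = kap%:C * (mc u 0 + (- B)%:C * I1c u 0) - 1 ->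
  Im th = 0 -> exists2 e, 3^-1 < e & 2 * Re th = - (1 + B ^+ 2) * e.
Proof.
move=> B0 Bk u hE hth thr.
have u0 : 0 < u by rewrite subr_gt0.
have k0 : 0 < kap by exact: lt_trans Bk.
have J0 := J2c_neq0 0 u0.
have mE : mc u 0 = (mr u 0)%:C by rewrite /mc mi_u0.
have IE : I1c u 0 = (p1 u 0)%:C by rewrite /I1c q1_u0.
have JE : J2c u 0 = (p2 u 0)%:C by rewrite /J2c q2_u0.
have e0 : 1 + (- B)%:C ^+ 2 != 0 :> C.
  apply/eqP => /(congr1 (@complex.Re R)) h.
  have h2 : complex.Re (1 + (- B)%:C ^+ 2) = 1 + B ^+ 2 by rewrite /=; ring.
  by move: h; rewrite h2 /=; have := sqr_ge0 B; lra.
have hz : (- B)%:C = zc u 0 - kap%:C by apply: complex_ext; rewrite /zc /u /=; ring.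
have [E0 hg] := long_rel_div hz (I1cE u 0) (J2cE u 0) hE hth J0 e0.
pose E := 3 - 2 * kap * mr u 0.
have EE : 3 - 2 * kap%:C * mc u 0 = E%:C by rewrite mE /E; ring.
rewrite EE in E0 hg hE; rewrite JE (fmorph_eq0 (real_complex R)) in J0.
rewrite (fmorph_eq0 (real_complex R)) in E0.
have p20 : 0 < p2 u 0 by rewrite lt0r J0 p2_ge0.
have hgr : (1 + B ^+ 2) * (2 * p1 u 0 / p2 u 0 - kap / E) = 2 * B.
  have := congr1 (@complex.Re R) hg; rewrite IE JE -!fmorphV.
  have -> : (1 + (- B)%:C ^+ 2) * (2 * (p1 u 0)%:C * (p2 u 0)^-1%:C - kap%:C * E^-1%:C)
    = ((1 + B ^+ 2) * (2 * p1 u 0 / p2 u 0 - kap / E))%:C by ring.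
  by move=> /= ->; ring.
have B2 : 0 < 1 + B ^+ 2 by have := sqr_ge0 B; lra.
have g1 : 1 <= 2 * p1 u 0 / p2 u 0 by rewrite ler_pdivlMr// mul1r p2_le.
have hd : 2 * p1 u 0 / p2 u 0 - kap / E <= 1.
  rewrite -(ler_pM2l B2) hgr mulr1; have := sqr_ge0 (B - 1); lra.
have Ep : 0 < E.
  rewrite lt0r E0 leNgt; apply/negP => En.
  have : 0 < kap / - E by rewrite divr_gt0// oppr_gt0.
  rewrite invrN mulrN; lra.
have km : 0 < kap * mr u 0 by apply: mulr_gt0 => //; exact: mr_gt0.
exists E^-1; first by rewrite ltf_pV2 ?posrE// /E; lra.
apply: (mulIf E0); rewrite -[RHS]mulrA mulVf// mulr1.
have := congr1 (@complex.Re R) hE; case: (th) thr => a b /= -> h.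
by apply: (etrans _ (etrans h _)); ring.
Qed.

Lemma gram_neq0 (th : C -> C) (k kap P s B : R) (la : C) (x r : R) :
  0 < k -> 0 < x -> 0 < P -> P < kap -> 0 < B -> B < kap -> 0 < s ->
  la = (- (k * P)) +i* (k * s) ->
  th (- (k * B))%:C = (x * r)%:C -> th (conjc la) = conjc (th la) ->
  (exists2 e, 3^-1 < e & 2 * r = - (1 + B ^+ 2) * e) ->
  (exists w sg c lr li : R,
   let nu := P ^+ 2 + s ^+ 2 - 1 in let y := (3 * lr - 2) ^+ 2 + 9 * li ^+ 2 in
   [/\ kap * lr >= kap - P, kap * li >= s / 2,
    (nu ^+ 2 + 4 * P ^+ 2) * c = 2 * nu & c >= 2^-1 + kap * sg] /\
   [/\ sg * s * y = 2 * li, w * y = 3 * (lr ^+ 2 + li ^+ 2) - 2 * lr,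
    2 * (Re (th la) / x) = (nu - 2 * P ^+ 2) * w + 2 * P * s ^+ 2 * sg &
    2 * (Im (th la) / x) = s * (2 * P * w + sg * (2 * P ^+ 2 - nu))]) ->
  gram th (- (k * B))%:C la (conjc la) != 0.
Proof.
move=> k0 x0 P0 Pk B0 Bk s0 laE thd thc [e he rE] [w [sg [c [lr [li [[h1 h2 h3 h4] [h5 h6 h7 h8]]]]]]].
have T := gram_sign_bound P0 Pk B0 Bk s0 erefl h1 h2 erefl h3 h4 h5 h6 he.
move: T h7 h8; set nu := _ - 1; set T := _ + _ * e => T0 h7 h8.
have a1 : 2 * Re (th la) = x * ((nu - 2 * P ^+ 2) * w + 2 * P * s ^+ 2 * sg).
  by rewrite -h7; field; rewrite gt_eqF.
have a2 : 2 * Im (th la) = x * (s * (2 * P * w + sg * (2 * P ^+ 2 - nu))).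
  by rewrite -h8; field; rewrite gt_eqF.
have E : complex.Im (gram th (- (k * B))%:C la (conjc la)) = k * s * x * T.
  rewrite /gram thc thd; move: a1 a2; case: (th la) => a b /=; rewrite laE /= => a1 a2.
  transitivity (k * (s * (2 * a) - x * s * (2 * r) + (P - B) * (2 * b))); first by ring.
  by rewrite a1 a2 rE /T /nu; ring.
apply/eqP => g0; have := mulr_gt0 (mulr_gt0 (mulr_gt0 k0 s0) x0) T0.
by rewrite -E g0 ltxx.
Qed.

End GramSign.

Lemma has_dim1_not2 (R : realType) (V : (R3 R -> R[i]) -> Prop) : has_dim V 1 -> ~ has_dim V 2.
Proof.
move=> [b [_ _ bspan]]; apply: (@rank1_not_dim2 _ _ (b 0)) => f /bspan[c hc].
exists (c 0); apply: filterS hc => v ->.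
by rewrite /lincomb big_ord_recl big_ord0 addr0.
Qed.

Lemma mulmx_orth_conj (F : fieldType) n (q h l c : 'M[F]_n) : q^T *m q = 1%:M ->
  q *m h \in unitmx -> h *m l = c *m h -> q *m h *m l *m invmx (q *m h) = q *m c *m q^T.
Proof.
move=> hq hu hl; apply: (can_inj (mulmxK hu)); rewrite mulmxKV//.
by rewrite -!mulmxA (mulmxA q^T) hq mul1mx hl.
Qed.

Lemma mulmx_conj_eigen (F : fieldType) n (h l : 'M[F]_n) (y : 'cV[F]_n) a : h \in unitmx ->
  l *m y = a *: y -> a *: (h *m y) = h *m l *m invmx h *m (h *m y).
Proof. by move=> hu hy; rewrite -(mulmxA (h *m l)) mulKmx// -mulmxA hy scalemxAr. Qed.

Section Conjugation.
Variables (R : realType) (u s : R).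
Hypothesis u0 : 0 < u.

Lemma zc_opp : zc u (- s) = conjc (zc u s). Proof. by []. Qed.

Lemma mc_opp : mc u (- s) = conjc (mc u s).
Proof. by have [a b] := mr_mi_opp s u0; rewrite /mc a b. Qed.

Lemma I1c_opp : I1c u (- s) = conjc (I1c u s).
Proof. by rewrite !I1cE mc_opp zc_opp rmorphB rmorph1 rmorphM. Qed.

Lemma J2c_opp : J2c u (- s) = conjc (J2c u s).
Proof. by rewrite !J2cE mc_opp zc_opp I1c_opp rmorphB rmorphM. Qed.

Lemma mi_neq0 : s != 0 -> mi u s != 0.
Proof.
have H t : 0 < t -> mi u t != 0.
  move=> t0; rewrite lt_eqF// -oppr_gt0.
  apply: lt_le_trans (mi_upper u0 (ltW t0)); apply: mulr_gt0; first by rewrite divr_gt0.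
  by rewrite ltr_wpDr ?sqr_ge0// exprn_gt0// mr_gt0.
move=> sn; have [s0|s0] := leP s 0; last exact: H.
have {}s0 : 0 < - s by rewrite oppr_gt0 lt_neqAle sn.
have [_ b] := mr_mi_opp (- s) u0; rewrite opprK in b.
by rewrite b oppr_eq0; exact: H.
Qed.

End Conjugation.

(** * Application to the hydrodynamic eigenvalues *)

Section Hydrodynamics.
Variables (R : realType) (tau : R) (kv : 'cV[R]_3) (Q : 'M[R]_3).
Variables (ldiff : R) (lac : R[i]) (lshear : R).
Local Notation C := R[i].
Local Notation ii := ('i%C : C).
Let k := enorm kv.
Hypothesis tau0 : 0 < tau.
Hypothesis k0 : 0 < k.
Hypothesis al : aligns Q kv.
Hypothesis sf : spectral_facts tau kv ldiff lac lshear.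
Let hQ : orth3 Q. Proof. by case: al. Qed.
Let th := theta tau k.
Let kap := inv_ktau tau kv.
Let kap0 : 0 < kap := inv_ktau_gt0 tau0 k0.
Let kn : k != 0. Proof. by rewrite gt_eqF. Qed.
Let tn : tau != 0. Proof. by rewrite gt_eqF. Qed.

(** The value 1 is the dispersion relation of the shear modes. *)
Definition crit (lam : C) := (inv_ktau tau kv)%:C * mc (z_re tau kv lam) (z_im tau kv lam).

Lemma theta_conj lam : - tau^-1 < Re lam -> th (conjc lam) = conjc (th lam).
Proof.
move=> hl; have hl' : - tau^-1 < Re (conjc lam) by case: lam hl.
have u0 := z_re_gt0 tau0 k0 hl.
rewrite /th (thetaE tau0 k0 hl') (thetaE tau0 k0 hl).
have -> : z_re tau kv (conjc lam) = z_re tau kv lam by case: lam {hl hl' u0}.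
have -> : z_im tau kv (conjc lam) = - z_im tau kv lam.
  by case: lam {hl hl' u0} => a b; rewrite /z_im /=; ring.
have -> : etac kv (conjc lam) = conjc (etac kv lam).
  by rewrite /etac rmorphM fmorphV /=; congr (_ / _); rewrite /real_complex_def /= oppr0.
rewrite (mc_opp _ u0) (I1c_opp _ u0) (J2c_opp _ u0).
have cr (x : R) : conjc x%:C = x%:C by rewrite /= oppr0.
have cM (x y : C) : conjc (x * y) = conjc x * conjc y := rmorphM _ x y.
have cD (x y : C) : conjc (x + y) = conjc x + conjc y := rmorphD _ x y.
have cN (x : C) : conjc (- x) = - conjc x := rmorphN _ x.
have cV (x : C) : conjc (x^-1) = (conjc x)^-1 := fmorphV _ x.
by rewrite !(cM, cD, cN, cV) !cr.
Qed.

Lemma theta_real (l : R) : - tau^-1 < l -> th l%:C = (Re (th l%:C))%:C.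
Proof.
move=> hl; have e : conjc l%:C = l%:C by rewrite /= oppr0.
have := congr1 (@complex.Im R) (@theta_conj l%:C hl); rewrite e.
by case: (th _) => a b /= h; apply: complex_ext => //=; lra.
Qed.

Lemma strip lam : lam \in hydro_eigenvalues ldiff lac lshear -> - tau^-1 < Re lam < 0.
Proof. exact: sf_strip sf _. Qed.

Lemma mem_diff : ldiff%:C \in hydro_eigenvalues ldiff lac lshear.
Proof. by rewrite !inE eqxx. Qed.
Lemma mem_ac : lac \in hydro_eigenvalues ldiff lac lshear.
Proof. by rewrite !inE eqxx orbT. Qed.
Lemma mem_shear : lshear%:C \in hydro_eigenvalues ldiff lac lshear.
Proof. by rewrite !inE eqxx !orbT. Qed.

Lemma eigen_ex lam : lam \in hydro_eigenvalues ldiff lac lshear ->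
  exists f, eigenfunction tau kv lam f.
Proof. by move=> h; have [[f hf] _] := (sf_eigenvalues sf lam).2 h; exists f. Qed.

Lemma crit_nonreal lam : - tau^-1 < Re lam -> Im lam != 0 -> crit lam != 1.
Proof.
move=> hl hi; have u0 := z_re_gt0 tau0 k0 hl.
have sn : z_im tau kv lam != 0 by apply: mulf_neq0; [rewrite gt_eqF | apply: mulf_neq0].
apply/eqP => /(congr1 (@complex.Im R)); rewrite /crit ImZ /= => /eqP.
by rewrite mulf_eq0 (negbTE (mi_neq0 u0 sn)) orbF gt_eqF.
Qed.

Lemma crit_shear : crit lshear%:C = 1.
Proof.
have /andP[hl _] := strip mem_shear.
exact: shear_crit tau0 k0 al hl (sf_shear_geo sf).
Qed.

(** Otherwise injectivity of m on the real axis would give ldiff = lshear, against their algebraic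
    multiplicities one and two. *)
Lemma crit_diff : crit ldiff%:C != 1.
Proof.
have /andP[hl _] := strip mem_diff; have /andP[hs _] := strip mem_shear.
apply/eqP => hd; have hsh := crit_shear.
have s0 (l : R) : z_im tau kv l%:C = 0 by rewrite /z_im /= !mulr0.
have H (l : R) : crit l%:C = 1 -> mr (z_re tau kv l%:C) 0 = kap^-1.
  move=> /(congr1 (@complex.Re R)); rewrite /crit ReZ s0 /= => e.
  by apply: (mulfI (lt0r_neq0 kap0)); rewrite e mulfV// gt_eqF.
have e : z_re tau kv ldiff%:C = z_re tau kv lshear%:C.
  by apply: mr_inj; [exact: z_re_gt0 hl|exact: z_re_gt0 hs|rewrite !H].
have el : ldiff = lshear.
  move: e; rewrite /z_re /= => /(mulfI (lt0r_neq0 kap0)) /addIr.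
  exact: mulfI.
by apply: (has_dim1_not2 (sf_diff_mult sf)); rewrite el; exact: sf_shear_alg sf.
Qed.

Lemma long_data lam : lam \in hydro_eigenvalues ldiff lac lshear -> crit lam != 1 ->
  let t := th lam * ((Num.sqrt 6)^-1)%:C in
  let eta := lam / k%:C in
  let m := mc (z_re tau kv lam) (z_im tau kv lam) in
  [/\ forall f, eigenfunction tau kv lam f ->
        exists a, moments f = a *: (Qtilde Q *m long_col tau kv lam),
      2 * t * (3 - 2 * kap%:C * m) = - (1 + eta ^+ 2) &
      kap%:C * t * J2c (z_re tau kv lam) (z_im tau kv lam) =
      kap%:C * (m + eta * I1c (z_re tau kv lam) (z_im tau kv lam)) - 1].
Proof.
move=> hl hc t eta m; have /andP[hs _] := strip hl.
have u0 := z_re_gt0 tau0 k0 hs.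
have [f hf] := eigen_ex hl.
split.
- by move=> g hg; have [] := long_form tau0 k0 al hs hc hg.
- by have [] := long_form tau0 k0 al hs hc hf.
have J0 := J2c_neq0 (z_im tau kv lam) u0.
have s6 : (Num.sqrt 6)%:C * ((Num.sqrt 6)^-1)%:C = 1 :> C by rewrite -rmorphM mulfV ?sqrt6_neq0.
have xk : kap%:C * (k * tau)%:C = 1.
  by rewrite /kap /inv_ktau -rmorphM -/k mulVf// gt_eqF// mulr_gt0.
rewrite /t /th (thetaE tau0 k0 hs) -/m.
transitivity ((kap%:C * (m + eta * I1c (z_re tau kv lam) (z_im tau kv lam)) - kap%:C * (k * tau)%:C)
  * ((Num.sqrt 6)%:C * ((Num.sqrt 6)^-1)%:C)
  * ((J2c (z_re tau kv lam) (z_im tau kv lam))^-1 * J2c (z_re tau kv lam) (z_im tau kv lam))).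
  by rewrite /eta /etac -/k; ring.
by rewrite mulVf// s6 xk !mulr1.
Qed.

Lemma z_reE lam : z_re tau kv lam = kap - (- (Re lam / k)).
Proof. by rewrite /z_re /kap /inv_ktau -/k; field; rewrite kn tn. Qed.
Lemma z_imE lam : z_im tau kv lam = Im lam / k.
Proof. by rewrite /z_im /inv_ktau -/k; field; rewrite kn tn. Qed.

Lemma neg_Re_lt_kap lam : lam \in hydro_eigenvalues ldiff lac lshear ->
  0 < - (Re lam / k) /\ - (Re lam / k) < kap.
Proof.
move=> /strip/andP[h1 h2]; have := z_re_gt0 tau0 k0 h1; rewrite z_reE subr_gt0 => h3.
by split=> //; rewrite -mulNr divr_gt0// oppr_gt0.
Qed.

Lemma gram_hydro : gram th ldiff%:C lac (conjc lac) != 0.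
Proof.
have [B0 Bk] := neg_Re_lt_kap mem_diff; have [P0 Pk] := neg_Re_lt_kap mem_ac.
set B := - _ in B0 Bk; set P := - _ in P0 Pk.
have /andP[ha _] := strip mem_ac; have /andP[hd _] := strip mem_diff.
have s0 : 0 < Im lac / k by rewrite divr_gt0// (sf_ac sf).
have hca : crit lac != 1 by apply: crit_nonreal => //; rewrite gt_eqF// (sf_ac sf).
have [_ ea ja] := long_data mem_ac hca.
have [_ ed jd] := long_data mem_diff crit_diff.
have q6 : 0 < Num.sqrt 6 :> R by rewrite sqrtr_gt0.
have ldE : ldiff = - (k * B) by rewrite /B /=; field.
have laE : lac = (- (k * P)) +i* (k * (Im lac / k)).
  by apply: complex_ext; rewrite /P /=; field.
have etaA : lac / k%:C = (- P) +i* (Im lac / k).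
  by rewrite -fmorphV mulrC; apply: complex_ext; rewrite ?ReZ ?ImZ /P /=; field.
have etaD : ldiff%:C / k%:C = (- B)%:C.
  by rewrite -fmorphV -rmorphM /B opprK.
rewrite z_reE z_imE etaA in ea ja.
have sd : z_im tau kv ldiff%:C = 0 by rewrite z_imE /= mul0r.
rewrite z_reE sd etaD in ed jd.
have thr := theta_real hd.
(* The factor sqrt 6 of [theta] is split off as the scale [x], since the real estimates are stated
   for theta / sqrt 6. *)
rewrite ldE; apply: (@gram_neq0 R th k kap P (Im lac / k) B lac (Num.sqrt 6)
  (Re (th ldiff%:C) / Num.sqrt 6)) => //.
- by rewrite -ldE [LHS]thr; congr (_%:C); rewrite mulrC divfK// gt_eqF.
- exact: theta_conj.
- have tr : Im (th ldiff%:C * ((Num.sqrt 6)^-1)%:C) = 0 by rewrite thr -rmorphM.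
  have [e he hre] := diff_data B0 Bk ed jd tr.
  by exists e => //; rewrite -hre ReZr.
- have := ac_data P0 Pk s0 ea ja.
  by rewrite ReZr ImZr.
Qed.

Let H := Hmx tau k Q ldiff lac.
Let Hh := Hhat k th ldiff%:C lac (conjc lac).
Let L := Lambda_mx ldiff lac lshear.

Lemma HmxE : H = Qtilde Q *m Hh. Proof. by []. Qed.

Lemma det_Hmx : \det H = \det Hh.
Proof. by rewrite HmxE det_mulmx det_Qtilde// mul1r. Qed.

Lemma det_Hh_neq0 : \det Hh != 0.
Proof.
rewrite det_Hhat; apply: mulf_neq0; last exact: gram_hydro.
apply: mulf_neq0; last by rewrite invr_eq0 (fmorph_eq0 (real_complex R)).
by apply/eqP => /(congr1 (@complex.Im R)) /= /eqP; rewrite oner_eq0.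
Qed.

Lemma Hmx_unit : H \in unitmx.
Proof. by rewrite unitmxE unitfE det_Hmx det_Hh_neq0. Qed.

Lemma Hmx_conj : H *m L *m invmx H =
  Qtilde Q *m Cmx k th ldiff%:C lac (conjc lac) lshear%:C *m (Qtilde Q)^T.
Proof.
rewrite HmxE; apply: mulmx_orth_conj; first exact: Qtilde_orth.
  exact: Hmx_unit.
exact: Hhat_diag kn det_Hh_neq0.
Qed.

Lemma Hmx_eigen lam (y : 'cV[C]_5) (x : 'cV[C]_5) : L *m y = lam *: y -> x = H *m y ->
  lam *: x = H *m L *m invmx H *m x.
Proof.
by move=> hy ->; apply: mulmx_conj_eigen => //; exact: Hmx_unit.
Qed.

Lemma Lambda_delta (j : 'I_5) : L *m delta_mx j 0 =
  (nth 0 [:: ldiff%:C; lac; conjc lac; lshear%:C; lshear%:C] j) *: (delta_mx j 0 : 'cV[C]_5).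
Proof.
apply/matrixP => i l; rewrite /L /Lambda_mx mul_diag_mx !mxE ord1 /=.
by have [->|_] := eqVneq i j; rewrite ?mulr0.
Qed.

(** The moment vector of any eigenfunction is a combination of the columns of [H] with the same
    eigenvalue, so the conjugated matrix acts on it as [lam]. This is the hypothesis on [M] in the
    evolution section. *)
Lemma Hmx_moments lam g : lam \in hydro_eigenvalues ldiff lac lshear ->
  eigenfunction tau kv lam g -> lam *: moments g = H *m L *m invmx H *m moments g.
Proof.
move=> hl hg; have := hl; have /andP[hs _] := strip hl.
have long (j : 'I_5) : lam = nth 0 [:: ldiff%:C; lac; conjc lac; lshear%:C; lshear%:C] j ->
    Hh *m delta_mx j 0 = long_col tau kv lam -> crit lam != 1 ->
    lam *: moments g = H *m L *m invmx H *m moments g.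
  move=> lE hc hcr; have [/(_ g hg)[a ha] _ _] := long_data hl hcr.
  apply: (@Hmx_eigen lam (a *: delta_mx j 0)).
    by rewrite -scalemxAr Lambda_delta -lE !scalerA mulrC.
  by rewrite ha -hc HmxE -scalemxAr mulmxA.
have nr := sf_ac sf.
rewrite /hydro_eigenvalues !inE => /or4P[] /eqP lE.
- apply: (long 0) => //; last by rewrite lE crit_diff.
  rewrite -colE lE; apply/matrixP => i l; rewrite !mxE ord1.
  by elim/ord5_ind: i.
- apply: (long 1) => //; last by apply: crit_nonreal => //; rewrite lE gt_eqF.
  rewrite -colE lE; apply/matrixP => i l; rewrite !mxE ord1.
  by elim/ord5_ind: i.
- apply: (long 2) => //; last first.
    by apply: crit_nonreal => //; rewrite lE; case: (lac) nr => a b /= b0; rewrite oppr_eq0 gt_eqF.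
  rewrite -colE lE; apply/matrixP => i l; rewrite !mxE ord1.
  by elim/ord5_ind: i.
have hs' : - tau^-1 < Re lshear%:C by rewrite -lE.
have he : eigenspace_of tau kv lshear%:C g by rewrite -lE; case: hg.
have [a [b hab]] := shear_form tau0 k0 al hs' (sf_shear_geo sf) he.
apply: (@Hmx_eigen lam (a *: delta_mx 3 0 + b *: delta_mx 4 0)).
  by rewrite mulmxDr -!scalemxAr !Lambda_delta lE scalerDr !scalerA /= ![_ * lshear%:C]mulrC.
rewrite hab HmxE -mulmxA.
congr (_ *m _); rewrite mulmxDr -!scalemxAr -!colE; congr (_ *: _ + _ *: _).
  by apply/matrixP => i l; rewrite !mxE ord1; elim/ord5_ind: i.
by apply/matrixP => i l; rewrite !mxE ord1; elim/ord5_ind: i.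
Qed.

End Hydrodynamics.
Theorem mainTheorem2 (R : realType) (tau : R) (kk : 'cV[int]_3)
    (Q : 'M[R]_3) (ldiff : R) (lac : R[i]) (lshear : R) :
  let kv := wavevec R kk in
  let k := enorm kv in
  let H := Hmx tau k Q ldiff lac in
  let Lambda := Lambda_mx ldiff lac lshear in
  let th := theta tau k in
  let c1 := C1 k (\det H) th ldiff%:C lac lac^* in
  let c2 := C2 k (\det H) th ldiff%:C lac lac^* in
  let c3 := C3 k (\det H) ldiff%:C lac lac^* in
  let c4 := C4 k (\det H) th ldiff%:C lac lac^* in
  let c5 := C5 (\det H) th ldiff%:C lac lac^* in
  let c6 := C6 k (\det H) th ldiff%:C lac lac^* in
  let s := lshear%:C in
  0 < tau -> 0 < k -> k < kcrit_min tau ->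
  aligns Q kv ->
  spectral_facts tau kv ldiff lac lshear ->
  [/\ H \in unitmx,
      forall (I : interval R) (fhat : R -> R3 R -> R[i]),
        hydro_solution tau kv ldiff lac lshear I fhat ->
        forall t, t \in I ->
          is_deriv_C I (fun t => moments (fhat t)) t
            (H *m Lambda *m invmx H *m moments (fhat t)),
      H *m Lambda *m invmx H =
        Qtilde Q *m mx_of_rows 5 5
          [:: [:: 0;  - 'i%C * k%:C; 0; 0; 0];
              [:: c1; c2;          0; 0; c3];
              [:: 0;  0;           s; 0; 0];
              [:: 0;  0;           0; s; 0];
              [:: c4; c5;          0; 0; c6]] *m (Qtilde Q)^T,
      [/\ purely_imaginary c1, purely_imaginary c3 & purely_imaginary c5] &
      [/\ is_real c2, is_real c4 & is_real c6]].
Proof.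
move=> kv k H Lambda th c1 c2 c3 c4 c5 c6 s tau0 k0 _ al sf.
have hQ : orth3 Q by case: al.
have kn : k != 0 by rewrite gt_eqF.
(* The rotation has determinant one, so the coefficients may be computed with the determinant of
   [Hhat]. *)
have dE : \det H = \det (Hhat k th ldiff%:C lac lac^*) := det_Hmx tau ldiff lac al.
have /andP[ha _] := strip sf (mem_ac ldiff lac lshear).
have /andP[hd _] := strip sf (mem_diff ldiff lac lshear).
have [[r1 r3 r5] [r2 r4 r6]] := coeffs_reality k (theta_real tau0 k0 hd) (theta_conj tau0 k0 ha).
split.
- exact: (Hmx_unit tau0 k0 al sf).
- move=> I fhat hs t tI; apply: hydro_solution_moments hs tI => lam g hl hg.
  exact: (Hmx_moments tau0 k0 al sf hl hg).
- by rewrite (Hmx_conj tau0 k0 al sf) /Cmx -dE.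
- by rewrite /purely_imaginary /c1 /c3 /c5 dE.
- by rewrite /is_real /c2 /c4 /c6 dE.
Qed.
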